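(* Let $\Bbbk$ be an algebraically closed field and let $A$ be a quadratic quantum $\mathbb{P}^2$ over $\Bbbk$. If $\operatorname{char}(\Bbbk)=3$, then the point scheme of $A$ is not a cuspidal cubic curve in $\mathbb{P}^2$. If $\operatorname{char}(\Bbbk)\neq3$ and if the point scheme of $A$ is a cuspidal cubic curve in $\mathbb{P}^2$, then $A$ is isomorphic to a quadratic algebra on three generators $x_1,x_2,x_3$ with defining relations $$x_1x_2=x_2x_1+x_1^2,\qquad x_3x_1=x_1x_3+x_1^2+3x_2^2,\qquad x_3x_2=x_2x_3-3x_2^2-2x_1x_3-2x_1x_2.$$ Moreover, any quadratic algebra over $\Bbbk$ with these defining relations is a quadratic quantum $\mathbb{P}^2$; it has point scheme given by a cuspidal cubic curve in $\mathbb{P}^2$ if and only if $\operatorname{char}(\Bbbk)\neq3$.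
   Context: Regular algebras. A graded $\Bbbk$-algebra $A=\bigoplus_{n\ge 0}A_n$ with $A_0=\Bbbk$, generated by the finite-dimensional space $A_1$, is regular (in the sense of Artin–Schelter) of global dimension $d$ if it has finite global dimension $d$, has polynomial growth, and is Gorenstein, i.e. $\operatorname{Ext}^i_A(\Bbbk,A)=0$ for $i\ne d$ and $\operatorname{Ext}^d_A(\Bbbk,A)\cong\Bbbk$ up to a degree shift. It is quadratic if its defining relations are spanned by a subspace $W\subset A_1\otimes_\Bbbk A_1$. A quadratic quantum $\mathbb{P}^2$ is a quadratic regular algebra of global dimension three (generated in degree one, $\dim A_1=3$). Point scheme. Identify $\mathbb{P}^2$ with $\mathbb{P}(A_1^* )$. The zero locus of $W$ in $\mathbb{P}(A_1^* )\times\mathbb{P}(A_1^* )$ is (Artin–Tate–Van den Bergh) the graph of an automorphism $\sigma$ of a closed subscheme $C\subset\mathbb{P}^2$, where $C$ is either $\mathbb{P}^2$ or a cubic divisor; $C$ is the point scheme of $A$. A cuspidal cubic curve in $\mathbb{P}^2$ is a cubic divisor which, after a linear change of the homogeneous coordinates $x,y,z$, is the zero locus of $y^3+x^2z$ or, when $\operatorname{char}(\Bbbk)=3$, of $y^3+x^2z$ or of $y^3+x^2z+xy^2$. *)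

(* Defs.v *)
From HB Require Import structures.
From mathcomp Require Import all_boot all_order all_algebra.
(* monalg also defines a notation {mpoly _[_]}, hiding the one of mpoly. *)
From mathcomp.multinomials Require Import -(notations) monalg.
From mathcomp.multinomials Require Import mpoly.

Set Implicit Arguments.
Unset Strict Implicit.
Unset Printing Implicit Defensive.

Import GRing.Theory.
Local Open Scope ring_scope.

(** ** Gradings *)

Definition internal_direct_sum (I : eqType) (V : zmodType)
    (gr : I -> V -> Prop) : Prop :=
  [/\ forall i, gr i 0,
      forall i u v, gr i u -> gr i v -> gr i (u - v),
      forall v, exists (s : seq I) (w : I -> V),
        (forall i, gr i (w i)) /\ v = \sum_(i <- s) w i
    & forall (s : seq I) (w : I -> V), uniq s -> (forall i, gr i (w i)) ->
        \sum_(i <- s) w i = 0 -> forall i, i \in s -> w i = 0].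

(* A connected graded algebra generated in degree one.  That each [gr n] is
   closed under scalars follows from [gr 0] being the scalars. *)
Record graded_algebra (k : fieldType) (A : algType k)
    (gr : nat -> A -> Prop) : Prop := {
  ga_sum : internal_direct_sum gr;
  ga_mul : forall m n a b, gr m a -> gr n b -> gr (m + n)%N (a * b);
  ga_connected : forall a, gr 0%N a <-> exists c : k, a = c%:A;
  ga_generated : forall S : A -> Prop,
    S 1 -> (forall (c : k) a b, S a -> S b -> S (c *: a + b)) ->
    (forall a b, S a -> S b -> S (a * b)) ->
    (forall a, gr 1%N a -> S a) -> forall a, S a }.

Definition dim_le (k : fieldType) (V : lmodType k) (U : V -> Prop)
    (N : nat) : Prop :=
  exists v : 'I_N -> V, (forall i, U (v i)) /\
    forall a, U a -> exists c : 'I_N -> k, a = \sum_i c i *: v i.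

Definition polynomial_growth (k : fieldType) (A : algType k)
    (gr : nat -> A -> Prop) : Prop :=
  exists c e : nat, forall n, dim_le (gr n) (c * n.+1 ^ e)%N.

(** ** Projective resolutions and global dimension

   Modules are left modules; for connected graded algebras the left and right
   global dimensions agree. *)

Definition projective (R : nzRingType) (P : lmodType R) : Prop :=
  forall (M N : lmodType R) (f : {linear M -> N}) (g : {linear P -> N}),
    (forall y, exists x, f x = y) ->
    exists h : {linear P -> M}, forall x, f (h x) = g x.

Record projective_resolution (R : nzRingType) (M : lmodType R)
    (P : nat -> lmodType R) (dP : forall i, {linear P i.+1 -> P i})
    (e : {linear P 0%N -> M}) : Prop := {
  pr_projective : forall i, projective (P i);
  pr_onto : forall m, exists y, e y = m;
  pr_exact0 : forall y, e y = 0 <-> exists z, y = dP 0%N z;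
  pr_exact : forall i y, dP i y = 0 <-> exists z, y = dP i.+1 z }.

Definition proj_dim_le (R : nzRingType) (M : lmodType R) (d : nat) : Prop :=
  exists (P : nat -> lmodType R) (dP : forall i, {linear P i.+1 -> P i})
         (e : {linear P 0%N -> M}),
    projective_resolution dP e /\
    forall i, (d < i)%N -> forall y : P i, y = 0.

Definition global_dim_le (R : nzRingType) (d : nat) : Prop :=
  forall M : lmodType R, proj_dim_le M d.

Definition global_dim_eq (R : nzRingType) (d : nat) : Prop :=
  global_dim_le R d /\ forall n, global_dim_le R n -> (d <= n)%N.

(** ** The Gorenstein condition *)

Section Gorenstein.
Variables (k : fieldType) (A : algType k) (gr : nat -> A -> Prop).

Definition int_grading (n : int) (a : A) : Prop :=
  match n with Posz m => gr m a | Negz _ => a = 0 end.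

Definition graded_module (M : lmodType A) (grM : int -> M -> Prop) : Prop :=
  internal_direct_sum grM /\
  forall (m : nat) (n : int) (a : A) (v : M),
    gr m a -> grM n v -> grM (m%:Z + n) (a *: v).

(* [K] is isomorphic to A / A_{>0}, i.e. to the trivial module k. *)
Definition trivial_module (K : lmodType A) : Prop :=
  exists k0 : K,
    [/\ k0 != 0,
        forall v, exists c : k, v = (c%:A : A) *: k0
      & forall (n : nat) (a : A) (v : K), (0 < n)%N -> gr n a -> a *: v = 0].

Variables (P : nat -> lmodType A) (dP : forall i, {linear P i.+1 -> P i})
          (grP : forall i, int -> P i -> Prop).

Record graded_resolution_of_trivial (K : lmodType A)
    (e : {linear P 0%N -> K}) : Prop := {
  gt_trivial : trivial_module K;
  gt_resolution : projective_resolution dP e;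
  gt_graded : forall i, graded_module (@grP i);
  gt_dP : forall i n y, @grP i.+1 n y -> @grP i n (dP i y);
  gt_e : forall n y, n != 0 -> @grP 0%N n y -> e y = 0 }.

(* Left A-linear maps P_i -> A of degree [n]. *)
Definition hom_degree (i : nat) (n : int) (f : {linear P i -> A^o}) : Prop :=
  forall j y, @grP i j y -> int_grading (j + n) (f y).

Definition cocycle (i : nat) (n : int) (f : {linear P i -> A^o}) : Prop :=
  hom_degree n f /\ forall y, f (dP i y) = 0.

Definition coboundary (i : nat) (n : int) : (P i -> A) -> Prop :=
  match i with
  | 0 => fun f => forall y, f y = 0
  | j.+1 => fun f => exists g : {linear P j -> A^o},
      hom_degree n g /\ forall y, f y = g (dP j y)
  end.

(* The degree [n] component of Ext^i_A(k, A) = H^i(Hom_A(P, A)) is zero. *)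
Definition Ext_zero (i : nat) (n : int) : Prop :=
  forall f : {linear P i -> A^o}, cocycle n f -> coboundary n f.

(* The degree [n] component of Ext^i_A(k, A) has dimension one. *)
Definition Ext_line (i : nat) (n : int) : Prop :=
  exists f0 : {linear P i -> A^o},
    [/\ cocycle n f0, ~ coboundary n f0
      & forall f : {linear P i -> A^o}, cocycle n f ->
          exists c : k, coboundary n (fun y => (f y : A) - c *: (f0 y : A))].

End Gorenstein.

(* Ext^i(k, A) = 0 for i <> d and Ext^d(k, A) = k up to a degree shift. The
   cohomology does not depend on the chosen graded projective resolution. *)
Definition gorenstein (k : fieldType) (A : algType k) (gr : nat -> A -> Prop)
    (d : nat) : Prop :=
  exists (K : lmodType A) (P : nat -> lmodType A)
         (dP : forall i, {linear P i.+1 -> P i})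
         (grP : forall i, int -> P i -> Prop) (e : {linear P 0%N -> K}),
    [/\ graded_resolution_of_trivial gr dP grP e,
        forall i n, i != d -> Ext_zero gr dP grP i n
      & exists l : int, Ext_line gr dP grP d l /\
          forall n, n != l -> Ext_zero gr dP grP d n].

Record regular_algebra (k : fieldType) (A : algType k)
    (gr : nat -> A -> Prop) (d : nat) : Prop := {
  reg_graded : graded_algebra gr;
  reg_findim : exists N, dim_le (gr 1%N) N;
  reg_gldim : global_dim_eq A d;
  reg_growth : polynomial_growth gr;
  reg_gorenstein : gorenstein gr d }.

(** ** Quadratic algebras *)

(* The free algebra on n generators, i.e. the tensor algebra of k^n. *)
Notation free_alg k n := (malg (fmonom 'I_n) k).

Definition free_gen (k : fieldType) (n : nat) (i : 'I_n) : free_alg k n :=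
  mkmalgU (fmu i) 1.

Definition eval_free (k : fieldType) (n : nat) (A : algType k)
    (x : 'I_n -> A) (f : free_alg k n) : A :=
  monalg.mmap (in_alg A) (fun m : fmonom 'I_n => \prod_(i <- fmonom_val m) x i) f.

(* A matrix w stands for the tensor \sum_(i, j) w i j x_i (x) x_j. *)
Definition quad_tensor (k : fieldType) (n : nat) (w : 'M[k]_n) : free_alg k n :=
  \sum_i \sum_j w i j *: (free_gen k i * free_gen k j).

Definition in_quad_ideal (k : fieldType) (n : nat) (W : {vspace 'M[k]_n})
    (f : free_alg k n) : Prop :=
  exists (m : nat) (a b : 'I_m -> free_alg k n) (w : 'I_m -> 'M[k]_n),
    (forall i, w i \in W) /\ f = \sum_i a i * quad_tensor (w i) * b i.

(* (A, gr) is T(k^n) / (W) as a graded algebra, with generators the x_i in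
   degree one; in particular the x_i form a basis of [gr 1]. *)
Record quadratic_algebra (k : fieldType) (A : algType k)
    (gr : nat -> A -> Prop) (n : nat) (x : 'I_n -> A)
    (W : {vspace 'M[k]_n}) : Prop := {
  qa_onto : forall a, exists f, a = eval_free x f;
  qa_kernel : forall f, eval_free x f = 0 <-> in_quad_ideal W f;
  qa_grading : forall m a, gr m a <->
    exists c : m.-tuple 'I_n -> k,
      a = \sum_(t : m.-tuple 'I_n) c t *: \prod_(i <- t) x i }.

Definition quadratic_quantum_P2 (k : closedFieldType) (A : algType k)
    (gr : nat -> A -> Prop) : Prop :=
  regular_algebra gr 3 /\
  exists (x : 'I_3 -> A) (W : {vspace 'M[k]_3}), quadratic_algebra gr x W.

Definition graded_isomorphic (k : fieldType) (A B : algType k)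
    (grA : nat -> A -> Prop) (grB : nat -> B -> Prop) : Prop :=
  exists f : {lrmorphism A -> B},
    bijective f /\ forall n a, grA n a <-> grB n (f a).

(** ** Point scheme

   Schemes are handled through their points over local k-algebras R: an
   R-point of P^2 is then a triple with an invertible entry, up to a unit.  A
   closed subscheme of a projective scheme and a morphism between projective
   schemes are determined by their R-points for all such R, and a morphism of
   finite type k-schemes is an isomorphism as soon as it is bijective on them. *)

Section Points.
Variables (k : fieldType) (R : comUnitAlgType k).

Definition local_ring : Prop :=
  forall a b : R, a + b \is a GRing.unit ->
    a \is a GRing.unit \/ b \is a GRing.unit.

Definition proj_point (p : 'I_3 -> R) : Prop := exists i, p i \is a GRing.unit.

Definition same_point (p q : 'I_3 -> R) : Prop :=
  exists2 u : R, u \is a GRing.unit & forall i, q i = u * p i.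

Definition on_subscheme (I : {mpoly k[3]} -> Prop) (p : 'I_3 -> R) : Prop :=
  forall F, I F -> mpoly.mmap (in_alg R) p F = 0.

Definition on_zero_locus (W : {vspace 'M[k]_3}) (p q : 'I_3 -> R) : Prop :=
  forall w, w \in W -> \sum_i \sum_j w i j *: (p i * q j) = 0.

End Points.

(* The zero locus of W in P^2 x P^2 is the graph of an automorphism of the
   closed subscheme of P^2 cut out by the homogeneous forms in I. *)
Definition is_point_scheme (k : fieldType) (W : {vspace 'M[k]_3})
    (I : {mpoly k[3]} -> Prop) : Prop :=
  (forall F, I F -> exists d, F \is d.-homog) /\
  forall R : comUnitAlgType k, local_ring R ->
    [/\ forall p q : 'I_3 -> R, proj_point p -> proj_point q ->
          on_zero_locus W p q -> on_subscheme I p /\ on_subscheme I q,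
        forall p : 'I_3 -> R, proj_point p -> on_subscheme I p ->
          exists q, [/\ proj_point q, on_zero_locus W p q
            & forall q', proj_point q' -> on_zero_locus W p q' ->
                same_point q q']
      & forall q : 'I_3 -> R, proj_point q -> on_subscheme I q ->
          exists p, [/\ proj_point p, on_zero_locus W p q
            & forall p', proj_point p' -> on_zero_locus W p' q ->
                same_point p p']].

Definition linear_change (k : fieldType) (g : 'M[k]_3) (F : {mpoly k[3]}) :
    {mpoly k[3]} :=
  F \mPo [tuple \sum_(j < 3) g i j *: 'X_j | i < 3].

Definition cuspidal_cubic (k : fieldType) (F : {mpoly k[3]}) : Prop :=
  let X : {mpoly k[3]} := 'X_(@inord 2 0) in
  let Y : {mpoly k[3]} := 'X_(@inord 2 1) in
  let Z : {mpoly k[3]} := 'X_(@inord 2 2) in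
  exists2 g : 'M[k]_3, g \in unitmx &
    F = linear_change g (Y ^+ 3 + X ^+ 2 * Z) \/
    (3%N \in [pchar k] /\
     F = linear_change g (Y ^+ 3 + X ^+ 2 * Z + X * Y ^+ 2)).

(* The generators x provide the homogeneous coordinates on P(A_1^* ); since
   [cuspidal_cubic] is invariant under linear changes of coordinates, the
   choice of presentation is immaterial. *)
Definition has_cuspidal_point_scheme (k : closedFieldType) (A : algType k)
    (gr : nat -> A -> Prop) : Prop :=
  exists (x : 'I_3 -> A) (W : {vspace 'M[k]_3}),
    quadratic_algebra gr x W /\
    exists F, cuspidal_cubic F /\ is_point_scheme W (fun G => G = F).

(** ** The relations
   x1 x2 = x2 x1 + x1^2,
   x3 x1 = x1 x3 + x1^2 + 3 x2^2,
   x3 x2 = x2 x3 - 3 x2^2 - 2 x1 x3 - 2 x1 x2;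
   [t i j] stands for the tensor x_i (x) x_j, with i, j in {1, 2, 3}. *)

Definition cusp_relations (k : fieldType) : {vspace 'M[k]_3} :=
  let t (i j : nat) : 'M[k]_3 := delta_mx (inord i.-1) (inord j.-1) in
  <<[:: t 1%N 2%N - (t 2%N 1%N + t 1%N 1%N);
        t 3%N 1%N - (t 1%N 3%N + t 1%N 1%N + 3%:R *: t 2%N 2%N);
        t 3%N 2%N - (t 2%N 3%N - 3%:R *: t 2%N 2%N
                     - 2%:R *: t 1%N 3%N - 2%:R *: t 1%N 2%N)]>>%VS.

(* Main.v *)
(** Let V be the space of generators and W the space of relations.  For a regular
    algebra of global dimension three, projectivity of the third syzygy of the
    trivial module and the Gorenstein condition produce a nonzero tensor T in
    the intersection of V (x) W and W (x) V.  If the point scheme is the cuspidal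
    cubic y^3 + x^2 z + e x y^2, its points over k and over the dual numbers show
    that sigma fixes the cusp and maps (1, t, _) to (1, a t + b, _), so that W
    consists of the bilinear forms vanishing on the graph of t |-> a t + b.
    If 3 b + e (1 - a) = 0, the zero locus of W is larger than this graph;
    otherwise T exists only for a = 1.  Hence 3 b <> 0, so e = 0, and rescaling
    makes b = 1.

    Conversely, the algebra with the given relations has the basis
    x3^c x2^b x1^a and comes from a superpotential.  The associated Koszul complex
    of any module is exact, because for the weights 1, 2, 4 its leading part is
    the Koszul complex of a polynomial ring; the dual complex of the trivial
    module is carried back to the complex itself by the antiautomorphism
    x1 |-> - x1.  The point scheme is read off from the determinant
    - 3 (y^3 + x^2 z) of the multilinearized relations. *)

Require Import Defs.
From HB Require Import structures.
From mathcomp Require Import all_boot all_order all_algebra.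
From mathcomp Require Import finmap.
From mathcomp.multinomials Require Import -(notations) mpoly.
From mathcomp.multinomials Require Import -(notations) monalg.
From mathcomp Require boolp classical_sets.
From mathcomp Require Import ring zify.
Set Implicit Arguments.
Unset Strict Implicit.
Unset Printing Implicit Defensive.
Import GRing.Theory.
Local Open Scope ring_scope.

(** * Free algebras *)

(** Regularity speaks of arbitrary resolutions, while W is visible only in the Koszul complex, of
    which quadraticity gives exactness in the first terms only. Comparing two beginnings of
    resolutions up to homotopy carries Ext groups and projective dimension over. On the curve,
    bijectivity on points over k does not by itself fix the cusp. The dual numbers do it: the
    tangent space has dimension two at the cusp and one at a smooth point. The point (1, 0, 1),
    which is off the curve, serves twice: having no partner, it forces W to be large, and it is the
    point that would acquire a partner if 3 b + e (1 - a) were zero. The relations of the theorem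
    turn out to be the forms vanishing on the graph of the translation t |-> t + 1 of y^3 + x^2 z.
    Conversely, global dimension quantifies over all modules, so exactness is needed for the complex
    with terms built from A (x) M, M arbitrary; the resolution used for the Gorenstein condition is
    the case of the trivial module. *)

Notation "<< z *g k >>" := (mkmalgU k z) (format "<< z *g k >>") : ring_scope.

Section FinSum.
Variables (K : choiceType) (G V : zmodType) (psi : K -> G -> V).

Definition malg_sum (g : malg K G) : V := \sum_(t <- msupp g) psi t (mcoeff t g).

Hypothesis psiB : forall t u v, psi t (u - v) = psi t u - psi t v.

Let psi0 t : psi t 0 = 0. Proof. by rewrite -(subrr 0) psiB subrr. Qed.

Lemma malg_sumEw (d : {fset K}) g : (msupp g `<=` d)%fset ->
  malg_sum g = \sum_(t <- d) psi t (mcoeff t g).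
Proof.
by move=> le; apply: big_fset_incl => // t _ /mcoeff_outdom ->.
Qed.

Lemma malg_sumU t u : malg_sum << u *g t >> = psi t u.
Proof. by rewrite (malg_sumEw msuppU_le) big_seq_fset1 mcoeffUU. Qed.

Lemma malg_sumB g h : malg_sum (g - h) = malg_sum g - malg_sum h.
Proof.
pose d := (msupp g `|` msupp h)%fset.
rewrite (@malg_sumEw d) ?msuppB_le // (@malg_sumEw d g) ?fsubsetUl //.
rewrite (@malg_sumEw d h) ?fsubsetUr // -sumrB.
by apply: eq_bigr => t _; rewrite mcoeffB psiB.
Qed.

End FinSum.

Section Additive.
Variables (U V : zmodType) (f : U -> V).
Hypothesis fB : forall u v, f (u - v) = f u - f v.

Lemma additive0 : f 0 = 0. Proof. by rewrite -(subrr 0) fB subrr. Qed.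

Lemma additiveN u : f (- u) = - f u.
Proof. by rewrite -sub0r fB additive0 sub0r. Qed.

Lemma additiveD u v : f (u + v) = f u + f v.
Proof. by rewrite -{1}[v]opprK fB additiveN opprK. Qed.

Lemma additive_sum (I : Type) (s : seq I) (P : pred I) (F : I -> U) :
  f (\sum_(i <- s | P i) F i) = \sum_(i <- s | P i) f (F i).
Proof. by elim/big_rec2: _ => [|i u v _ <-]; rewrite ?additive0 ?additiveD. Qed.

End Additive.

Lemma malg_ext (K : choiceType) (G V : zmodType) (f g : malg K G -> V) :
  (forall u v, f (u - v) = f u - f v) -> (forall u v, g (u - v) = g u - g v) ->
  (forall t u, f << u *g t >> = g << u *g t >>) -> f =1 g.
Proof.
move=> fB gB fg h; rewrite [h]monalgE (additive_sum fB) (additive_sum gB).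
exact: eq_bigr.
Qed.

Lemma linear_of (R : nzRingType) (U V : lmodType R) (f : U -> V) :
  (forall u v, f (u - v) = f u - f v) -> (forall a u, f (a *: u) = a *: f u) ->
  {g : {linear U -> V} | g =1 f}.
Proof.
move=> fB fZ.
have f_lin : linear f by move=> a u v; rewrite (additiveD fB) fZ.
pose g : {linear U -> V} := HB.pack f (GRing.isLinear.Build R U V *:%R f f_lin).
by exists g.
Qed.

Lemma malgUZ (K : choiceType) (R : nzRingType) (c b : R) (t : K) :
  c *: << b *g t >> = << c * b *g t >>.
Proof. by apply/malgP => l; rewrite mcoeffZ !mcoeffU mulrnAr. Qed.

Lemma malg_scaleAr (K : monomType) (R : comNzRingType) (c : R) (f g : malg K R) :
  c *: (f * g) = f * (c *: g).
Proof.
apply: (malg_ext (f := fun f => c *: (f * g)) (g := fun f => f * (c *: g))) f.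
- by move=> u v /=; rewrite mulrBl scalerBr.
- by move=> u v /=; rewrite mulrBl.
move=> s a; move: g; apply: malg_ext => [u v|u v|t b].
- by rewrite mulrBr scalerBr.
- by rewrite scalerBr mulrBr.
by rewrite malgUZ !malgM_def !fgmulUU malgUZ mulrCA.
Qed.

Lemma linear_sub (R : pzRingType) (U V : lmodType R) (p : U -> V) :
  linear p -> forall u v, p (u - v) = p u - p v.
Proof. by move=> pL u v; have := pL (-1) v u; rewrite !scaleN1r ![- _ + _]addrC. Qed.

Lemma linear_Z (R : pzRingType) (U V : lmodType R) (p : U -> V) :
  linear p -> forall a u, p (a *: u) = a *: p u.
Proof.
move=> pL a u; have := pL a u 0.
by rewrite (additive0 (linear_sub pL)) !addr0.
Qed.

Section FreeAlgebra.
Variables (k : fieldType) (n : nat).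
Implicit Types (f g : free_alg k n) (m : fmonom 'I_n).

Definition word (s : seq 'I_n) : free_alg k n := << 1 *g FMonom s >>.

Lemma word0 : word [::] = 1.
Proof. by rewrite /word -fmoneE. Qed.

Lemma word_cat s t : word (s ++ t) = word s * word t.
Proof. rewrite /word malgM_def fgmulUU mulr1; congr mkmalgU; exact/esym/fmmulE. Qed.

Lemma word1 i : word [:: i] = free_gen k i.
Proof. by rewrite /word /free_gen fmuE. Qed.

Lemma malgU_word (c : k) m : << c *g m >> = c *: word m.
Proof. by rewrite /word (malgUZ c) mulr1 fmK. Qed.

Lemma free_ext (V : lmodType k) (p q : free_alg k n -> V) :
  linear p -> linear q -> (forall s, p (word s) = q (word s)) -> p =1 q.
Proof.
move=> p_lin q_lin pq.
have pB := linear_sub p_lin; have qB := linear_sub q_lin.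
apply: malg_ext => // t c; rewrite malgU_word -[c *: _]addr0 p_lin q_lin pq.
by rewrite (additive0 pB) (additive0 qB).
Qed.

Definition words_to (V : lmodType k) (h : seq 'I_n -> V) : free_alg k n -> V :=
  malg_sum (fun m c => c *: h m).

Lemma words_to_linear (V : lmodType k) (h : seq 'I_n -> V) : linear (words_to h).
Proof.
have hB (m : fmonom 'I_n) (u v : k) : (u - v) *: h m = u *: h m - v *: h m.
  exact: scalerBl.
have wB u v : words_to h (u - v) = words_to h u - words_to h v.
  exact: malg_sumB hB u v.
move=> c u v; rewrite (additiveD wB); congr (_ + _).
move: u; apply: malg_ext => [u v'|u v'|m b].
- by rewrite scalerBr wB.
- by rewrite wB scalerBr.
transitivity (words_to h << c * b *g m >>); first by congr (words_to h _); apply: malgUZ.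
transitivity ((c * b) *: h m); first exact: malg_sumU.
by rewrite -scalerA; congr (_ *: _); apply/esym; apply: malg_sumU.
Qed.

Lemma words_toE (V : lmodType k) (h : seq 'I_n -> V) s : words_to h (word s) = h s.
Proof. by rewrite /words_to /word malg_sumU ?scale1r // => *; exact: scalerBl. Qed.

(** Centrality of the scalars is a hypothesis so that the target may be the free algebra itself,
    where [malg_scaleAr] supplies it; [subst_genM] needs this case. *)
Lemma words_to_mul (A : lalgType k) (h : seq 'I_n -> A) :
  (forall (c : k) (a b : A), a * (c *: b) = c *: (a * b)) ->
  (forall s t, h (s ++ t) = h s * h t) ->
  forall f g, words_to h (f * g) = words_to h f * words_to h g.
Proof.
move=> mulZr hM f g; have lin := words_to_linear h.
apply: (free_ext (p := fun f => words_to h (f * g))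
          (q := fun f => words_to h f * words_to h g)) f.
- by move=> c u v /=; rewrite mulrDl -scalerAl lin.
- by move=> c u v /=; rewrite lin mulrDl -scalerAl.
move=> s; move: g; apply: free_ext.
- by move=> c u v /=; rewrite mulrDr -malg_scaleAr lin.
- by move=> c u v /=; rewrite lin mulrDr mulZr.
by move=> t; rewrite -word_cat !words_toE.
Qed.

Lemma words_to_rmul (A : algType k) (h : seq 'I_n -> A) :
  (forall s t, h (s ++ t) = h t * h s) ->
  forall f g, words_to h (f * g) = words_to h g * words_to h f.
Proof.
move=> hM f g; have lin := words_to_linear h.
apply: (free_ext (p := fun f => words_to h (f * g))
          (q := fun f => words_to h g * words_to h f)) f.
- by move=> c u v /=; rewrite mulrDl -scalerAl lin.
- by move=> c u v /=; rewrite lin mulrDr -scalerAr.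
move=> s; move: g; apply: free_ext.
- by move=> c u v /=; rewrite mulrDr -malg_scaleAr lin.
- by move=> c u v /=; rewrite lin mulrDl -scalerAl.
by move=> t; rewrite -word_cat !words_toE.
Qed.

(** Deletes a final letter [i] and kills the words not ending in it. The augmentation ideal of the
    free algebra is a free left module on the generators, and these are its coordinates
    ([free_rdivE]). *)
Definition rdiv (i : 'I_n) : free_alg k n -> free_alg k n :=
  words_to (fun s => if s is j :: s' then
     if last j s' == i then word (belast j s') else 0 else 0).

Lemma rdiv_linear i : linear (rdiv i).
Proof. exact: words_to_linear. Qed.

Lemma rdivM_gen i f j : rdiv i (f * free_gen k j) = (j == i)%:R *: f.
Proof.
move: f; apply: free_ext => [c u v|c u v|s].
- by rewrite mulrDl -scalerAl rdiv_linear.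
- by rewrite scalerDr !scalerA mulrC.
rewrite -word1 -word_cat /rdiv words_toE cats1.
case: s => [|l s] /=; first by case: eqP; rewrite ?scale1r ?scale0r.
by rewrite last_rcons belast_rcons; case: eqP; rewrite ?scale1r ?scale0r.
Qed.

Lemma rdiv1 i : rdiv i 1 = 0.
Proof. by rewrite -word0 /rdiv words_toE. Qed.

Lemma free_rdivE f : exists c : k, f = c%:A + \sum_i rdiv i f * free_gen k i.
Proof.
pose h (s : seq 'I_n) : k^o := (s == [::])%:R.
exists (words_to h f).
pose q f : free_alg k n := words_to h f *: 1 + \sum_i rdiv i f * free_gen k i.
apply: (free_ext (p := id) (q := q)) f => [c u v|c u v|s]; first exact: erefl.
  rewrite /q.
  rewrite (words_to_linear h c).
  rewrite [_ *: 1]scalerDl.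
  rewrite [c *: (_ + _)]scalerDr.
  rewrite [RHS]addrACA.
  rewrite [c *: (words_to h u *: 1)]scalerA.
  congr (_ + _).
  rewrite [c *: (\sum_i _)]scaler_sumr -[RHS]big_split.
  apply: eq_bigr => i _.
  rewrite (rdiv_linear i c) [LHS]mulrDl -[in LHS]scalerAl. exact: erefl.
have -> : q (word s) = h s *: 1 + \sum_i rdiv i (word s) * free_gen k i.
  by rewrite -(words_toE h).
rewrite /h /=; case/lastP: s => [|s i].
  by rewrite scale1r word0 big1 ?addr0 // => i _; rewrite rdiv1 mul0r.
rewrite -cats1 word_cat word1 cats1.
have -> : (rcons s i == [::]) = false by case: s.
rewrite scale0r add0r (bigD1 i) //= rdivM_gen eqxx scale1r big1 ?addr0 //.
by move=> j ji; rewrite rdivM_gen eq_sym (negbTE ji) scale0r mul0r.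
Qed.

Lemma free_ind (P : free_alg k n -> Prop) :
  P 1 -> (forall c f g, P f -> P g -> P (c *: f + g)) ->
  (forall f i, P f -> P (f * free_gen k i)) -> forall f, P f.
Proof.
move=> P1 PD PM f; have P0 : P 0 by have := PD (-1) _ _ P1 P1; rewrite scaleN1r addNr.
have Pw s : P (word s).
  elim/last_ind: s => [|s i IHs]; first by rewrite word0.
  by rewrite -cats1 word_cat word1; apply: PM.
rewrite [f]monalgE; elim: (enum_fset _) => [|m s IHs]; first by rewrite big_nil.
by rewrite big_cons malgU_word; apply: PD.
Qed.

Section Eval.
Variables (A : algType k) (x : 'I_n -> A).

Lemma eval_freeE f : eval_free x f = words_to (fun s => \prod_(i <- s) x i) f.
Proof.
by rewrite /eval_free mmapE; apply: eq_bigr => m _; rewrite mulr_algl.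
Qed.

Lemma eval_free_linear : linear (eval_free x).
Proof. by move=> c f g; rewrite !eval_freeE words_to_linear. Qed.

Lemma eval_freeM f g : eval_free x (f * g) = eval_free x f * eval_free x g.
Proof.
rewrite !eval_freeE words_to_mul // => [c a b|s t]; rewrite ?scalerAr //; exact: big_cat.
Qed.

Lemma eval_freeD f g : eval_free x (f + g) = eval_free x f + eval_free x g.
Proof. by have := eval_free_linear 1 f g; rewrite !scale1r. Qed.

Lemma eval_free0 : eval_free x 0 = 0.
Proof. by have := eval_freeD 0 0; rewrite addr0 => /esym/eqP; rewrite -subr_eq0 addrK => /eqP. Qed.

Lemma eval_freeZ c f : eval_free x (c *: f) = c *: eval_free x f.
Proof. by rewrite -[c *: f]addr0 eval_free_linear eval_free0 addr0. Qed.

Lemma eval_freeB f g : eval_free x (f - g) = eval_free x f - eval_free x g.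
Proof. by rewrite eval_freeD -scaleN1r eval_freeZ scaleN1r. Qed.

Lemma eval_free_word s : eval_free x (word s) = \prod_(i <- s) x i.
Proof. by rewrite eval_freeE words_toE. Qed.

Lemma eval_free1 : eval_free x 1 = 1.
Proof. by rewrite -word0 eval_free_word big_nil. Qed.

Lemma eval_free_gen i : eval_free x (free_gen k i) = x i.
Proof. by rewrite -word1 eval_free_word big_seq1. Qed.

Lemma eval_free_sum (I : Type) (s : seq I) (F : I -> free_alg k n) :
  eval_free x (\sum_(i <- s) F i) = \sum_(i <- s) eval_free x (F i).
Proof. exact: additive_sum eval_freeB _ _ _ _. Qed.

Lemma eval_free_quad w :
  eval_free x (quad_tensor w) = \sum_i \sum_j w i j *: (x i * x j).
Proof.
rewrite eval_free_sum; apply: eq_bigr => i _; rewrite eval_free_sum.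
by apply: eq_bigr => j _; rewrite eval_freeZ eval_freeM !eval_free_gen.
Qed.

Lemma eval_free_ideal (W : {vspace 'M[k]_n}) f : (forall w, w \in W -> eval_free x (quad_tensor w) = 0) ->
  in_quad_ideal W f -> eval_free x f = 0.
Proof.
move=> xW [m [a [b [w [wW ->]]]]]; rewrite eval_free_sum big1 // => i _.
by rewrite !eval_freeM xW // mulr0 mul0r.
Qed.

End Eval.

Lemma eval_free_comp (A B : algType k) (x : 'I_n -> A) (p : A -> B) f :
  linear p -> p 1 = 1 -> (forall a b, p (a * b) = p a * p b) ->
  p (eval_free x f) = eval_free (p \o x) f.
Proof.
move=> p_lin p1 pM; move: f; apply: free_ind => [|c f g IHf IHg|f i IHf].
- by rewrite !eval_free1.
- by rewrite !eval_free_linear p_lin IHf IHg.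
- by rewrite !eval_freeM pM IHf !eval_free_gen.
Qed.

Lemma quad_tensor_ideal (W : {vspace 'M[k]_n}) w :
  w \in W -> in_quad_ideal W (quad_tensor w).
Proof.
move=> wW; exists 1%N, (fun=> 1), (fun=> 1), (fun=> w); split=> //.
by rewrite big_ord1 mul1r mulr1.
Qed.

End FreeAlgebra.

(** * Quadratic algebras *)

Section Spans.
Variables (k : fieldType) (A : algType k) (n : nat) (x : 'I_n -> A).

Definition word_span m (a : A) : Prop :=
  exists c : m.-tuple 'I_n -> k,
    a = \sum_(t : m.-tuple 'I_n) c t *: \prod_(i <- t) x i.

Lemma word_span0 m : word_span m 0.
Proof. by exists (fun=> 0); rewrite big1 // => t _; rewrite scale0r. Qed.

Lemma word_span_lin m c a b : word_span m a -> word_span m b -> word_span m (c *: a + b).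
Proof.
case=> [p ->] [q ->]; exists (fun t => c * p t + q t).
rewrite scaler_sumr -big_split; apply: eq_bigr => t _ /=.
by rewrite scalerDl scalerA.
Qed.

Lemma word_spanZ m c a : word_span m a -> word_span m (c *: a).
Proof. by rewrite -[c *: a]addr0 => Sa; apply/word_span_lin/word_span0. Qed.

Lemma word_spanB m a b : word_span m a -> word_span m b -> word_span m (a - b).
Proof. by move=> Sa Sb; rewrite addrC -scaleN1r; apply: word_span_lin. Qed.

Lemma word_span_sum m (I : Type) (s : seq I) (F : I -> A) :
  (forall i, word_span m (F i)) -> word_span m (\sum_(i <- s) F i).
Proof.
move=> SF; elim/big_ind: _ => // [|a b Sa Sb]; first exact: word_span0.
by rewrite -[a]scale1r; apply: word_span_lin.
Qed.

Lemma word_span_prod m (s : seq 'I_n) : size s = m -> word_span m (\prod_(i <- s) x i).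
Proof.
move=> sz; pose t0 : m.-tuple 'I_n := Tuple (introT eqP sz).
exists (fun t => (t == t0)%:R); rewrite (bigD1 t0) //= eqxx scale1r [X in _ + X]big1 ?addr0 //.
by move=> t /negbTE ->; rewrite scale0r.
Qed.

Lemma word_spanM m p a b : word_span m a -> word_span p b -> word_span (m + p) (a * b).
Proof.
case=> [c ->] [d ->]; rewrite mulr_suml; apply: word_span_sum => t.
rewrite mulr_sumr; apply: word_span_sum => u.
rewrite -scalerAl -scalerAr -big_cat; do 2!apply: word_spanZ.
by apply: word_span_prod; rewrite size_cat !size_tuple.
Qed.

Lemma word_span1 i : word_span 1 (x i).
Proof. by rewrite -[x i](big_seq1 *%R i x); apply: word_span_prod. Qed.

End Spans.

Lemma word_span_change (k : fieldType) (A : algType k) n (x y : 'I_n -> A) m a :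
  (forall i, word_span y 1 (x i)) -> word_span x m a -> word_span y m a.
Proof.
move=> xy [c ->]; apply: word_span_sum => t; apply: word_spanZ.
case: t => s /= /eqP <-; elim: s => [|i s IHs].
  by have := word_span_prod y (erefl (size (Nil 'I_n))); rewrite !big_nil.
by rewrite big_cons; apply: (word_spanM (m := 1)).
Qed.

Lemma mulr_sum_mul (R : pzSemiRingType) n (u : R) (F G : 'I_n -> R) :
  u * (\sum_i F i * G i) = \sum_i (u * F i) * G i.
Proof. by rewrite mulr_sumr; apply: eq_bigr => i _; rewrite mulrA. Qed.

Lemma sum_delta (R : nzRingType) (V : lmodType R) n (i : 'I_n) (g : 'I_n -> V) :
  \sum_j (j == i)%:R *: g j = g i.
Proof.
rewrite (bigD1 i) //= eqxx scale1r big1 ?addr0 // => j ji.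
by rewrite (negbTE ji) scale0r.
Qed.

Lemma scale_sum_mul_sum (R : comNzRingType) (V : lalgType R) n (c : R)
    (p q : 'I_n -> R) (X Y : 'I_n -> V) :
  (forall (c : R) (a b : V), c *: (a * b) = a * (c *: b)) ->
  c *: ((\sum_i p i *: X i) * (\sum_i q i *: Y i)) =
  \sum_i \sum_j (c * (p i * q j)) *: (X i * Y j).
Proof.
move=> mulZr; rewrite mulr_suml scaler_sumr; apply: eq_bigr => i _.
rewrite mulr_sumr scaler_sumr; apply: eq_bigr => j _.
by rewrite -mulZr -scalerAl !scalerA -mulrA [q j * _]mulrC.
Qed.

Lemma sum_congruence (R : comNzRingType) (V : lmodType R) n (w g : 'M[R]_n)
    (Y : 'I_n -> 'I_n -> V) :
  \sum_i \sum_j \sum_a \sum_b (w i j * (g i a * g j b)) *: Y a b =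
  \sum_a \sum_b (g^T *m w *m g) a b *: Y a b.
Proof.
under eq_bigr do rewrite exchange_big.
rewrite exchange_big; apply: eq_bigr => a _ /=.
under eq_bigr do rewrite exchange_big.
rewrite exchange_big; apply: eq_bigr => b _ /=.
under eq_bigr do rewrite -scaler_suml.
rewrite -scaler_suml; congr (_ *: _).
rewrite mxE exchange_big; apply: eq_bigr => j _ /=; rewrite mxE mulr_suml.
by apply: eq_bigr => i _; rewrite mxE; ring.
Qed.

Lemma sum_mulmx_scale (R : comNzRingType) (V : lmodType R) n (h g : 'M[R]_n)
    (Y : 'I_n -> V) i :
  \sum_j h i j *: (\sum_l g j l *: Y l) = \sum_l (h *m g) i l *: Y l.
Proof.
under eq_bigr do rewrite scaler_sumr.
rewrite exchange_big; apply: eq_bigr => l _ /=.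
by rewrite mxE scaler_suml; apply: eq_bigr => j _; rewrite scalerA.
Qed.

Lemma sum_mx1_scale (R : comNzRingType) (V : lmodType R) n (Y : 'I_n -> V) i :
  \sum_l (1%:M : 'M[R]_n) i l *: Y l = Y i.
Proof. by rewrite -[RHS]sum_delta; apply: eq_bigr => l _; rewrite mxE eq_sym. Qed.

Section Quadratic.
Variables (k : fieldType) (n : nat) (A : algType k) (gr : nat -> A -> Prop).
Variables (x : 'I_n -> A) (W : {vspace 'M[k]_n}).
Hypothesis AxW : quadratic_algebra gr x W.

Lemma quad_rel w : w \in W -> \sum_i \sum_j w i j *: (x i * x j) = 0.
Proof.
move=> wW; rewrite -eval_free_quad; apply/(qa_kernel AxW).
exact: quad_tensor_ideal.
Qed.

Lemma eval_rel w : w \in W -> eval_free x (quad_tensor w) = 0.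
Proof. by move=> wW; rewrite eval_free_quad quad_rel. Qed.

Lemma rdiv_sum_gen (i : 'I_n) (g : 'I_n -> free_alg k n) :
  rdiv i (\sum_j g j * free_gen k j) = g i.
Proof.
rewrite (additive_sum (linear_sub (rdiv_linear i)) _ _ (fun j => g j * free_gen k j)).
rewrite -[RHS](sum_delta i g); apply: eq_bigr => j _; exact: rdivM_gen.
Qed.

Lemma rdiv_quad (i : 'I_n) f w :
  rdiv i (f * quad_tensor w) = \sum_j w j i *: (f * free_gen k j).
Proof.
have rS := additive_sum (linear_sub (rdiv_linear (k := k) i)).
rewrite /quad_tensor mulr_sumr rS; apply: eq_bigr => j _.
rewrite mulr_sumr rS (bigD1 i) //= big1 => [|l li].
  rewrite addr0 -malg_scaleAr mulrA -[X in rdiv i X]addr0 (rdiv_linear i).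
  rewrite rdivM_gen eqxx scale1r (additive0 (linear_sub (rdiv_linear i))).
  exact: addr0.
rewrite -malg_scaleAr mulrA -[X in rdiv i X]addr0 (rdiv_linear i).
rewrite rdivM_gen (negbTE li) scale0r scaler0.
by rewrite (additive0 (linear_sub (rdiv_linear i))) addr0.
Qed.

(** Split [b] into a constant and left multiples of the generators. Dividing the latter terms by
    their last generator leaves elements of the ideal, which vanish in A; only the constant [c] of
    [b] contributes, and there the division acts on the tensor [w]. *)
Lemma eval_rdiv_ideal a b w : w \in W ->
  exists c : k, forall i, eval_free x (rdiv i (a * quad_tensor w * b)) =
                          (c *: eval_free x a) * \sum_j w j i *: x j.
Proof.
move=> wW; have [c Eb] := free_rdivE b; exists c => i.
have -> : a * quad_tensor w * b = c *: (a * quad_tensor w) +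
    \sum_j (a * quad_tensor w * rdiv j b) * free_gen k j.
  rewrite {1}Eb [LHS]mulrDr; congr (_ + _).
    by rewrite -malg_scaleAr mulr1.
  exact: mulr_sum_mul.
rewrite (rdiv_linear i) eval_free_linear rdiv_sum_gen.
rewrite !eval_freeM eval_rel // mulr0 mul0r addr0 rdiv_quad eval_free_sum.
rewrite -scalerAl mulr_sumr; congr (_ *: _); apply: eq_bigr => j _.
by rewrite eval_freeZ eval_freeM eval_free_gen scalerAr.
Qed.

(* Exactness of the Koszul complex of left modules at A^n: the relations of A
   are generated by W. *)
Lemma koszul_exact (f : 'I_n -> A) : \sum_i f i * x i = 0 ->
  exists m (g : 'I_m -> A) (w : 'I_m -> 'M[k]_n),
    (forall r, w r \in W) /\
    forall i, f i = \sum_r g r * \sum_j w r j i *: x j.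
Proof.
move=> f0; pose F i := projT1 (boolp.cid (qa_onto AxW (f i))).
have EF i : f i = eval_free x (F i) by rewrite /F; case: boolp.cid.
have /(qa_kernel AxW) : eval_free x (\sum_i F i * free_gen k i) = 0.
  rewrite eval_free_sum -[RHS]f0; apply: eq_bigr => i _.
  by rewrite eval_freeM eval_free_gen EF.
case=> m [a [b [w [wW E]]]].
have /boolp.choice [c Ec] r := eval_rdiv_ideal (a r) (b r) (wW r).
exists m, (fun r => c r *: eval_free x (a r)), w; split=> // i.
rewrite EF -[F i](rdiv_sum_gen i F) E.
rewrite (additive_sum (linear_sub (rdiv_linear i)) _ _ (fun r => a r * _ * b r)).
by rewrite eval_free_sum; apply: eq_bigr => r _; apply: Ec.
Qed.

Lemma koszul_exact_basis (f : 'I_n -> A) : \sum_i f i * x i = 0 ->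
  exists g : 'I_(\dim W) -> A,
    forall i, f i = \sum_r g r * \sum_j (vbasis W)`_r j i *: x j.
Proof.
move=> /koszul_exact [m [g [w [wW E]]]].
exists (fun s => \sum_r coord (vbasis W) s (w r) *: g r) => i.
rewrite E; under [RHS]eq_bigr do rewrite mulr_suml.
rewrite exchange_big; apply: eq_bigr => r _ /=.
under [RHS]eq_bigr do rewrite -scalerAl scalerAr.
rewrite -mulr_sumr; congr (_ * _).
under [RHS]eq_bigr do rewrite scaler_sumr.
rewrite exchange_big; apply: eq_bigr => j _ /=.
rewrite {1}(coord_vbasis (wW r)) summxE scaler_suml; apply: eq_bigr => s _.
by rewrite mxE scalerA.
Qed.

(** Multiplying out reversed words gives an antihomomorphism of the free algebra. It kills the ideal
    of W, so evaluating it on chosen preimages [F] is well defined on A. *)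
Lemma quad_antihom (y : 'I_n -> A) :
  (forall w, w \in W -> \sum_i \sum_j w i j *: (y j * y i) = 0) ->
  exists p : A -> A, [/\ linear p, p 1 = 1, forall a b, p (a * b) = p b * p a
                      & forall i, p (x i) = y i].
Proof.
move=> yW; pose h s := \prod_(i <- rev s) y i; pose q := words_to (k := k) h.
have qL : linear q by exact: words_to_linear.
have qM f g : q (f * g) = q g * q f.
  by apply: words_to_rmul => s t; rewrite /h rev_cat big_cat.
have q1 : q 1 = 1 by rewrite -word0 /q words_toE /h big_nil.
have qg i : q (free_gen k i) = y i by rewrite -word1 /q words_toE /h big_seq1.
have q0 f : in_quad_ideal W f -> q f = 0.
  case=> m [a [b [w [wW ->]]]]; rewrite (additive_sum (linear_sub qL)) big1 // => i _.
  rewrite !qM (_ : q (quad_tensor (w i)) = 0) ?mul0r ?mulr0 //.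
  rewrite -[RHS](yW _ (wW i)) (additive_sum (linear_sub qL)); apply: eq_bigr => j _.
  rewrite (additive_sum (linear_sub qL)); apply: eq_bigr => l _.
  rewrite -[X in q X]addr0 qL qM !qg (additive0 (linear_sub qL)).
  exact: addr0.
pose F a := projT1 (boolp.cid (qa_onto AxW a)).
have EF a : eval_free x (F a) = a by rewrite /F; case: boolp.cid.
have qE f g : eval_free x f = eval_free x g -> q f = q g.
  move=> E; apply/eqP; rewrite -subr_eq0 -(linear_sub qL) q0 //.
  by apply/(qa_kernel AxW); rewrite eval_freeB E subrr.
exists (q \o F); split=> [c a b||a b|i] /=.
- by rewrite -qL; apply: qE; rewrite eval_free_linear !EF.
- by rewrite -[RHS]q1; apply: qE; rewrite EF eval_free1.
- by rewrite -qM; apply: qE; rewrite eval_freeM !EF.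
- by rewrite -qg; apply: qE; rewrite EF eval_free_gen.
Qed.

Lemma quad_hom (B : algType k) (y : 'I_n -> B) :
  (forall w, w \in W -> \sum_i \sum_j w i j *: (y i * y j) = 0) ->
  exists p : A -> B, [/\ linear p, p 1 = 1, forall a b, p (a * b) = p a * p b
                      & forall i, p (x i) = y i].
Proof.
move=> yW; pose q := eval_free y.
have q0 f : in_quad_ideal W f -> q f = 0.
  by apply: eval_free_ideal => w wW; rewrite eval_free_quad yW.
pose F a := projT1 (boolp.cid (qa_onto AxW a)).
have EF a : eval_free x (F a) = a by rewrite /F; case: boolp.cid.
have qE f g : eval_free x f = eval_free x g -> q f = q g.
  move=> E; apply/eqP; rewrite -subr_eq0 -eval_freeB; apply/eqP/q0.
  by apply/(qa_kernel AxW); rewrite eval_freeB E subrr.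
exists (q \o F); split=> [c a b||a b|i] /=.
- by rewrite -eval_free_linear; apply: qE; rewrite eval_free_linear !EF.
- by rewrite -[RHS](eval_free1 y); apply: qE; rewrite EF eval_free1.
- by rewrite -eval_freeM; apply: qE; rewrite eval_freeM !EF.
- by rewrite -(eval_free_gen y); apply: qE; rewrite EF eval_free_gen.
Qed.

End Quadratic.

(** * Linear changes of the generators *)

Section Change.
Variables (k : fieldType) (n : nat) (A : algType k) (gr : nat -> A -> Prop).

Definition subst_gen (g : 'M[k]_n) : free_alg k n -> free_alg k n :=
  words_to (fun s => \prod_(i <- s) \sum_j g i j *: free_gen k j).

Lemma subst_gen_linear g : linear (subst_gen g).
Proof. exact: words_to_linear. Qed.

Lemma subst_genM g f h : subst_gen g (f * h) = subst_gen g f * subst_gen g h.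
Proof.
apply: words_to_mul => [c a b|s t]; first exact/esym/malg_scaleAr.
exact: big_cat.
Qed.

Lemma subst_gen1 g : subst_gen g 1 = 1.
Proof. rewrite -[X in subst_gen g X]word0 /subst_gen words_toE; exact: big_nil. Qed.

Lemma subst_gen_gen g i : subst_gen g (free_gen k i) = \sum_j g i j *: free_gen k j.
Proof. by rewrite -word1 /subst_gen words_toE big_seq1. Qed.

Lemma eval_subst (x : 'I_n -> A) g f :
  eval_free x (subst_gen g f) = eval_free (fun i => \sum_j g i j *: x j) f.
Proof.
move: f; apply: (free_ind (P := fun f => eval_free x (subst_gen g f) =
    eval_free (fun i => \sum_j g i j *: x j) f)) => [|c f h IHf IHh|f i IHf].
- by rewrite subst_gen1 !eval_free1.
- transitivity (eval_free x (c *: subst_gen g f + subst_gen g h)).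
    by congr (eval_free x _); apply: subst_gen_linear.
  transitivity (c *: eval_free x (subst_gen g f) + eval_free x (subst_gen g h)).
    exact: eval_free_linear.
  apply/esym; apply: etrans (eval_free_linear _ c f h) _; apply/esym.
  exact: (congr2 (fun a b => c *: a + b) IHf IHh).
transitivity (eval_free x (subst_gen g f * subst_gen g (free_gen k i))).
  by congr (eval_free x _); apply: subst_genM.
transitivity (eval_free x (subst_gen g f) * eval_free x (subst_gen g (free_gen k i))).
  exact: eval_freeM.
apply/esym; apply: etrans (eval_freeM _ f (free_gen k i)) _; apply/esym.
apply: (congr2 *%R IHf); rewrite subst_gen_gen eval_free_gen eval_free_sum.
by apply: eq_bigr => j _; rewrite eval_freeZ eval_free_gen.
Qed.

Lemma subst_gen_sum g m (F : 'I_m -> free_alg k n) :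
  subst_gen g (\sum_i F i) = \sum_i subst_gen g (F i).
Proof. exact: (additive_sum (linear_sub (subst_gen_linear g))). Qed.

Lemma subst_genZ g c f : subst_gen g (c *: f) = c *: subst_gen g f.
Proof. exact: linear_Z (subst_gen_linear g) c f. Qed.

Lemma subst_gen_quad g w : subst_gen g (quad_tensor w) = quad_tensor (g^T *m w *m g).
Proof.
rewrite /quad_tensor subst_gen_sum -sum_congruence.
apply: eq_bigr => i _; rewrite subst_gen_sum; apply: eq_bigr => j _.
rewrite subst_genZ subst_genM !subst_gen_gen; exact/scale_sum_mul_sum/malg_scaleAr.
Qed.

Lemma subst_gen_ideal g (W W' : {vspace 'M[k]_n}) f :
  (forall w, w \in W -> g^T *m w *m g \in W') ->
  in_quad_ideal W f -> in_quad_ideal W' (subst_gen g f).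
Proof.
move=> gW [m [a [b [w [wW ->]]]]]; exists m, (fun i => subst_gen g (a i)),
  (fun i => subst_gen g (b i)), (fun i => g^T *m w i *m g).
split=> [i|]; first exact: gW.
rewrite subst_gen_sum; apply: eq_bigr => i _.
by rewrite (subst_genM g (a i * _)) (subst_genM g (a i)) subst_gen_quad.
Qed.

Lemma subst_genK g h : h *m g = 1%:M -> cancel (subst_gen h) (subst_gen g).
Proof.
move=> hg; apply: (free_ext (p := fun f => subst_gen g (subst_gen h f)) (q := id)).
- by move=> c u v; rewrite !subst_gen_linear.
- by move=> c u v.
elim/last_ind => [|s i IHs]; first by rewrite word0 !subst_gen1.
rewrite -cats1 word_cat word1.
transitivity (subst_gen g (subst_gen h (word k s) * subst_gen h (free_gen k i))).
  by congr (subst_gen g _); apply: subst_genM.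
transitivity (subst_gen g (subst_gen h (word k s)) * subst_gen g (subst_gen h (free_gen k i))).
  exact: subst_genM.
apply: (congr2 *%R IHs); rewrite subst_gen_gen subst_gen_sum.
rewrite -[RHS](sum_mx1_scale (R := k)) -hg -sum_mulmx_scale.
by apply: eq_bigr => j _; rewrite subst_genZ subst_gen_gen.
Qed.

(** For y = g x, the tensor w in the y_i equals the tensor g^T w g in the x_i; the new space of
    relations is therefore the preimage of W under this congruence. *)
Lemma quadratic_algebra_change (x : 'I_n -> A) (W W' : {vspace 'M[k]_n}) g :
  quadratic_algebra gr x W -> g \in unitmx ->
  (forall w, (w \in W') = (g^T *m w *m g \in W)) ->
  quadratic_algebra gr (fun i => \sum_j g i j *: x j) W'.
Proof.
move=> [x_onto x_ker x_gr] g_unit W'E; pose y i := \sum_j g i j *: x j.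
pose h := invmx g; have hg : h *m g = 1%:M by rewrite mulVmx.
have gh : g *m h = 1%:M by rewrite mulmxV.
split=> [a|f|m a].
- have [f ->] := x_onto a; exists (subst_gen h f).
  by rewrite -eval_subst subst_genK.
- rewrite -eval_subst x_ker; split; last first.
    by apply: subst_gen_ideal => w; rewrite W'E.
  rewrite -{2}[f](subst_genK gh); apply: subst_gen_ideal => w wW.
  by rewrite W'E !mulmxA -trmx_mul hg trmx1 mul1mx -mulmxA hg mulmx1.
rewrite x_gr -/(word_span x m a) -/(word_span y m a).
have xE i : x i = \sum_j h i j *: y j.
  by rewrite sum_mulmx_scale hg sum_mx1_scale.
split; apply: word_span_change => i; rewrite ?[x i]xE; apply: word_span_sum => j;
  apply: word_spanZ; exact: word_span1.
Qed.

End Change.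

(** * Graded modules and partial resolutions *)

Lemma sum_widen (I : eqType) (V : nmodType) (s s' : seq I) (F : I -> V) :
  uniq s -> uniq s' -> {subset s <= s'} -> (forall i, i \notin s -> F i = 0) ->
  \sum_(i <- s) F i = \sum_(i <- s') F i.
Proof.
move=> Us Us' sub F0; rewrite [RHS](bigID (mem s)) /= [X in _ + X]big1 ?addr0 //.
rewrite -[RHS]big_filter; apply: perm_big; apply: uniq_perm => //.
  exact: filter_uniq.
by move=> i; rewrite mem_filter andb_idr // => /sub.
Qed.

(** [internal_direct_sum] only asserts that decompositions exist. A projector names the components,
    so that homogeneous parts of elements and of maps can be formed. *)
Record projector (I : eqType) (V : zmodType) (gr : I -> V -> Prop)
    (p : I -> V -> V) : Prop := {
  pj_in : forall i v, gr i (p i v);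
  pj_sub : forall i u v, p i (u - v) = p i u - p i v;
  pj_id : forall i v, gr i v -> p i v = v;
  pj_0 : forall i j v, gr i v -> j != i -> p j v = 0;
  pj_fin : forall v, exists s,
    [/\ uniq s, forall i, i \notin s -> p i v = 0 & v = \sum_(i <- s) p i v] }.

Lemma pj_sum (I : eqType) (V : zmodType) (gr : I -> V -> Prop) p :
  projector gr p -> forall v, exists s, uniq s /\
    forall s', uniq s' -> {subset s <= s'} -> v = \sum_(i <- s') p i v.
Proof.
move=> pP v; have [s [Us s0 {1}->]] := pj_fin pP v.
by exists s; split=> // s' Us' ss'; rewrite {1}(sum_widen Us Us' ss' s0).
Qed.

Section Projector.
Variables (I : eqType) (V : zmodType) (gr : I -> V -> Prop).

Section Closed.
Hypothesis gr0 : forall i, gr i 0.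
Hypothesis grB : forall i u v, gr i u -> gr i v -> gr i (u - v).

Lemma closedN i u : gr i u -> gr i (- u).
Proof. by move=> gu; rewrite -sub0r; apply: grB. Qed.

Lemma closedD i u v : gr i u -> gr i v -> gr i (u + v).
Proof. by move=> gu gv; rewrite -[v]opprK; apply/grB/closedN. Qed.

Lemma closed_sum i (J : Type) (s : seq J) (P : pred J) (F : J -> V) :
  (forall j, P j -> gr i (F j)) -> gr i (\sum_(j <- s | P j) F j).
Proof. by move=> gF; elim/big_ind: _ => // u v; apply: closedD. Qed.

Lemma closedMn i u n : gr i u -> gr i (u *+ n).
Proof.
by move=> gu; elim: n => [|n IHn]; rewrite ?mulr0n // mulrS; apply: closedD.
Qed.
End Closed.

Hypothesis gr_sum : internal_direct_sum gr.

Lemma ids_gr0 i : gr i 0. Proof. by case: gr_sum. Qed.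
Lemma ids_grB i u v : gr i u -> gr i v -> gr i (u - v).
Proof. by case: gr_sum => _ + _ _; apply. Qed.

Lemma projector_exists : exists p, projector gr p.
Proof.
have [gr0 grB gen indep] := gr_sum.
have rep v : exists sw : seq I * (I -> V),
    [/\ forall i, gr i (sw.2 i), uniq sw.1, forall i, i \notin sw.1 -> sw.2 i = 0
      & v = \sum_(i <- sw.1) sw.2 i].
  have [s [w [gw ->]]] := gen v.
  (* The list [s] may repeat an index; its component then enters the sum once for each
     occurrence. *)
  exists (undup s, fun i => w i *+ count_mem i s); split=> /= [i||i|].
  - exact: closedMn.
  - exact: undup_uniq.
  - by rewrite mem_undup => /count_memPn ->.
  rewrite -big_undup_iterop_count; apply: eq_bigr => i _.
  by rewrite Monoid.iteropE; elim: (count_mem i s) => //= n ->; rewrite mulrS.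
have [R RP] := boolp.choice rep; pose p i v := (R v).2 i.
have wide v s : uniq s -> {subset (R v).1 <= s} -> v = \sum_(i <- s) p i v.
  by move=> Us' sub; have [_ Us out {1}->] := RP v; apply: sum_widen.
have det s (w w' : I -> V) : uniq s -> (forall i, gr i (w i)) ->
    (forall i, gr i (w' i)) -> \sum_(i <- s) w i = \sum_(i <- s) w' i ->
    {in s, w =1 w'}.
  move=> Us gw gw' E i si; apply/eqP; rewrite -subr_eq0; apply/eqP.
  apply: (indep s (fun i => w i - w' i)) => // [j|]; first exact: grB.
  by rewrite sumrB E subrr.
have pin i v : gr i (p i v) by have [] := RP v.
have pout i v : i \notin (R v).1 -> p i v = 0 by have [_ _ + _] := RP v; apply.
have uniq_rep v s (w : I -> V) : (forall i, gr i (w i)) ->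
    (forall i, i \notin s -> w i = 0) -> uniq s -> v = \sum_(i <- s) w i ->
    forall i, p i v = w i.
  move=> gw w0 Us E i; pose t := undup (i :: s ++ (R v).1).
  have Ut : uniq t by apply: undup_uniq.
  have it : i \in t by rewrite mem_undup mem_head.
  suff Et : \sum_(j <- t) p j v = \sum_(j <- t) w j.
    exact: (det t (p^~ v) w Ut (fun j => pin j v) gw Et i it).
  rewrite -wide //; last first.
    by move=> j jR; rewrite mem_undup inE mem_cat jR !orbT.
  by rewrite {1}E; apply: sum_widen => // j js; rewrite mem_undup inE mem_cat js orbT.
exists p; split=> // [i u v|i v gv|i j v gv ji|v].
- pose s := undup ((R u).1 ++ (R v).1).
  apply: (uniq_rep _ s (fun i => p i u - p i v)) => [j|j||].
  + exact: grB.
  + by rewrite mem_undup mem_cat negb_or => /andP[/pout -> /pout ->]; rewrite subrr.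
  + exact: undup_uniq.
  rewrite sumrB -!wide ?undup_uniq // => j jR;
    by rewrite mem_undup mem_cat jR ?orbT.
- rewrite (uniq_rep v [:: i] (fun j => if j == i then v else 0)) ?eqxx //.
  + by move=> j; case: eqP => // ->.
  + by move=> j; rewrite inE => /negbTE ->.
  by rewrite big_seq1 eqxx.
- rewrite (uniq_rep v [:: i] (fun j => if j == i then v else 0)) ?(negbTE ji) //.
  + by move=> l; case: eqP => // ->.
  + by move=> l; rewrite inE => /negbTE ->.
  by rewrite big_seq1 eqxx.
by exists (R v).1; have [_ Us _ _] := RP v; split=> // [i|]; [apply: pout | apply: wide].
Qed.

Lemma projector_eq0 p : projector gr p -> forall v, (forall i, p i v = 0) -> v = 0.
Proof.
move=> pP v v0; have [s [Us E]] := pj_sum pP v.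
by rewrite (E s) // big1.
Qed.

End Projector.

Lemma ids_of_projector (I : eqType) (V : zmodType) (gr : I -> V -> Prop) p :
  (forall i, gr i 0) -> (forall i u v, gr i u -> gr i v -> gr i (u - v)) ->
  projector gr p -> internal_direct_sum gr.
Proof.
move=> gr0 grB pP; split=> // [v|s w Us gw E i si].
  have [s [Us sE]] := pj_sum pP v; exists s, (p^~ v); split; last exact: sE.
  by move=> i; apply: (pj_in pP).
have pS := additive_sum (pj_sub pP i).
rewrite -(pj_id pP (gw i)) -[LHS]addr0.
transitivity (p i (\sum_(j <- s) w j)); last by rewrite E (additive0 (pj_sub pP i)).
rewrite pS (bigD1_seq i) //=; congr (_ + _); rewrite big1 // => j ji.
by apply: (pj_0 pP (gw j)); rewrite eq_sym.
Qed.

Section Kernel.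
Variables (R : nzRingType) (X Y : lmodType R) (f : {linear X -> Y}).

Definition ker_pred : {pred X} := fun x => f x == 0.

Fact ker_pred_closed : submod_closed ker_pred.
Proof.
split=> [|a u v]; rewrite /ker_pred !unfold_in ?linear0 // => /eqP u0 /eqP v0.
by rewrite linearP u0 v0 scaler0 addr0.
Qed.

HB.instance Definition _ :=
  GRing.isSubmodClosed.Build R X ker_pred ker_pred_closed.

Record kernel := Kernel { kernel_val : X; kernel_in : kernel_val \in ker_pred }.

HB.instance Definition _ := [isSub for kernel_val].
HB.instance Definition _ := [Choice of kernel by <:].
HB.instance Definition _ := [SubChoice_isSubLmodule of kernel by <:].

Lemma kernelP (u : kernel) : f (val u) = 0.
Proof. by have := valP u; rewrite unfold_in => /eqP. Qed.

Lemma kernel_mk x : f x = 0 -> {u : kernel | val u = x}.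
Proof. by move=> /eqP fx; exists (Kernel fx). Qed.

End Kernel.

(** [projective] lifts along surjections only, whereas the image of [d] is merely known to contain
    that of [g]. The pullback of [d] along [g] projects onto P, and a section of this projection
    gives the lift. *)
Lemma projective_lift (R : nzRingType) (P X Y : lmodType R)
    (d : {linear X -> Y}) (g : {linear P -> Y}) :
  projective P -> (forall p, exists x, d x = g p) ->
  exists h : {linear P -> X}, forall p, d (h p) = g p.
Proof.
move=> projP gd.
have [q qE] : {q : {linear (P * X)%type -> Y} | forall z, q z = g z.1 - d z.2}.
  apply: linear_of => [u v|a u].
    by rewrite [(u - v).1]/(u.1 - v.1) [(u - v).2]/(u.2 - v.2) !linearB /= addrACA.
  by rewrite [(a *: u).1]/(a *: u.1) [(a *: u).2]/(a *: u.2) !linearZ /= scalerDr.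
pose pullback := kernel q.
have [fst' fst'E] : {p : {linear pullback -> P} | forall z, p z = (val z).1}.
  by apply: linear_of => [u v|a u]; rewrite ?linearB ?linearZ.
have [snd' snd'E] : {p : {linear pullback -> X} | forall z, p z = (val z).2}.
  by apply: linear_of => [u v|a u]; rewrite ?linearB ?linearZ.
have onto p : exists z, fst' z = p.
  have [x dx] := gd p.
  have [|z zE] := kernel_mk (f := q) (x := (p, x)); first by rewrite qE dx subrr.
  by exists z; rewrite fst'E zE.
have [s sE] := projP _ _ fst' idfun onto.
exists (snd' \o s) => p /=; have := kernelP (s p); rewrite qE -fst'E sE => /eqP.
by rewrite subr_eq0 snd'E eq_sym => /eqP.
Qed.

Section GradedModules.
Variables (k : fieldType) (A : algType k) (gr : nat -> A -> Prop).
Hypothesis gr_sum : internal_direct_sum gr.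
Hypothesis gr_mul : forall m n a b, gr m a -> gr n b -> gr (m + n)%N (a * b).

Record gmod := Gmod {
  gm_sort : lmodType A;
  gm_deg : int -> gm_sort -> Prop;
  gm_ok : graded_module gr gm_deg }.

Definition ghom (X Y : gmod) (f : gm_sort X -> gm_sort Y) : Prop :=
  forall n y, gm_deg n y -> gm_deg n (f y).

Lemma gm_sum (X : gmod) : internal_direct_sum (@gm_deg X).
Proof. by case: (gm_ok X). Qed.

Lemma gm_scale (X : gmod) m n a v :
  gr m a -> gm_deg n v -> @gm_deg X (m%:Z + n) (a *: v).
Proof. by case: (gm_ok X) => _; apply. Qed.

Lemma gm0 (X : gmod) n : @gm_deg X n 0. Proof. exact: ids_gr0 (gm_sum X) n. Qed.

Lemma gmB (X : gmod) n u v : gm_deg n u -> gm_deg n v -> @gm_deg X n (u - v).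
Proof. exact: (ids_grB (gm_sum X)). Qed.

Lemma projector_scale (X : gmod) p m b i (w : gm_sort X) :
  projector (@gm_deg X) p -> gr m b -> p (m%:Z + i) (b *: w) = b *: p i w.
Proof.
move=> pP gb; have [s' [Us' s'E]] := pj_sum pP w.
pose t' := undup (i :: s'); have Ut' : uniq t' by apply: undup_uniq.
rewrite {1}(s'E t') //; last by move=> l ls; rewrite mem_undup inE ls orbT.
rewrite scaler_sumr (additive_sum (pj_sub pP _)) (bigD1_seq i) //=; last first.
  by rewrite mem_undup mem_head.
rewrite (pj_id pP (gm_scale gb (pj_in pP _ _))) big1 ?addr0 // => l li.
apply: (pj_0 pP (gm_scale gb (pj_in pP l w))).
by rewrite (inj_eq (addrI _)) eq_sym.
Qed.

(** The component is v |-> sum_i p_{i+n} (f (q_i v)), with q the projector of X. The sum is finite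
    for each v, but its support [S v] depends on v: additivity is checked on a common support, and
    A-linearity on homogeneous elements. *)
Lemma degree_component (X Y : gmod) (n : int) (f : {linear gm_sort X -> gm_sort Y}) p :
  projector (@gm_deg Y) p ->
  exists g : {linear gm_sort X -> gm_sort Y},
    forall j y, gm_deg j y -> g y = p (j + n) (f y).
Proof.
move=> pP; have [q qP] := projector_exists (gm_sum X).
have [S SP] := boolp.choice (pj_sum qP).
pose t s v := \sum_(i <- s) p (i + n) (f (q i v)).
have pfB i u v : p (i + n) (f (q i (u - v))) =
    p (i + n) (f (q i u)) - p (i + n) (f (q i v)).
  by rewrite (pj_sub qP) linearB (pj_sub pP).
have qout i v : i \notin S v -> q i v = 0.
  have [Us sE] := SP v => iS.
  have E := sE (i :: S v); rewrite /= iS Us in E.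
  have {}E := E isT (fun j js => mem_behead (s := i :: S v) js).
  rewrite big_cons -sE // in E.
  by move/eqP: E; rewrite -subr_eq0 opprD addrCA subrr addr0 oppr_eq0 => /eqP.
have tE v s : uniq s -> {subset S v <= s} -> t (S v) v = t s v.
  move=> Us sub; apply: sum_widen => // [|i /qout ->]; first by have [] := SP v.
  by rewrite linear0 (additive0 (pj_sub pP _)).
pose g v := t (S v) v.
have gB u v : g (u - v) = g u - g v.
  pose s := undup (S u ++ S v ++ S (u - v)); have Us : uniq s by apply: undup_uniq.
  rewrite /g !(tE _ s) //; try by move=> j js; rewrite mem_undup !mem_cat js ?orbT.
  by rewrite /t -sumrB; apply: eq_bigr => i _; rewrite pfB.
have gh j y : gm_deg j y -> g y = p (j + n) (f y).
  move=> gy; pose s := undup (j :: S y); have Us : uniq s by apply: undup_uniq.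
  rewrite /g (tE _ s) //; last by move=> i iS; rewrite mem_undup inE iS orbT.
  rewrite /t (bigD1_seq j) ?mem_undup ?mem_head //= (pj_id qP gy) big1 ?addr0 //.
  by move=> i ij; rewrite (pj_0 qP gy ij) linear0 (additive0 (pj_sub pP _)).
have gZ a u : g (a *: u) = a *: g u.
  have [_ _ decA _] := gr_sum.
  have hom m j (b : A) v : gr m b -> gm_deg j v -> g (b *: v) = b *: g v.
    move=> gb gv; rewrite (gh _ _ (gm_scale gb gv)) (gh _ _ gv) linearZ /=.
    by rewrite -addrA (projector_scale _ _ pP).
  have [s [w [gw ->]]] := decA a; rewrite !scaler_suml (additive_sum gB).
  apply: eq_bigr => m _.
  have [s' [Us' s'E]] := pj_sum qP u; rewrite (s'E s') // scaler_sumr.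
  rewrite !(additive_sum gB) scaler_sumr; apply: eq_bigr => i _.
  by apply: hom; [apply: gw | apply: (pj_in qP)].
have [g' g'E] := linear_of gB gZ; exists g' => j y gy.
by rewrite g'E; apply: gh.
Qed.

Lemma proj_ghom (X Y : gmod) (f : {linear gm_sort X -> gm_sort Y}) p q :
  ghom f -> projector (@gm_deg X) p -> projector (@gm_deg Y) q ->
  forall n x, q n (f x) = f (p n x).
Proof.
move=> gf pP qP n x; have [s [Us sE]] := pj_sum pP x.
pose t := undup (n :: s); have Ut : uniq t by apply: undup_uniq.
rewrite {1}(sE t) //; last by move=> l ls; rewrite mem_undup inE ls orbT.
rewrite linear_sum (additive_sum (pj_sub qP _)) (bigD1_seq n) //=; last first.
  by rewrite mem_undup mem_head.
rewrite (pj_id qP (gf _ _ (pj_in pP _ _))) big1 ?addr0 // => l ln.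
by apply: (pj_0 qP (gf _ _ (pj_in pP l x))); rewrite eq_sym.
Qed.

Section KernelGrading.
Variables (X Y : gmod) (f : {linear gm_sort X -> gm_sort Y}).
Hypothesis f_graded : ghom f.

Fact kernel_ok : graded_module gr (fun n (u : kernel f) => @gm_deg X n (val u)).
Proof.
have [p pP] := projector_exists (gm_sum X).
have [q qP] := projector_exists (gm_sum Y).
split; last by move=> m n a v ga gv; rewrite GRing.valZ; apply: gm_scale.
have pK n (u : kernel f) : f (p n (val u)) = 0.
  by rewrite -(proj_ghom f_graded pP qP) kernelP (additive0 (pj_sub qP n)).
pose r n u := projT1 (kernel_mk (pK n u)).
have rE n u : val (r n u) = p n (val u) by rewrite /r; case: kernel_mk.
apply: (@ids_of_projector _ _ _ r) => [n|n u v gu gv|].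
- by rewrite GRing.val0; apply: gm0.
- by rewrite GRing.valB; apply: gmB.
split=> [n v|n u v|n v gv|n j v gv jn|v].
- by rewrite rE; apply: (pj_in pP).
- by apply: val_inj; rewrite GRing.valB !rE GRing.valB (pj_sub pP).
- by apply: val_inj; rewrite rE (pj_id pP).
- by apply: val_inj; rewrite rE GRing.val0; apply: (pj_0 pP gv).
have [s [Us s0 sE]] := pj_fin pP (val v); exists s; split=> // [i si|].
  by apply: val_inj; rewrite rE GRing.val0 s0.
by apply: val_inj; rewrite linear_sum /= {1}sE; apply: eq_bigr => i _; rewrite rE.
Qed.

Definition ker_gmod : gmod := Gmod kernel_ok.

End KernelGrading.

Lemma graded_ext (X : gmod) (V : zmodType) (f g : gm_sort X -> V) :
  (forall u v, f (u - v) = f u - f v) -> (forall u v, g (u - v) = g u - g v) ->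
  (forall n y, gm_deg n y -> f y = g y) -> f =1 g.
Proof.
move=> fB gB fg x; have [_ _ dec _] := gm_sum X.
have [s [w [gw ->]]] := dec x.
rewrite (additive_sum fB) (additive_sum gB).
by apply: eq_bigr => i _; apply: fg (gw i).
Qed.

(** The degree zero component of any ungraded lift is again a lift, because graded maps commute with
    the projectors. *)
Lemma graded_lift (P X Y : gmod) (d : {linear gm_sort X -> gm_sort Y})
    (g : {linear gm_sort P -> gm_sort Y}) :
  projective (gm_sort P) -> ghom d -> ghom g -> (forall p, exists x, d x = g p) ->
  exists h : {linear gm_sort P -> gm_sort X}, ghom h /\ forall p, d (h p) = g p.
Proof.
move=> projP gd gg dg; have [h0 h0E] := projective_lift projP dg.
have [p pP] := projector_exists (gm_sum X); have [q qP] := projector_exists (gm_sum Y).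
have [h hE] := degree_component 0 h0 pP; exists h; split.
  by move=> n y gy; rewrite (hE _ _ gy) addr0; apply: (pj_in pP).
apply: graded_ext => [u v|u v|n y gy]; rewrite ?linearB //.
rewrite (hE _ _ gy) addr0 -(proj_ghom gd pP qP) h0E.
exact/(pj_id qP)/gg.
Qed.

(** Exactness is required at [M], [F0] and [F1] and not at [F2]. This much holds for the Koszul
    complex of every connected graded quadratic algebra ([koszul_start]). *)
Record res_start (M F0 F1 F2 : gmod) (e : {linear gm_sort F0 -> gm_sort M})
    (d1 : {linear gm_sort F1 -> gm_sort F0})
    (d2 : {linear gm_sort F2 -> gm_sort F1}) : Prop := {
  rs_proj0 : projective (gm_sort F0);
  rs_proj1 : projective (gm_sort F1);
  rs_proj2 : projective (gm_sort F2);
  rs_e : ghom e;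
  rs_d1 : ghom d1;
  rs_d2 : ghom d2;
  rs_onto : forall m, exists y, e y = m;
  rs_ex0 : forall y, e y = 0 <-> exists z, y = d1 z;
  rs_ex1 : forall y, d1 y = 0 <-> exists z, y = d2 z }.

Section Comparison.
Variables (M F0 F1 F2 Q0 Q1 Q2 : gmod).

Lemma res_start_map e d1 d2 e' d1' d2' :
  @res_start M F0 F1 F2 e d1 d2 -> @res_start M Q0 Q1 Q2 e' d1' d2' ->
  exists (a0 : {linear gm_sort F0 -> gm_sort Q0})
    (a1 : {linear gm_sort F1 -> gm_sort Q1}) (a2 : {linear gm_sort F2 -> gm_sort Q2}),
    [/\ ghom a0, ghom a1 & ghom a2] /\
    [/\ forall y, e' (a0 y) = e y, forall y, d1' (a1 y) = a0 (d1 y)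
      & forall y, d2' (a2 y) = a1 (d2 y)].
Proof.
move=> F Q.
have [|a0 [ga0 a0E]] := graded_lift (rs_proj0 F) (rs_e Q) (rs_e F).
  by move=> y; apply: (rs_onto Q).
have gc (X Y Z : gmod) (f : {linear gm_sort Y -> gm_sort Z})
    (g : {linear gm_sort X -> gm_sort Y}) : ghom f -> ghom g -> ghom (f \o g).
  by move=> gf gg n y gy; apply/gf/gg.
have [|a1 [ga1 a1E]] := graded_lift (rs_proj1 F) (rs_d1 Q) (gc _ _ _ _ _ ga0 (rs_d1 F)).
  move=> y; have [|z E] := (rs_ex0 Q (a0 (d1 y))).1; last by exists z; rewrite -E.
  by rewrite a0E; apply/(rs_ex0 F); exists y.
have [|a2 [ga2 a2E]] := graded_lift (rs_proj2 F) (rs_d2 Q) (gc _ _ _ _ _ ga1 (rs_d2 F)).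
  move=> y; have [|z E] := (rs_ex1 Q (a1 (d2 y))).1; last by exists z; rewrite -E.
  rewrite a1E /= (_ : d1 (d2 y) = 0) ?linear0 //.
  by apply/(rs_ex1 F); exists y.
by exists a0, a1, a2.
Qed.
End Comparison.

(* Both sequences are homotopy equivalent; on the kernel of d2 the homotopy
   only leaves a map eta factoring through that kernel. *)
Lemma res_start_homotopy (M F0 F1 F2 Q0 Q1 Q2 : gmod) e d1 d2 e' d1' d2' :
  @res_start M F0 F1 F2 e d1 d2 -> @res_start M Q0 Q1 Q2 e' d1' d2' ->
  exists (a : {linear gm_sort F2 -> gm_sort Q2}) (b : {linear gm_sort Q2 -> gm_sort F2})
    (eta : {linear gm_sort F2 -> gm_sort F2}),
    [/\ ghom a, ghom b & ghom eta] /\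
    [/\ forall y, d2 y = 0 -> d2' (a y) = 0, forall y, d2' y = 0 -> d2 (b y) = 0,
       forall y, d2 (eta y) = 0 & forall y, d2 y = 0 -> y = b (a y) + eta y].
Proof.
move=> F Q; have [a0 [a1 [a2 [[ga0 ga1 ga2] [a0E a1E a2E]]]]] := res_start_map F Q.
have [b0 [b1 [b2 [[gb0 gb1 gb2] [b0E b1E b2E]]]]] := res_start_map Q F.
have d12 y : d1 (d2 y) = 0 by apply/(rs_ex1 F); exists y.
have ed y : e (d1 y) = 0 by apply/(rs_ex0 F); exists y.
have [g0 g0E] : {g : {linear gm_sort F0 -> gm_sort F0} | forall y, g y = y - b0 (a0 y)}.
  apply: linear_of => [u v|c u]; last by rewrite !linearZ_LR /= -scalerDr.
  by rewrite !linearB /= addrACA.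
have [||h0 [gh0 h0E]] := graded_lift (rs_proj0 F) (rs_d1 F) (g := g0).
- by move=> n y gy; rewrite g0E; apply: gmB => //; apply/gb0/ga0.
- move=> y; have [|z E] := (rs_ex0 F (g0 y)).1; last by exists z; rewrite -E.
  by rewrite g0E linearB /= b0E a0E subrr.
have [g1 g1E] : {g : {linear gm_sort F1 -> gm_sort F1} |
    forall y, g y = y - b1 (a1 y) - h0 (d1 y)}.
  apply: linear_of => [u v|c u]; last by rewrite !linearZ_LR /= -!scalerDr.
  by rewrite !linearB /= [X in X + _ = _]addrACA [LHS]addrACA.
have [||h1 [gh1 h1E]] := graded_lift (rs_proj1 F) (rs_d2 F) (g := g1).
- move=> n y gy; rewrite g1E; apply: gmB; last by apply/gh0/(rs_d1 F).
  by apply: gmB => //; apply/gb1/ga1.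
- move=> y; have [|z E] := (rs_ex1 F (g1 y)).1; last by exists z; rewrite -E.
  by rewrite g1E !linearB /= b1E a1E h0E g0E subrr.
have [eta etaE] : {g : {linear gm_sort F2 -> gm_sort F2} |
    forall y, g y = y - b2 (a2 y) - h1 (d2 y)}.
  apply: linear_of => [u v|c u]; last by rewrite !linearZ_LR /= -!scalerDr.
  by rewrite !linearB /= [X in X + _ = _]addrACA [LHS]addrACA.
exists a2, b2, eta; split; first split=> //.
  move=> n y gy; rewrite etaE; apply: gmB; last by apply/gh1/(rs_d2 F).
  by apply: gmB => //; apply/gb2/ga2.
split=> [y d0|y d0|y|y d0].
- by rewrite a2E d0 linear0.
- by rewrite b2E d0 linear0.
- by rewrite etaE !linearB /= b2E a2E h1E g1E d12 linear0 subr0 subrr.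
by rewrite etaE d0 linear0 subr0 addrC subrK.
Qed.

End GradedModules.

(* Ungraded statements are the graded ones for the grading concentrated in
   degree zero. *)
Section Ungraded.
Variables (k : fieldType) (A : algType k).

Definition conc (I : eqType) (i0 : I) (V : zmodType) (n : I) (v : V) :=
  n = i0 \/ v = 0.

Lemma conc_sum (I : eqType) (i0 : I) (V : zmodType) :
  internal_direct_sum (@conc I i0 V).
Proof.
pose p (i : I) (v : V) := if i == i0 then v else 0.
apply: (@ids_of_projector _ _ _ p) => [i|i u v [->|->] [h|->]|].
- by right.
- by left.
- by left.
- by left.
- by right; rewrite subrr.
split=> [i v|i u v|i v [->|->]|i j v [->|->] ji|v]; rewrite /p.
- by case: eqP => [->|_]; [left | right].
- by case: eqP; rewrite ?subrr.
- by rewrite eqxx.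
- by case: eqP.
- by rewrite (negbTE ji).
- by case: eqP.
exists [:: i0]; split=> // [i|]; first by rewrite inE => /negbTE ->.
by rewrite big_seq1 eqxx.
Qed.

Fact plain_ok (M : lmodType A) : graded_module (conc 0%N (V := A)) (conc (0 : int) (V := M)).
Proof.
split; first exact: conc_sum.
move=> m n a v [->|->] [->|->]; try by right; rewrite ?scaler0 ?scale0r.
by left.
Qed.

Definition plain (M : lmodType A) : gmod (conc 0%N (V := A)) := Gmod (@plain_ok M).

Record start (M F0 F1 F2 : lmodType A) (e : {linear F0 -> M})
    (d1 : {linear F1 -> F0}) (d2 : {linear F2 -> F1}) : Prop := {
  st_proj0 : projective F0;
  st_proj1 : projective F1;
  st_proj2 : projective F2;
  st_onto : forall m, exists y, e y = m;
  st_ex0 : forall y, e y = 0 <-> exists z, y = d1 z;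
  st_ex1 : forall y, d1 y = 0 <-> exists z, y = d2 z }.

Lemma plain_ghom (M N : lmodType A) (f : {linear M -> N}) :
  @ghom k A (conc 0%N (V := A)) (plain M) (plain N) f.
Proof. by move=> n y [->|->]; [left | right; rewrite linear0]. Qed.

Lemma start_homotopy (M F0 F1 F2 Q0 Q1 Q2 : lmodType A) e d1 d2 e' d1' d2' :
  @start M F0 F1 F2 e d1 d2 -> @start M Q0 Q1 Q2 e' d1' d2' ->
  exists (a : {linear F2 -> Q2}) (b : {linear Q2 -> F2}) (eta : {linear F2 -> F2}),
    [/\ forall y, d2 y = 0 -> d2' (a y) = 0, forall y, d2' y = 0 -> d2 (b y) = 0,
       forall y, d2 (eta y) = 0 & forall y, d2 y = 0 -> y = b (a y) + eta y].
Proof.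
move=> F Q.
have Fs : @res_start k A (conc 0%N (V := A)) (plain M) (plain F0) (plain F1) (plain F2) e d1 d2.
  by case: F => *; split=> //; apply: plain_ghom.
have Qs : @res_start k A (conc 0%N (V := A)) (plain M) (plain Q0) (plain Q1) (plain Q2) e' d1' d2'.
  by case: Q => *; split=> //; apply: plain_ghom.
by have [a [b [eta [_ E]]]] := res_start_homotopy (conc_sum 0%N A) Fs Qs; exists a, b, eta.
Qed.

Lemma resolution_start (M : lmodType A) (P : nat -> lmodType A)
    (dP : forall i, {linear P i.+1 -> P i}) (e : {linear P 0%N -> M}) :
  projective_resolution dP e -> start e (dP 0%N) (dP 1%N).
Proof. by case=> *; split. Qed.

(** An argument of Schanuel type. As Q_4 = 0, the last differential of Q is injective, so [a]
    restricted to the kernel of [d2] lifts to Q_3. The homotopy then writes the identity of the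
    kernel as a map through Q_3 plus a map through F2: the kernel is a direct summand of Q_3 x
    F2. *)
Lemma syzygy_projective (M F0 F1 F2 : lmodType A) e d1 d2 :
  @start M F0 F1 F2 e d1 d2 -> proj_dim_le M 3 -> projective (kernel d2).
Proof.
move=> F [Q [dQ [eQ [Qr Q0]]]].
have [a [b [eta [aE bE etaE E]]]] := start_homotopy F (resolution_start Qr).
have dinj y z : dQ 2%N y = dQ 2%N z -> y = z.
  move=> yz; apply/eqP; rewrite -subr_eq0; apply/eqP.
  have [|w ->] := (pr_exact Qr (i := 2) (y - z)).1; first by rewrite linearB yz subrr.
  by rewrite (Q0 4%N _ w) ?linear0.
have lift (u : kernel d2) : exists y, a (val u) = dQ 2%N y.
  by apply/(pr_exact Qr)/aE/kernelP.
have [c cE] := boolp.choice lift.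
have [c' c'E] : {c' : {linear kernel d2 -> Q 3%N} | c' =1 c}.
  apply: linear_of => [u v|x u]; apply: dinj.
    by rewrite linearB /= -!cE linearB.
  by rewrite linearZ_LR -!cE linearZ_LR.
have bker y : d2 (b (dQ 2%N y)) = 0 by apply/bE/(pr_exact Qr); exists y.
pose bb y := projT1 (kernel_mk (bker y)).
have bbE y : val (bb y) = b (dQ 2%N y) by rewrite /bb; case: kernel_mk.
have [b' b'E] : {b' : {linear Q 3%N -> kernel d2} | b' =1 bb}.
  apply: linear_of => [u v|x u]; apply: val_inj.
    by rewrite linearB /= !bbE !linearB.
  by rewrite GRing.valZ !bbE !linearZ_LR.
pose ee y := projT1 (kernel_mk (etaE y)).
have eeE y : val (ee y) = eta y by rewrite /ee; case: kernel_mk.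
have [e' e'E] : {e' : {linear F2 -> kernel d2} | e' =1 ee}.
  apply: linear_of => [u v|x u]; apply: val_inj.
    by rewrite linearB /= !eeE !linearB.
  by rewrite GRing.valZ !eeE !linearZ_LR.
move=> X Y f g fsurj.
have projQ : projective (Q 3%N) by exact: (pr_projective Qr).
have [p pE] := projQ _ _ f (g \o b') fsurj.
have projF : projective F2 by exact: (st_proj2 F).
have [q qE] := projF _ _ f (g \o e') fsurj.
have [vl vlE] : {v : {linear kernel d2 -> F2} | v =1 val}.
  by apply: linear_of => [u v|x u]; rewrite ?linearB ?linearZ_LR.
have [h hE] : {h : {linear kernel d2 -> X} | forall u, h u = p (c' u) + q (vl u)}.
  apply: linear_of => [u v|x u]; last by rewrite !linearZ_LR scalerDr.
  by rewrite !linearB /= addrACA -opprD.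
exists h => u; rewrite hE linearD pE qE /= -linearD; congr (g _).
apply: val_inj; rewrite linearD /= b'E e'E bbE eeE c'E -cE vlE -E //.
exact: kernelP.
Qed.

(** With Q_3 = 0 the map [a] kills the kernel of [d2], so [eta] is a projection of F2 onto that
    kernel. Such a projection is refuted for the trivial module in [cusp_proj_dim_gt]. *)
Lemma syzygy_split (M F0 F1 F2 : lmodType A) e d1 d2 :
  @start M F0 F1 F2 e d1 d2 -> proj_dim_le M 2 ->
  exists eta : {linear F2 -> F2},
    (forall y, d2 (eta y) = 0) /\ (forall y, d2 y = 0 -> eta y = y).
Proof.
move=> F [Q [dQ [eQ [Qr Q0]]]].
have [a [b [eta [aE bE etaE E]]]] := start_homotopy F (resolution_start Qr).
exists eta; split=> // y dy; have [|z az] := (pr_exact Qr (i := 1) (a y)).1.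
  exact: aE.
by rewrite {2}(E y dy) az (Q0 3%N _ z) // !linear0 add0r.
Qed.

End Ungraded.

Lemma alg_scalar_eq0 (k : fieldType) (A : algType k) (c : k) : c *: (1 : A) = 0 -> c = 0.
Proof.
move=> c0; apply/eqP; apply: contraT => cN0.
by have := oner_neq0 A; rewrite -[1]scale1r -(mulVf cN0) -scalerA c0 scaler0 eqxx.
Qed.

Lemma projective_row (R : nzRingType) m : projective 'rV[R]_m.
Proof.
move=> M N f g fsurj.
have [x xE] := boolp.choice (fun i : 'I_m => fsurj (g (delta_mx 0 i))).
have [h hE] : {h : {linear 'rV[R]_m -> M} | forall v, h v = \sum_i v 0 i *: x i}.
  apply: linear_of => [u v|a u].
    by rewrite -sumrB; apply: eq_bigr => i _; rewrite !mxE scalerBl.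
  by rewrite scaler_sumr; apply: eq_bigr => i _; rewrite mxE scalerA.
exists h => v; rewrite hE linear_sum [v in RHS]row_sum_delta linear_sum.
by apply: eq_bigr => i _; rewrite !linearZ_LR xE.
Qed.

Section GradedAlgebra.
Variables (k : fieldType) (A : algType k) (gr : nat -> A -> Prop).
Hypothesis gr_sum : internal_direct_sum gr.
Hypothesis gr_mul : forall m n a b, gr m a -> gr n b -> gr (m + n)%N (a * b).

Lemma int_projector : exists p, projector (int_grading gr) p.
Proof.
have [q qP] := projector_exists gr_sum.
exists (fun n => match n with Posz m => q m | Negz _ => fun=> 0 end).
split=> [[m|m] v|[m|m] u v|[m|m] v|[i|i] [j|j] v|v] //=.
- exact: (pj_in qP).
- exact: (pj_sub qP).
- by rewrite subrr.
- exact: (pj_id qP).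
- move=> gi ji; apply: (pj_0 qP gi).
  by apply: contraNneq ji => ->.
- by move=> -> _; rewrite (additive0 (pj_sub qP j)).
have [s [Us s0 sE]] := pj_fin qP v; exists (map Posz s); split.
- by rewrite map_inj_uniq // => i j [].
- case=> [i|i] // i_s; apply: s0; apply: contraNN i_s; exact: map_f.
by rewrite big_map.
Qed.

Lemma int_grading_sum : internal_direct_sum (int_grading gr).
Proof.
have [p pP] := int_projector; apply: (ids_of_projector _ _ pP).
  by case=> [n|n] //; apply: (ids_gr0 gr_sum).
by case=> [n|n] u v /=; [apply: (ids_grB gr_sum) | move=> -> ->; rewrite subrr].
Qed.

Lemma int_grading_mul m n a b : int_grading gr m a -> int_grading gr n b ->
  int_grading gr (m + n) (a * b).
Proof.
have g0 := ids_gr0 int_grading_sum.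
case: m n => [m|m] [n|n] ga gb; first exact: gr_mul.
- by have -> : b = 0 := gb; rewrite mulr0; apply: g0.
- by have -> : a = 0 := ga; rewrite mul0r; apply: g0.
by have -> : a = 0 := ga; rewrite mul0r; apply: g0.
Qed.

(** The grading of the free module whose [m] generators sit in degree [s]. *)
Definition row_deg m (s : int) (n : int) (v : 'rV[A]_m) : Prop :=
  forall i, int_grading gr (n - s) (v 0 i).

Fact row_ok m s : graded_module gr (@row_deg m s).
Proof.
have g0 := ids_gr0 int_grading_sum; have gB := ids_grB int_grading_sum.
have [p pP] := int_projector; split; last first.
  move=> d n a v ga gv i; rewrite mxE -addrA.
  exact: (int_grading_mul (m := d%:Z)).
apply: (@ids_of_projector _ _ _ (fun n (v : 'rV[A]_m) => \row_i p (n - s) (v 0 i))).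
- by move=> n i; rewrite mxE.
- by move=> n u v gu gv i; rewrite !mxE; apply: gB.
split=> [n v i|n u v|n v gv|n j v gv jn|v].
- by rewrite mxE; apply: (pj_in pP).
- by apply/rowP => i; rewrite !mxE (pj_sub pP).
- by apply/rowP => i; rewrite mxE (pj_id pP).
- apply/rowP => i; rewrite !mxE; apply: (pj_0 pP (gv i)).
  by rewrite (inj_eq (addIr _)).
have [S SP] := boolp.choice (pj_fin pP).
exists (undup (flatten [seq [seq j + s | j <- S (v 0 i)] | i <- enum 'I_m])).
have out n i : n \notin undup (flatten [seq [seq j + s | j <- S (v 0 i)] | i <- enum 'I_m]) ->
    n - s \notin S (v 0 i).
  rewrite mem_undup; apply: contraNN => ns; apply/flattenP.
  exists [seq j + s | j <- S (v 0 i)]; first by apply: map_f; rewrite mem_enum.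
  by apply/mapP; exists (n - s); rewrite ?subrK.
split=> [|n nS|]; first exact: undup_uniq.
  by apply/rowP => i; have [_ s0 _] := SP (v 0 i); rewrite !mxE s0 // out.
apply/rowP => i; rewrite summxE; under eq_bigr do rewrite mxE.
have [Us s0 {1}->] := SP (v 0 i).
transitivity (\sum_(n <- [seq j + s | j <- S (v 0 i)]) p (n - s) (v 0 i)).
  by rewrite big_map; apply: eq_bigr => j _; rewrite addrK.
apply: sum_widen => [|||n ns].
- by rewrite map_inj_uniq //; apply: addIr.
- exact: undup_uniq.
- move=> n ns; rewrite mem_undup; apply/flattenP.
  by exists [seq j + s | j <- S (v 0 i)] => //; apply: map_f; rewrite mem_enum.
apply: s0; apply: contraNN ns => ns.
by apply/mapP; exists (n - s); rewrite ?subrK.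
Qed.

Definition row_gmod m s : gmod gr := Gmod (@row_ok m s).

Fact reg_ok : @graded_module k A gr A^o (int_grading gr).
Proof.
split; first exact: int_grading_sum.
by move=> m n a v ga gv; apply: (int_grading_mul (m := m%:Z)).
Qed.

Definition reg_gmod : gmod gr := Gmod reg_ok.

Lemma projector_mulr p d a b n : projector gr p -> gr d b ->
  p (n + d)%N (a * b) = p n a * b.
Proof.
move=> pP gb; have [s [Us sE]] := pj_sum pP a.
pose t := undup (n :: s); have Ut : uniq t by apply: undup_uniq.
rewrite {1}(sE t) //; last by move=> l ls; rewrite mem_undup inE ls orbT.
rewrite mulr_suml (additive_sum (pj_sub pP _)) (bigD1_seq n) //=; last first.
  by rewrite mem_undup mem_head.
rewrite (pj_id pP (gr_mul (pj_in pP _ _) gb)) big1 ?addr0 // => l ln.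
by apply: (pj_0 pP (gr_mul (pj_in pP _ _) gb)); rewrite eqn_add2r eq_sym.
Qed.

Lemma projector0_mulr p d a b : projector gr p -> gr d b -> (0 < d)%N ->
  p 0%N (a * b) = 0.
Proof.
move=> pP gb d0; have [s [Us sE]] := pj_sum pP a.
rewrite (sE s) // mulr_suml (additive_sum (pj_sub pP _)) big1 // => l _.
apply: (pj_0 pP (gr_mul (pj_in pP _ _) gb)).
by rewrite eq_sym addn_eq0 negb_and -!lt0n d0 orbT.
Qed.

End GradedAlgebra.

(** * The first terms of the Koszul resolution of the trivial module *)

Section KoszulStart.
Variables (k : fieldType) (A : algType k) (gr : nat -> A -> Prop) (n : nat).
Variables (x : 'I_n -> A) (W : {vspace 'M[k]_n}).
Hypothesis AxW : quadratic_algebra gr x W.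
Hypothesis gr_sum : internal_direct_sum gr.
Hypothesis gr_mul : forall m n a b, gr m a -> gr n b -> gr (m + n)%N (a * b).
Hypothesis gr_conn : forall a, gr 0%N a <-> exists c : k, a = c%:A.

Lemma gen_deg1 i : gr 1%N (x i).
Proof. by apply/(qa_grading AxW); apply: word_span1. Qed.

Lemma deg1P a : gr 1%N a <-> exists c : 'I_n -> k, a = \sum_i c i *: x i.
Proof.
rewrite (qa_grading AxW) -/(word_span x 1 a); split=> [[c ->]|[c ->]]; last first.
  by apply: word_span_sum => i; apply/word_spanZ/word_span1.
exists (fun i => c [tuple i]).
rewrite (reindex (fun i : 'I_n => [tuple i])) /=.
  by apply: eq_bigr => i _; rewrite big_seq1.
exists (fun t : 1.-tuple 'I_n => thead t) => [i _|t _] /=; first by rewrite theadE.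
by rewrite [t in RHS]tuple_eta; apply/val_inj; case: t => [[|a0 [|? ?]]].
Qed.

(** A linear relation is a syzygy with constant coefficients. By [koszul_exact] these constants lie
    in the left ideal generated by elements of degree one, whose degree zero component vanishes. *)
Lemma gen_indep (c : 'I_n -> k) : \sum_i c i *: x i = 0 -> forall i, c i = 0.
Proof.
move=> c0 i; have [p pP] := projector_exists gr_sum.
have [|m [g [w [wW E]]]] := koszul_exact AxW (f := fun i => (c i)%:A).
  by rewrite -[RHS]c0; apply: eq_bigr => j _; rewrite mulr_algl.
apply: (@alg_scalar_eq0 _ A); have gc : gr 0%N (c i)%:A by apply/gr_conn; exists (c i).
rewrite -(pj_id pP gc) E (additive_sum (pj_sub pP _)) big1 // => r _.
apply: (projector0_mulr gr_mul _ pP (d := 1%N)) => //.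
by apply/deg1P; exists (fun j => w r j i).
Qed.

(** A priori a quadratic relation only lies in the ideal generated by W. In the degree one part of
    [koszul_exact] the coefficients [g r] are replaced by their degree zero components, which are
    scalars. *)
Lemma rel_closed (w : 'M[k]_n) : \sum_i \sum_j w i j *: (x i * x j) = 0 -> w \in W.
Proof.
move=> w0; have [p pP] := projector_exists gr_sum.
have [|m [g [v [vW E]]]] := koszul_exact AxW (f := fun j => \sum_i w i j *: x i).
  rewrite -[RHS]w0 exchange_big; apply: eq_bigr => j _ /=.
  by rewrite mulr_suml; apply: eq_bigr => i _; rewrite scalerAl.
have /boolp.choice [c cE] r : exists c : k, p 0%N (g r) = c%:A.
  by apply/gr_conn/(pj_in pP).
suff -> : w = \sum_r c r *: v r by apply: memv_suml => r _; apply: memvZ.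
suff E0 j : \sum_i (w i j - (\sum_r c r *: v r) i j) *: x i = 0.
  by apply/matrixP => i j; apply/eqP; rewrite -subr_eq0; apply/eqP/(gen_indep (E0 j)).
transitivity (\sum_i w i j *: x i - \sum_i (\sum_r c r *: v r) i j *: x i).
  by rewrite -sumrB; apply: eq_bigr => i _; rewrite scalerBl.
apply/eqP; rewrite subr_eq0; apply/eqP.
have gw : gr 1%N (\sum_i w i j *: x i) by apply/deg1P; exists (fun i => w i j).
rewrite -(pj_id pP gw) E (additive_sum (pj_sub pP _)).
under [RHS]eq_bigr do rewrite summxE scaler_suml.
rewrite [RHS]exchange_big; apply: eq_bigr => r _ /=.
rewrite (projector_mulr gr_mul _ 0 pP (d := 1%N)).
  rewrite cE mulr_algl scaler_sumr; apply: eq_bigr => i _.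
  by rewrite mxE scalerA.
by apply/deg1P; exists (fun i => v r i j).
Qed.

Let wb (r : 'I_(\dim W)) : 'M[k]_n := (vbasis W)`_r.

Definition koszul1 : 'M[A]_(n, 1) := \col_i x i.
Definition koszul2 : 'M[A]_(\dim W, n) :=
  \matrix_(r, i) \sum_j (vbasis W)`_r j i *: x j.

Let wbW r : wb r \in W. Proof. by apply/vbasis_mem/mem_nth; rewrite size_tuple. Qed.

Variables (K : lmodType A) (k0 : K).
Hypothesis k0_neq0 : k0 != 0.
Hypothesis k0_gen : forall v, exists c : k, v = (c%:A : A) *: k0.
Hypothesis k0_ann : forall (m : nat) (a : A) (v : K), (0 < m)%N -> gr m a -> a *: v = 0.

Fact trivial_ok : graded_module gr (conc (0 : int) (V := K)).
Proof.
split; first exact: conc_sum.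
move=> [|m] n0 a v ga gv; last by right; apply: (k0_ann _ _ ga).
by case: gv => [->|->]; [left | right; rewrite scaler0].
Qed.

Definition trivial_gmod : gmod gr := Gmod trivial_ok.

Lemma aug_decomp a : exists (c : k) (g : 'I_n -> A), a = c%:A + \sum_i g i * x i.
Proof.
have [f ->] := qa_onto AxW a; have [c ->] := free_rdivE f.
exists c, (fun i => eval_free x (rdiv i f)).
rewrite eval_freeD eval_freeZ eval_free1 eval_free_sum; congr (_ + _).
by apply: eq_bigr => i _; rewrite eval_freeM eval_free_gen.
Qed.

Lemma scalar_k0 (c : k) : (c%:A : A) *: k0 = 0 -> c = 0.
Proof.
move=> c0; apply/eqP; apply: contraNT k0_neq0 => cN0; apply/eqP.
rewrite -[k0]scale1r -[1](_ : (c^-1%:A * c%:A) = 1) -?scalerA ?c0 ?scaler0 //.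
by rewrite mulr_algl scalerA mulVf // scale1r.
Qed.

Lemma koszul_start : exists e : {linear 'rV[A]_1 -> K},
  @res_start k A gr trivial_gmod (row_gmod gr_sum gr_mul 1 0)
    (row_gmod gr_sum gr_mul n 1) (row_gmod gr_sum gr_mul (\dim W) 2)
    e (mulmxr koszul1) (mulmxr koszul2).
Proof.
have [e eE] : {e : {linear 'rV[A]_1 -> K} | forall v, e v = v 0 0 *: k0}.
  by apply: linear_of => [u v|a u]; rewrite !mxE ?scalerBl ?scalerA.
have k1E (v : 'rV_n) : (v *m koszul1) 0 0 = \sum_i v 0 i * x i.
  by rewrite mxE; apply: eq_bigr => i _; rewrite mxE.
have gx := gen_deg1.
have ga v : (\sum_i v i * x i) *: k0 = 0.
  by rewrite scaler_suml big1 // => i _; rewrite -scalerA (k0_ann k0 _ (gx i)) ?scaler0.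
exists e; split=> [||||m v gv|m u gu|v|v|v]; try exact: projective_row.
- move=> m v gv; rewrite eE; have [->|m0] := eqVneq m 0; [by left | right].
  have := gv 0; rewrite subr0; case: m m0 {gv} => [m|m] m0 /=.
    by move=> gv; apply: (k0_ann _ _ gv); rewrite lt0n.
  by move=> ->; rewrite scale0r.
- move=> i; rewrite /= ord1 k1E subr0.
  apply: (closed_sum (ids_gr0 (int_grading_sum gr_sum) )
     (ids_grB (int_grading_sum gr_sum))) => j _.
  by rewrite -(subrK 1 m); apply: (int_grading_mul gr_sum gr_mul (n := 1)) (gv j) (gx j).
- move=> i; rewrite /= mxE.
  apply: (closed_sum (ids_gr0 (int_grading_sum gr_sum) )
     (ids_grB (int_grading_sum gr_sum))) => j _.
  rewrite (_ : m - 1 = (m - 2) + 1); last by rewrite -addrA.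
  apply: (int_grading_mul gr_sum gr_mul (n := 1)) (gu j) _.
  by rewrite mxE; apply/deg1P; exists (fun l => wb j l i).
- have [c ->] := k0_gen v; exists (const_mx c%:A).
  by rewrite eE mxE.
- rewrite eE; split=> [|[z ->]]; last by rewrite /= k1E ga.
  have [c [g vE]] := aug_decomp (v 0 0); rewrite {1}vE scalerDl ga addr0.
  move/scalar_k0 => c0; exists (\row_i g i); apply/rowP => i.
  rewrite ord1 /= k1E vE c0 scale0r add0r.
  by apply: eq_bigr => j _; rewrite mxE.
have k2E (u : 'rV_(\dim W)) i :
    (u *m koszul2) 0 i = \sum_r u 0 r * \sum_j (vbasis W)`_r j i *: x j.
  by rewrite mxE; apply: eq_bigr => r _; rewrite mxE.
split=> [v0|[u ->]].
  have [|g gE] := koszul_exact_basis AxW (f := v 0).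
    by rewrite -k1E; have /matrixP -> := v0; rewrite mxE.
  exists (\row_r g r); apply/rowP => i; rewrite /= k2E gE.
  by apply: eq_bigr => r _; rewrite mxE.
apply/rowP => i; rewrite ord1 /= k1E mxE.
under eq_bigr do rewrite k2E mulr_suml.
rewrite exchange_big big1 // => r _ /=.
under eq_bigr do rewrite -mulrA.
rewrite -mulr_sumr (_ : \sum_i _ = 0) ?mulr0 // -[RHS](quad_rel AxW (wbW r)).
rewrite exchange_big; apply: eq_bigr => j _ /=; rewrite mulr_suml.
by apply: eq_bigr => l _; rewrite scalerAl.
Qed.

End KoszulStart.

(** * The tensor of a regular quadratic algebra *)

Section RegularTensor.
Variables (k : fieldType) (A : algType k) (gr : nat -> A -> Prop) (n : nat).
Variables (x : 'I_n -> A) (W : {vspace 'M[k]_n}).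
Hypothesis AxW : quadratic_algebra gr x W.
Hypothesis gr_sum : internal_direct_sum gr.
Hypothesis gr_mul : forall m n a b, gr m a -> gr n b -> gr (m + n)%N (a * b).

(* A homogeneous element of degree 3 in the second syzygy of the trivial module
   is a tensor in (V (x) W) \cap (W (x) V). *)
Lemma koszul_tensor (u : 'rV[A]_(\dim W)) :
  (forall a, gr 0%N a <-> exists c : k, a = c%:A) ->
  (forall r, gr 1%N (u 0 r)) -> u *m koszul2 x W = 0 -> u != 0 ->
  exists T : 'I_n -> 'M[k]_n,
    [/\ exists l, T l != 0, forall l, T l \in W
      & forall j, \matrix_(l, i) T l i j \in W].
Proof.
move=> gr_conn u1 u0 uN0.
have /boolp.choice [g gE] r : exists c : 'I_n -> k, u 0 r = \sum_i c i *: x i.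
  by apply/(deg1P AxW).
pose wb r := (vbasis W)`_r.
exists (fun l => \sum_(r < \dim W) g r l *: wb r).
have wbW (r : 'I_(\dim W)) : wb r \in W.
  by apply/vbasis_mem/mem_nth; rewrite size_tuple.
split=> [|l|j].
- apply: boolp.contrapT => T0; case/eqP: uN0; apply/rowP => r; rewrite mxE gE.
  rewrite big1 // => l _.
  have /freeP vfree := basis_free (vbasisP W).
  rewrite (vfree (g^~ l)) ?scale0r //; apply/eqP/negPn/negP => Tl.
  by apply: T0; exists l.
- by apply: memv_suml => r _; apply/memvZ/wbW.
apply: (rel_closed AxW gr_sum gr_mul gr_conn).
have /rowP/(_ j) := u0; rewrite !mxE => E0; rewrite -[RHS]E0 {E0}.
transitivity (\sum_l \sum_i \sum_(r < \dim W) (g r l * wb r i j) *: (x l * x i)).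
  apply: eq_bigr => l _; apply: eq_bigr => i _; rewrite mxE summxE scaler_suml.
  by apply: eq_bigr => r _; rewrite mxE.
under eq_bigr do rewrite exchange_big.
rewrite exchange_big; apply: eq_bigr => r _ /=.
rewrite mxE gE mulr_suml; apply: eq_bigr => l _.
rewrite -scalerAl mulr_sumr scaler_sumr; apply: eq_bigr => i _.
by rewrite -scalerAr scalerA.
Qed.

End RegularTensor.

Section MinimalSyzygy.
Variables (k : fieldType) (A : algType k) (gr : nat -> A -> Prop).
Hypothesis gr_sum : internal_direct_sum gr.
Hypothesis gr_mul : forall m n a b, gr m a -> gr n b -> gr (m + n)%N (a * b).

(* A graded Nakayama argument: a coordinate functional of a dual basis does not
   vanish on an element of minimal degree. *)
Lemma minimal_functional (M : gmod gr) (N : int) (u : gm_sort M) :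
  projective (gm_sort M) -> gm_deg N u -> u != 0 ->
  (forall i v, i < N -> @gm_deg _ _ _ M i v -> v = 0) ->
  exists g : {linear gm_sort M -> A^o},
    (forall j y, gm_deg j y -> int_grading gr (j - N) (g y)) /\ g u != 0.
Proof.
move=> projM uN u0 Nmin.
have [pA pAP] := int_projector gr_sum; have [p pP] := projector_exists (gm_sum M).
pose Fr : lmodType A := malg (gm_sort M) A.
have cB (t : gm_sort M) (a b : A) : (a - b) *: t = a *: t - b *: t by exact: scalerBl.
pose c0 (f : Fr) : gm_sort M := malg_sum (fun t a => a *: t) f.
have c0U a t : c0 << a *g t >> = a *: t by apply: malg_sumU.
have [c cE] : {c : {linear Fr -> gm_sort M} | c =1 c0}.
  apply: linear_of => [f g|a f]; first exact: malg_sumB.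
  move: f; apply: malg_ext => [f g|f g|t b].
  - by rewrite scalerBr; apply: malg_sumB.
  - by rewrite /c0 (malg_sumB cB) scalerBr.
  by rewrite malgUZ !c0U scalerA.
have [|s sE] := projM _ _ c idfun.
  by move=> t; exists << 1 *g t >>; rewrite cE c0U scale1r.
have coordL t : {f : {linear gm_sort M -> A^o} | forall v, f v = mcoeff t (s v)}.
  apply: linear_of => [v w|a v]; first by rewrite linearB mcoeffB.
  by rewrite linearZ_LR mcoeffZ.
pose f t := projT1 (coordL t).
have fE t v : f t v = mcoeff t (s v) by rewrite /f; case: (coordL t).
(* Here u is the sum of the f_t(u) t. In degree N a component of f_t(u) of positive degree i meets
   the component of t of degree N - i, which is zero by minimality; so some f_t(u) has a nonzero
   degree zero component. *)
have [t ft] : exists t, pA 0 (f t u) != 0.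
  apply: boolp.contrapT => noft; case/eqP: u0.
  rewrite -(pj_id pP uN) -[u in p N u](sE u) /= cE.
  rewrite (additive_sum (pj_sub pP _)) big1 // => t _; rewrite -fE.
  have [S [US S0 SE]] := pj_fin pAP (f t u).
  rewrite SE scaler_suml (additive_sum (pj_sub pP _)) big1 // => i _.
  have [i0|i0] := boolP (0 < i); last first.
    have [->|iN0] := eqVneq i 0.
      suff -> : pA 0 (f t u) = 0 by rewrite scale0r (additive0 (pj_sub pP _)).
      by apply/eqP/negPn/negP => ft; apply: noft; exists t.
    case: i i0 iN0 => [[|i]|i] // _ _.
    have -> : pA (Negz i) (f t u) = 0 by apply: (pj_in pAP (Negz i)).
    by rewrite scale0r (additive0 (pj_sub pP _)).
  case: i i0 => [i|i] // i0; rewrite -[N](subrKC i%:Z).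
  rewrite (projector_scale _ _ pP); last exact: (pj_in pAP i%:Z).
  rewrite (Nmin (N - i%:Z) (p (N - i%:Z) t)) ?scaler0 //; last exact: (pj_in pP).
  by rewrite Num.Theory.ltrBlDr Num.Theory.ltrDl.
have pR : projector (@gm_deg _ _ _ (reg_gmod gr_sum gr_mul)) pA by [].
(* The coordinate [f t] need not be homogeneous; its component of degree -N takes the value pA 0 (f
   t u) on [u]. *)
have [g gE] := degree_component (Y := reg_gmod gr_sum gr_mul) gr_sum (- N) (f t) pR.
exists g; split=> [j y gy|]; first by rewrite (gE _ _ gy); apply: (pj_in pAP).
by rewrite (gE _ _ uN) subrr.
Qed.

End MinimalSyzygy.

Lemma int_grading_neg (k : fieldType) (A : algType k) (gr : nat -> A -> Prop)
    (n : int) a : n < 0 -> int_grading gr n a -> a = 0.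
Proof. by case: n. Qed.

Section RegularTensorMain.
Variables (k : fieldType) (A : algType k) (gr : nat -> A -> Prop) (n : nat).
Variables (x : 'I_n.+1 -> A) (W : {vspace 'M[k]_n.+1}).

(** Without such a T, the third syzygy Omega of the trivial module starts in some degree N >= 4. A
    functional on Omega of degree m <= -3 whose class in Ext^3 is zero comes from the free module on
    the relations, generated in degree 2, so it vanishes. Now some functional of degree -N is
    nonzero on an element of minimal degree, which forces -N to be the degree of the one-dimensional
    Ext^3. Multiplied by a generator it stays nonzero, in the degree 1 - N where Ext^3 vanishes. *)
Theorem regular_tensor : quadratic_algebra gr x W -> regular_algebra gr 3 ->
  exists T : 'I_n.+1 -> 'M[k]_n.+1,
    [/\ exists l, T l != 0, forall l, T l \in W
      & forall j, \matrix_(l, i) T l i j \in W].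
Proof.
move=> AxW [[gr_sum gr_mul gr_conn _] _ [gld _] _].
move=> [K [P [dP [grP [e [Gres _ [l [[f0 [[f0g f0d] f0n _]] Ext3]]]]]]]].
have [[k0 [k0n k0g k0a]] Pr Pg PdP Pe] := Gres.
have [e0 F] := koszul_start AxW gr_sum gr_mul k0n k0g k0a.
have xc (c : k) : c *: x ord0 = 0 -> c = 0.
  move=> cx; have := gen_indep AxW gr_sum gr_mul gr_conn (c := fun i => c *+ (i == ord0)).
  rewrite (bigD1 ord0) //= mulr1n cx add0r big1 => [/(_ erefl ord0)|i /negbTE ->].
    by rewrite mulr1n.
  by rewrite mulr0n scale0r.
pose X i : gmod gr := Gmod (Pg i).
pose F2 := row_gmod gr_sum gr_mul (\dim W) 2.
pose d2 : {linear 'rV[A]_(\dim W) -> 'rV[A]_n.+1} := mulmxr (koszul2 x W).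
have Q : @res_start k A gr (trivial_gmod k0a) (X 0%N) (X 1%N) (X 2%N) e
    (dP 0%N) (dP 1%N).
  split.
  - exact: (pr_projective Pr).
  - exact: (pr_projective Pr).
  - exact: (pr_projective Pr).
  - move=> m y gy; have [->|m0] := eqVneq m 0; [by left | right].
    exact: (Pe _ _ m0 gy).
  - by move=> m y; apply: PdP.
  - by move=> m y; apply: PdP.
  - exact: (pr_onto Pr).
  - exact: (pr_exact0 Pr).
  - exact: (pr_exact Pr).
have Fs : start e0 (mulmxr (koszul1 x)) d2 by case: F => *; split.
have projOm : projective (kernel d2) := syzygy_projective Fs (gld K).
have d2g : ghom (X := F2) (Y := row_gmod gr_sum gr_mul n.+1 1) d2 := rs_d2 F.
pose Om : gmod gr := ker_gmod d2g.
have rs0 (z : P 3%N) : dP 1%N (dP 2%N z) = 0.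
  by apply/(pr_exact Pr); exists z.
apply: boolp.contrapT => noT.
have N3 (u : 'rV[A]_(\dim W)) : u *m koszul2 x W = 0 -> (forall r, gr 1%N (u 0 r)) -> u = 0.
  move=> u0 u1; apply/eqP/negPn/negP => un; apply: noT.
  exact: (koszul_tensor AxW gr_sum gr_mul gr_conn u1 u0 un).
have le3 (j : int) (u : 'rV[A]_(\dim W)) : j <= 3 -> row_deg gr 2 j u -> d2 u = 0 -> u = 0.
  move=> j3 gu du; have [j2|[j2|j2]] : j < 2 \/ j = 2 \/ j = 3 by lia.
  - apply/rowP => r; rewrite mxE; apply: (int_grading_neg _ (gu r)); lia.
  (* In degree 2 the entries of [u] are scalars; multiplication by a generator moves [u] to degree
     3, where [N3] applies, and no generator is killed by a nonzero scalar. *)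
  - have /rowP xu : x ord0 *: u = 0.
      apply: N3 => [|r]; first by rewrite -scalemxAl [u *m _]du scaler0.
      by rewrite mxE; apply: (gr_mul _ 0%N _ _ (gen_deg1 AxW _)); have := gu r; rewrite j2.
    apply/rowP => r; rewrite mxE; have := gu r; rewrite j2 => /gr_conn [c cE].
    have := xu r; rewrite !mxE cE mulr_algr => cx.
    by rewrite (xc _ cx) scale0r.
  by apply: (N3 _ du) => r; have := gu r; rewrite j2.
have projP i : projective (P i) by exact: (pr_projective Pr).
(* If Omega were zero, the comparison with the Koszul complex would give [zeta] such that y and zeta
   (d y) differ by a boundary for all y in P_3. Then f0 = f0 zeta d, against the choice of [f0]. *)
have [w1 w1n] : exists w : kernel d2, w != 0.
  apply: boolp.contrapT => Om0; apply: f0n.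
  have [a [b [eta [[ga gb geta] [aE bE etaE hE]]]]] := res_start_homotopy gr_sum Q F.
  have [z|zeta [gz zetaE]] := graded_lift gr_sum (P := X 2%N) (X := X 3%N) (Y := X 2%N)
      (d := dP 2%N) (g := eta) (projP 2%N) (PdP 2%N) geta.
    by have [|y yE] := (pr_exact Pr (eta z)).1; [apply: etaE | exists y].
  exists (f0 \o zeta); split=> [m y gy|y] /=; first by apply/f0g/gz.
  have [|v vE] := (pr_exact Pr (y - zeta (dP 2%N y))).1.
    rewrite linearB /= zetaE {1}(hE (dP 2%N y)) //.
    have [|u uE] := kernel_mk (f := d2) (x := a (dP 2%N y)); first exact: aE.
    have u0 : u = 0 by apply/eqP/negPn/negP => un; apply: Om0; exists u.
    by rewrite -uE u0 GRing.val0 linear0 add0r subrr.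
  by apply/eqP; rewrite -subr_eq0 -linearB vE f0d.
have [N [N4 [w [gw w0] Nmin]]] : exists N : int, (4 <= N) /\
   exists2 w : kernel d2, row_deg gr 2 N (val w) /\ w != 0 &
     forall j (v : kernel d2), j < N -> row_deg gr 2 j (val v) -> v = 0.
  pose PN (N : nat) := exists w : kernel d2, row_deg gr 2 N%:Z (val w) /\ w != 0.
  have le3K (j : int) (v : kernel d2) : j <= 3 -> row_deg gr 2 j (val v) -> v = 0.
    by move=> j3 gv; apply/val_inj/(le3 _ _ j3 gv)/kernelP.
  have ex : exists N, boolp.asbool (PN N).
    have [p pP] := projector_exists (gm_sum Om).
    apply: boolp.contrapT => noN; case/eqP: w1n; apply: (projector_eq0 pP) => i.
    apply/eqP/negPn/negP => pi0; have gi := pj_in pP i w1.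
    case: i pi0 gi => [i|i] pi0 gi; last by case/eqP: pi0; apply: le3K gi.
    by apply: noN; exists i; apply/boolp.asboolP; exists (p i%:Z w1).
  have [N /boolp.asboolP [w [gw wn]] Nmin] := ex_minnP ex.
  exists N%:Z; split.
    by rewrite Order.TotalTheory.leNgt; apply: contra_neqN wn => N3'; apply: le3K gw; lia.
  exists w => // j v jN gv; apply/eqP/negPn/negP => vn.
  case: j jN gv => [j|j] jN gv; last by case/eqP: vn; apply: le3K gv.
  have /Nmin : boolp.asbool (PN j) by apply/boolp.asboolP; exists v.
  lia.
(* Transported to P_3, [phi] becomes a cocycle and hence a coboundary; undoing the transport extends
   [phi] to a functional [G] on the free module. Its values on the generators have degree 2 + m <
   0. *)
have vanish (m : int) (phi : {linear kernel d2 -> A^o}) : m <= - 3%:Z ->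
    Ext_zero gr dP grP 3 m ->
    (forall j y, row_deg gr 2 j (val y) -> int_grading gr (j + m) (phi y)) ->
    forall y, phi y = 0.
  move=> m3 Em gphi.
  have [a [b [eta [[ga gb geta] [aE bE etaE hE]]]]] := res_start_homotopy gr_sum F Q.
  have bker z : d2 (b (dP 2%N z)) = 0 by apply/bE/rs0.
  pose bb z := projT1 (kernel_mk (bker z)).
  have bbE z : val (bb z) = b (dP 2%N z) by rewrite /bb; case: kernel_mk.
  pose ee z := projT1 (kernel_mk (etaE z)).
  have eeE z : val (ee z) = eta z by rewrite /ee; case: kernel_mk.
  have [psi psiE] : {f : {linear P 3%N -> A^o} | forall z, f z = phi (bb z)}.
    apply: linear_of => [u v|c u].
      by rewrite -linearB; congr (phi _); apply: val_inj; rewrite GRing.valB !bbE !linearB.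
    by rewrite -linearZ_LR; congr (phi _); apply: val_inj; rewrite GRing.valZ !bbE !linearZ_LR.
  have [|g [gg gE]] := Em psi.
    split=> [j z gz|z].
      by rewrite psiE; apply: gphi; rewrite bbE; apply/gb/PdP.
    rewrite psiE -[RHS](linear0 phi); congr (phi _); apply: val_inj.
    rewrite bbE GRing.val0 (_ : dP 2%N (dP 3%N z) = 0) ?linear0 //.
    by apply/(pr_exact Pr); exists z.
  have [G GE] : {f : {linear 'rV[A]_(\dim W) -> A^o} | forall y, f y = g (a y) + phi (ee y)}.
    apply: linear_of => [u v|c u].
      have -> : ee (u - v) = ee u - ee v.
        by apply: val_inj; rewrite GRing.valB !eeE linearB.
      by rewrite !linearB /= opprD addrACA.
    have -> : ee (c *: u) = c *: ee u.
      by apply: val_inj; rewrite GRing.valZ !eeE linearZ_LR.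
    by rewrite !linearZ_LR scalerDr.
  have G0 y : G y = 0.
    rewrite [y]row_sum_delta linear_sum big1 // => r _; rewrite linearZ_LR.
    suff -> : G (delta_mx 0 r) = 0 by rewrite scaler0.
    have gd : row_deg gr 2 2 (delta_mx 0 r : 'rV[A]_(\dim W)).
      move=> i; rewrite subrr mxE; apply/gr_conn; exists ((i == r)%:R).
      by rewrite eqxx scaler_nat.
    apply: (@int_grading_neg _ _ gr (2 + m)); first lia.
    rewrite GE; apply: (closedD (ids_gr0 (int_grading_sum gr_sum))
      (ids_grB (int_grading_sum gr_sum))); first by apply/gg/ga.
    by apply: gphi; rewrite eeE; apply: geta.
  move=> y; rewrite -[RHS](G0 (val y)) GE.
  have [|z zE] := (pr_exact Pr (a (val y))).1; first exact/aE/kernelP.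
  rewrite zE -gE psiE -linearD; congr (phi _); apply: val_inj.
  by rewrite GRing.valD bbE eeE -zE -hE // kernelP.
have [g [gg gw0]] := minimal_functional gr_sum gr_mul (M := Om) projOm gw w0 Nmin.
have [Nl|Nl] := eqVneq (- N) l; last first.
  case/eqP: gw0; apply: (vanish (- N)) => //; last exact: Ext3.
  lia.
(* Right multiplication preserves left linearity and moves the degree from -N to 1 - N. *)
have [gx gxE] : {h : {linear kernel d2 -> A^o} | forall y, h y = (g y : A) * x ord0}.
  apply: linear_of => [u v|a u]; first by rewrite linearB mulrBl.
  rewrite linearZ_LR; exact/esym/mulrA.
have gxw : gx w = 0.
  apply: (vanish (1 - N)).
  - lia.
  - by apply: Ext3; apply/eqP => E; lia.
  move=> j y gy; rewrite gxE (addrC 1) addrA.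
  by apply: (int_grading_mul gr_sum gr_mul (n := 1)); [apply: gg | apply: gen_deg1 AxW _].
have [c cE] : exists c : k, (g w : A) = c%:A.
  by apply/gr_conn; have := gg _ _ gw; rewrite subrr.
move: gxw; rewrite gxE cE mulr_algl => cx; case/eqP: gw0; rewrite cE.
by rewrite (xc _ cx) scale0r.
Qed.

End RegularTensorMain.

(** * Points of the cuspidal cubic *)

Notation o0 := (@inord 2 0).
Notation o1 := (@inord 2 1).
Notation o2 := (@inord 2 2).

Lemma ord3_ind (P : 'I_3 -> Prop) : P o0 -> P o1 -> P o2 -> forall i, P i.
Proof.
move=> P0 P1 P2 [[|[|[|i]]] Hi] //.
- by rewrite (_ : Ordinal Hi = o0) //; apply: val_inj; rewrite /= inordK.
- by rewrite (_ : Ordinal Hi = o1) //; apply: val_inj; rewrite /= inordK.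
- by rewrite (_ : Ordinal Hi = o2) //; apply: val_inj; rewrite /= inordK.
Qed.

Lemma sum3 (V : nmodType) (F : 'I_3 -> V) : \sum_i F i = F o0 + F o1 + F o2.
Proof.
rewrite !big_ord_recl big_ord0 addr0 addrA.
by congr (F _ + F _ + F _); apply: val_inj; rewrite /= inordK.
Qed.

Definition pt3 (T : Type) (a b c : T) (i : 'I_3) : T := nth c [:: a; b] i.

Lemma pt3E (T : Type) (a b c : T) :
  (pt3 a b c o0 = a) * (pt3 a b c o1 = b) * (pt3 a b c o2 = c).
Proof. by rewrite /pt3 !inordK. Qed.

Lemma ord3_neq : ((o0 == o1) = false) * ((o0 == o2) = false) * ((o1 == o0) = false) *
  ((o1 == o2) = false) * ((o2 == o0) = false) * ((o2 == o1) = false).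
Proof. by rewrite -!val_eqE /= !inordK. Qed.

Section Cubic.
Variable R : comNzRingType.

(* e is 0, or 1 for the second cuspidal form in characteristic 3. *)
Definition cubic (e : R) (p : 'I_3 -> R) : R :=
  p o1 ^+ 3 + p o0 ^+ 2 * p o2 + e * (p o0 * p o1 ^+ 2).

Definition lin (g : 'M[R]_3) (p : 'I_3 -> R) (i : 'I_3) : R := \sum_j g i j * p j.

Definition form (w : 'M[R]_3) (p q : 'I_3 -> R) : R := \sum_i \sum_j w i j * (p i * q j).

Lemma formE w p q : form w p q =
  w o0 o0 * (p o0 * q o0) + w o0 o1 * (p o0 * q o1) + w o0 o2 * (p o0 * q o2) +
  (w o1 o0 * (p o1 * q o0) + w o1 o1 * (p o1 * q o1) + w o1 o2 * (p o1 * q o2)) +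
  (w o2 o0 * (p o2 * q o0) + w o2 o1 * (p o2 * q o1) + w o2 o2 * (p o2 * q o2)).
Proof. by rewrite /form !sum3. Qed.

End Cubic.

Section Evaluation.
Variables (k : fieldType) (R : comUnitAlgType k).

Definition linA (g : 'M[k]_3) (p : 'I_3 -> R) (i : 'I_3) : R := \sum_j g i j *: p j.

Lemma linA_comp g h p i : linA g (linA h p) i = linA (g *m h) p i.
Proof. exact: sum_mulmx_scale. Qed.

Lemma linA1 p i : linA 1%:M p i = p i.
Proof. exact: sum_mx1_scale. Qed.

Lemma local_sum (I : Type) (s : seq I) (F : I -> R) : local_ring R ->
  \sum_(i <- s) F i \is a GRing.unit -> exists i, F i \is a GRing.unit.
Proof.
move=> locR; elim: s => [|i s IHs]; first by rewrite big_nil unitr0.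
by rewrite big_cons => /locR [Fi|/IHs //]; exists i.
Qed.

Lemma proj_linA g p : local_ring R -> g \in unitmx ->
  proj_point p -> proj_point (linA g p).
Proof.
move=> locR g_unit [i pi].
have pE : p i = linA (invmx g) (linA g p) i by rewrite linA_comp mulVmx // linA1.
rewrite pE in pi; have [j] := local_sum locR pi.
by rewrite -mulr_algl unitrM => /andP[_ gj]; exists j.
Qed.

Lemma same_linA g p q : same_point p q -> same_point (linA g p) (linA g q).
Proof.
case=> u u_unit E; exists u => // i; rewrite /linA mulr_sumr; apply: eq_bigr => j _.
by rewrite E scalerAr.
Qed.

Lemma locus_linA (W W' : {vspace 'M[k]_3}) g p q :
  (forall w, (w \in W') = (g^T *m w *m g \in W)) ->
  on_zero_locus W p q -> on_zero_locus W' (linA g p) (linA g q).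
Proof.
move=> W'E Wpq w; rewrite W'E => /Wpq E; rewrite -[RHS]E -sum_congruence.
apply: eq_bigr => i _; apply: eq_bigr => j _.
by apply: scale_sum_mul_sum => c a b; rewrite scalerAr.
Qed.

Lemma on_cubic g (e : k) F p :
  F = linear_change g (mpoly.mpolyX k (mpoly.mnm1 o1) ^+ 3 +
    mpoly.mpolyX k (mpoly.mnm1 o0) ^+ 2 * mpoly.mpolyX k (mpoly.mnm1 o2) +
    e *: (mpoly.mpolyX k (mpoly.mnm1 o0) * mpoly.mpolyX k (mpoly.mnm1 o1) ^+ 2)) ->
  mpoly.mmap (in_alg R) p F = cubic (e%:A : R) (linA g p).
Proof.
have mM a b : mpoly.mmap (in_alg R) p (a * b) =
    mpoly.mmap (in_alg R) p a * mpoly.mmap (in_alg R) p b by exact: rmorphM.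
have mX a m : mpoly.mmap (in_alg R) p (a ^+ m) = mpoly.mmap (in_alg R) p a ^+ m.
  exact: rmorphXn.
have lX i : mpoly.mmap (in_alg R) p (linear_change g (mpoly.mpolyX k (mpoly.mnm1 i))) =
    linA g p i.
  rewrite /linear_change /mpoly.comp_mpoly mpoly.mmapX mpoly.mmap1U tnth_mktuple.
  rewrite (raddf_sum (mpoly.mmap (in_alg R) p)); apply: eq_bigr => j _ /=.
  by rewrite mpoly.mmapZ mpoly.mmapX mpoly.mmap1U /= mulr_algl.
have cD a b : linear_change g (a + b) = linear_change g a + linear_change g b.
  exact: (rmorphD (mpoly.comp_mpoly _)).
have cM a b : linear_change g (a * b) = linear_change g a * linear_change g b.
  exact: (rmorphM (mpoly.comp_mpoly _)).
have cX a m : linear_change g (a ^+ m) = linear_change g a ^+ m.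
  exact: (rmorphXn (mpoly.comp_mpoly _)).
have cZ a : linear_change g (e *: a) = e *: linear_change g a.
  exact: mpoly.comp_mpolyZ.
have mD a b : mpoly.mmap (in_alg R) p (a + b) =
  mpoly.mmap (in_alg R) p a + mpoly.mmap (in_alg R) p b by exact: rmorphD.
move=> ->; rewrite 2!cD cX cM cX cZ cM cX 2!mD mX mM mX mpoly.mmapZ mM mX !lX.
by rewrite /cubic.
Qed.

End Evaluation.

(** * The dual numbers over a field *)

Section Dual.
Variable k : fieldType.

Record dual := Dual { dual_re : k; dual_eps : k }.

Definition dual_pair (a : dual) := (dual_re a, dual_eps a).
Lemma dual_pairK : cancel dual_pair (fun p => Dual p.1 p.2). Proof. by case. Qed.

HB.instance Definition _ := Choice.copy dual (can_type dual_pairK).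

Lemma dualP (a b : dual) :
  dual_re a = dual_re b -> dual_eps a = dual_eps b -> a = b.
Proof. by case: a b => ? ? [? ?] /= -> ->. Qed.

Definition dual_add a b := Dual (dual_re a + dual_re b) (dual_eps a + dual_eps b).
Definition dual_opp a := Dual (- dual_re a) (- dual_eps a).
Definition dual_mul a b := Dual (dual_re a * dual_re b)
  (dual_re a * dual_eps b + dual_eps a * dual_re b).
Definition dual_scale c a := Dual (c * dual_re a) (c * dual_eps a).
Definition dual_inv a := if dual_re a == 0 then a
  else Dual (dual_re a)^-1 (- (dual_eps a / dual_re a ^+ 2)).

Fact dual_addA : associative dual_add. Proof. by move=> *; apply: dualP => /=; ring. Qed.
Fact dual_addC : commutative dual_add. Proof. by move=> *; apply: dualP => /=; ring. Qed.
Fact dual_add0 : left_id (Dual 0 0) dual_add. Proof. by move=> *; apply: dualP => /=; ring. Qed.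
Fact dual_addN : left_inverse (Dual 0 0) dual_opp dual_add.
Proof. by move=> *; apply: dualP => /=; ring. Qed.

HB.instance Definition _ :=
  GRing.isZmodule.Build dual dual_addA dual_addC dual_add0 dual_addN.

Fact dual_mulA : associative dual_mul. Proof. by move=> *; apply: dualP => /=; ring. Qed.
Fact dual_mulC : commutative dual_mul. Proof. by move=> *; apply: dualP => /=; ring. Qed.
Fact dual_mul1 : left_id (Dual 1 0) dual_mul. Proof. by move=> *; apply: dualP => /=; ring. Qed.
Fact dual_mulDl : left_distributive dual_mul +%R.
Proof. by move=> *; apply: dualP => /=; ring. Qed.
Fact dual_1neq0 : Dual 1 0 != 0 :> dual.
Proof. by apply/eqP => /(congr1 dual_re) /eqP; rewrite oner_eq0. Qed.

HB.instance Definition _ := GRing.Zmodule_isComNzRing.Build dual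
  dual_mulA dual_mulC dual_mul1 dual_mulDl dual_1neq0.

Fact dual_scaleA a b v : dual_scale a (dual_scale b v) = dual_scale (a * b) v.
Proof. by apply: dualP => /=; ring. Qed.
Fact dual_scale1 : left_id 1 dual_scale. Proof. by move=> *; apply: dualP => /=; ring. Qed.
Fact dual_scaleDr : right_distributive dual_scale +%R.
Proof. by move=> *; apply: dualP => /=; ring. Qed.
Fact dual_scaleDl v : {morph dual_scale^~ v : a b / a + b}.
Proof. by move=> *; apply: dualP => /=; ring. Qed.

HB.instance Definition _ := GRing.Zmodule_isLmodule.Build k dual
  dual_scaleA dual_scale1 dual_scaleDr dual_scaleDl.

Fact dual_scaleAl c (a b : dual) : c *: (a * b) = (c *: a) * b.
Proof. by apply: dualP => /=; ring. Qed.

HB.instance Definition _ := GRing.Lmodule_isLalgebra.Build k dual dual_scaleAl.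
HB.instance Definition _ := GRing.Lalgebra_isComAlgebra.Build k dual.

Definition dual_unit := [pred a : dual | dual_re a != 0].

Fact dual_mulV : {in dual_unit, left_inverse 1 dual_inv *%R}.
Proof.
move=> a a0; rewrite /dual_inv (negbTE a0); apply: dualP => /=; field; exact: a0.
Qed.

Fact dual_unitP (a b : dual) : b * a = 1 -> dual_unit a.
Proof.
move/(congr1 dual_re) => /= ba; apply/eqP => a0; move: ba; rewrite a0 mulr0.
by move/eqP; rewrite eq_sym oner_eq0.
Qed.

Fact dual_inv0 : {in [predC dual_unit], dual_inv =1 id}.
Proof. by move=> a; rewrite inE /= negbK /dual_inv => ->. Qed.

HB.instance Definition _ := GRing.ComNzRing_hasMulInverse.Build dual
  dual_mulV dual_unitP dual_inv0.

Lemma dual_unitE (a : dual) : (a \is a GRing.unit) = (dual_re a != 0).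
Proof. by []. Qed.

Lemma dual_local : local_ring dual.
Proof.
move=> a b; rewrite !dual_unitE /=; case: (eqVneq (dual_re a) 0) => [-> |]; last by left.
by rewrite add0r; right.
Qed.

Lemma field_local : local_ring (k^o : comUnitAlgType k).
Proof.
move=> a b; rewrite !unitfE; case: (eqVneq a 0) => [-> |]; last by left.
by rewrite add0r; right.
Qed.

End Dual.
Check fun k : fieldType => (dual k : comUnitAlgType k).

(** The conditions of [is_point_scheme] on points over local algebras, in coordinates where the form
    is y^3 + x^2 z + e x y^2. *)
Definition cusp_points (k : fieldType) (W : {vspace 'M[k]_3}) (e : k) : Prop :=
  forall R : comUnitAlgType k, local_ring R ->
    [/\ forall p q : 'I_3 -> R, proj_point p -> proj_point q -> on_zero_locus W p q ->
          cubic (e%:A : R) p = 0 /\ cubic (e%:A : R) q = 0,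
        forall p : 'I_3 -> R, proj_point p -> cubic (e%:A : R) p = 0 ->
          exists q, [/\ proj_point q, on_zero_locus W p q
            & forall q', proj_point q' -> on_zero_locus W p q' -> same_point q q']
      & forall q : 'I_3 -> R, proj_point q -> cubic (e%:A : R) q = 0 ->
          exists p, [/\ proj_point p, on_zero_locus W p q
            & forall p', proj_point p' -> on_zero_locus W p' q -> same_point p p']].

Lemma cusp_points_change (k : fieldType) (W W' : {vspace 'M[k]_3}) (e : k) F g :
  g \in unitmx ->
  F = linear_change g (mpoly.mpolyX k (mpoly.mnm1 o1) ^+ 3 +
    mpoly.mpolyX k (mpoly.mnm1 o0) ^+ 2 * mpoly.mpolyX k (mpoly.mnm1 o2) +
    e *: (mpoly.mpolyX k (mpoly.mnm1 o0) * mpoly.mpolyX k (mpoly.mnm1 o1) ^+ 2)) ->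
  (forall w, (w \in W') = (g^T *m w *m g \in W)) ->
  is_point_scheme W (fun G => G = F) -> cusp_points W' e.
Proof.
move=> g_unit FE W'E [_ scheme] R locR; have [P1 P2 P3] := scheme R locR.
pose h := invmx g.
have h_unit : h \in unitmx by rewrite unitmx_inv.
have hg : h *m g = 1%:M by rewrite mulVmx.
have gh : g *m h = 1%:M by rewrite mulmxV.
have WE w : (w \in W) = (h^T *m w *m h \in W').
  by rewrite W'E !mulmxA -trmx_mul hg trmx1 mul1mx -mulmxA hg mulmx1.
have ghK (p : 'I_3 -> R) : linA g (linA h p) = p.
  by apply: boolp.funext => i; rewrite linA_comp gh linA1.
have hgK (p : 'I_3 -> R) : linA h (linA g p) = p.
  by apply: boolp.funext => i; rewrite linA_comp hg linA1.
have sub (p : 'I_3 -> R) : on_subscheme (fun G => G = F) (linA h p) <->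
    cubic (e%:A : R) p = 0.
  split=> [/(_ F erefl)|p0 G ->]; by rewrite (on_cubic _ FE) ghK.
have hW p q : on_zero_locus W' p q -> on_zero_locus W (linA h p : 'I_3 -> R) (linA h q).
  exact: locus_linA.
have gW p q : on_zero_locus W p q -> on_zero_locus W' (linA g p : 'I_3 -> R) (linA g q).
  exact: locus_linA.
have hp (p : 'I_3 -> R) : proj_point p -> proj_point (linA h p) by apply: proj_linA.
have gp (p : 'I_3 -> R) : proj_point p -> proj_point (linA g p) by apply: proj_linA.
split=> [p q pp qq /hW pq|p pp p0|q qq q0].
- by have [/sub ? /sub ?] := P1 _ _ (hp _ pp) (hp _ qq) pq.
- have [|q [qq pq uq]] := P2 _ (hp _ pp); first exact/sub.
  exists (linA g q); split; [exact: gp | by rewrite -[p]ghK; apply: gW |].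
  by move=> q' q'q' /hW pq'; rewrite -[q']ghK; apply/same_linA/uq => //; apply: hp.
have [|p [pp pq up]] := P3 _ (hp _ qq); first exact/sub.
exists (linA g p); split; [exact: gp | by rewrite -[q]ghK; apply: gW |].
by move=> p' p'p' /hW pq'; rewrite -[p']ghK; apply/same_linA/up => //; apply: hp.
Qed.

Lemma cuspidalP (k : fieldType) (F : mpoly.mpoly 3 k) : cuspidal_cubic F ->
  exists g e, [/\ g \in unitmx, e != 0 -> 3%:R = 0 :> k &
  F = linear_change g (mpoly.mpolyX k (mpoly.mnm1 o1) ^+ 3 +
    mpoly.mpolyX k (mpoly.mnm1 o0) ^+ 2 * mpoly.mpolyX k (mpoly.mnm1 o2) +
    e *: (mpoly.mpolyX k (mpoly.mnm1 o0) * mpoly.mpolyX k (mpoly.mnm1 o1) ^+ 2))].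
Proof.
case=> g g_unit [->|[/andP[_ /eqP k3] ->]].
  by exists g, 0; rewrite eqxx scale0r addr0.
by exists g, 1; rewrite scale1r.
Qed.

Section FieldPoints.
Variables (k : fieldType) (W : {vspace 'M[k]_3}) (e : k).
Hypothesis CP : cusp_points W e.

Definition nz (p : 'I_3 -> k) := exists i, p i != 0.
Definition onW (p q : 'I_3 -> k) := forall w, w \in W -> form w p q = 0.

Let eA : (e%:A : k^o) = e. Proof. exact: mulr1. Qed.

Let nzE (p : 'I_3 -> k) : nz p <-> proj_point (p : 'I_3 -> k^o).
Proof. by split=> -[i pi]; exists i; move: pi; rewrite unitfE. Qed.

Let sameE (p q : 'I_3 -> k) : same_point (p : 'I_3 -> k^o) q ->
  exists2 u : k, u != 0 & forall i, q i = u * p i.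
Proof. by case=> u; rewrite unitfE => u0 E; exists u. Qed.

Lemma pointsW p q : nz p -> nz q -> onW p q -> cubic e p = 0 /\ cubic e q = 0.
Proof.
have [P1 _ _] := CP (@field_local k); rewrite eA in P1.
by move=> /nzE pp /nzE qq; apply: P1.
Qed.

Lemma pointsW_right p : nz p -> cubic e p = 0 ->
  exists q, [/\ nz q, onW p q
    & forall q', nz q' -> onW p q' -> exists2 u : k, u != 0 & forall i, q' i = u * q i].
Proof.
have [_ P2 _] := CP (@field_local k); rewrite eA in P2.
move=> /nzE pp p0; have [q [qq pq uq]] := P2 _ pp p0.
by exists q; split=> // [|q' /nzE q'q' pq']; [apply/nzE | apply/sameE/uq].
Qed.

Lemma pointsW_left q : nz q -> cubic e q = 0 ->
  exists p, [/\ nz p, onW p q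
    & forall p', nz p' -> onW p' q -> exists2 u : k, u != 0 & forall i, p' i = u * p i].
Proof.
have [_ _ P3] := CP (@field_local k); rewrite eA in P3.
move=> /nzE qq q0; have [p [pp pq up]] := P3 _ qq q0.
by exists p; split=> // [|p' /nzE p'p' pq']; [apply/nzE | apply/sameE/up].
Qed.

Lemma unique_left p p' q : nz p -> nz p' -> nz q -> cubic e q = 0 -> onW p q ->
  onW p' q -> exists2 u : k, u != 0 & forall i, p' i = u * p i.
Proof.
move=> pp pp' qq q0 pq pq'; have [r [rr _ ur]] := pointsW_left qq q0.
have [u u0 E] := ur _ pp pq; have [u' u'0 E'] := ur _ pp' pq'.
exists (u' / u) => [|i]; first by rewrite mulf_neq0 ?invr_neq0.
by rewrite E' E mulrA divfK.
Qed.

Lemma unique_right p q q' : nz p -> nz q -> nz q' -> cubic e p = 0 -> onW p q ->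
  onW p q' -> exists2 u : k, u != 0 & forall i, q' i = u * q i.
Proof.
move=> pp qq qq' p0 pq pq'; have [r [rr _ ur]] := pointsW_right pp p0.
have [u u0 E] := ur _ qq pq; have [u' u'0 E'] := ur _ qq' pq'.
exists (u' / u) => [|i]; first by rewrite mulf_neq0 ?invr_neq0.
by rewrite E' E mulrA divfK.
Qed.

Definition cusp : 'I_3 -> k := pt3 0 0 1.
(** The smooth points of the cubic, parametrised by the affine line; by [cubic_cases] only the cusp
    is missing. *)
Definition pt (t : k) : 'I_3 -> k := pt3 1 t (- (t ^+ 3 + e * t ^+ 2)).

Lemma nz_pt t : nz (pt t). Proof. by exists o0; rewrite /pt pt3E oner_neq0. Qed.
Lemma nz_cusp : nz cusp. Proof. by exists o2; rewrite /cusp pt3E oner_neq0. Qed.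

Lemma cubic_pt t : cubic e (pt t) = 0.
Proof. by rewrite /cubic /pt !pt3E; ring. Qed.

Lemma cubic_cusp : cubic e cusp = 0.
Proof. by rewrite /cubic /cusp !pt3E; ring. Qed.

Lemma onWZ p q u v : u != 0 -> v != 0 ->
  onW (fun i => u * p i) (fun i => v * q i) -> onW p q.
Proof.
move=> u0 v0 pq w /pq; rewrite !formE => E.
apply: (mulfI u0); apply: (mulfI v0); rewrite !mulr0 -[RHS]E; ring.
Qed.

Lemma onW_ext p q p' q' : p =1 p' -> q =1 q' -> onW p q -> onW p' q'.
Proof. by move=> /boolp.funext -> /boolp.funext ->. Qed.

Lemma cubic_cases q : nz q -> cubic e q = 0 ->
  exists2 u : k, u != 0 & (forall i, q i = u * cusp i) \/
    exists t, forall i, q i = u * pt t i.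
Proof.
move=> qq q0; have [qo0|qo0] := eqVneq (q o0) 0.
  have q1 : q o1 = 0.
    have /eqP : q o1 ^+ 3 = 0 by rewrite -[RHS]q0 /cubic qo0; ring.
    by rewrite expf_eq0 => /eqP.
  exists (q o2).
    by case: qq => i; apply: contraNneq => q2; move: i; apply: ord3_ind; apply/eqP.
  by left; apply: ord3_ind; rewrite /cusp !pt3E ?q1 ?qo0; ring.
exists (q o0) => //; right; exists (q o1 / q o0); apply: ord3_ind; rewrite /pt !pt3E.
- by rewrite mulr1.
- by rewrite mulrCA divff // mulr1.
apply: (mulfI (expf_neq0 2 qo0)); rewrite /cubic in q0.
apply/eqP; rewrite -subr_eq0 -[X in _ == X]q0; apply/eqP; field; exact: qo0.
Qed.

End FieldPoints.

Lemma lincomb2_eq0 (R : pzRingType) (y z x a b : R) :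
  a = 0 -> b = 0 -> x = y * a + z * b -> x = 0.
Proof. by move=> -> -> ->; rewrite !mulr0 addr0. Qed.

Lemma dual_scalarE (k : fieldType) (e : k) : e%:A = Dual e 0 :> dual k.
Proof. by apply: dualP => /=; ring. Qed.

Lemma dual_re_form (k : fieldType) (w : 'M[k]_3) (p q : 'I_3 -> dual k) :
  dual_re (\sum_i \sum_j w i j *: (p i * q j)) =
  form w (@dual_re k \o p) (@dual_re k \o q).
Proof. by rewrite /form !sum3 /=. Qed.

Lemma dual_eps_form (k : fieldType) (w : 'M[k]_3) (p q : 'I_3 -> dual k) :
  dual_eps (\sum_i \sum_j w i j *: (p i * q j)) =
  form w (@dual_re k \o p) (@dual_eps k \o q) +
  form w (@dual_eps k \o p) (@dual_re k \o q).
Proof. by rewrite /form !sum3 /=; ring. Qed.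

(** * The action of sigma on the cusp and on the smooth points *)

Section CuspFixed.
Variables (k : fieldType) (W : {vspace 'M[k]_3}) (e : k).
Hypothesis CP : cusp_points W e.

(** At the singular point every vector (v0, v1) is tangent, so cusp + eps (v0, v1, 0) lies on the
    curve over the dual numbers. Its image lies over [pt e s], where the only tangent direction is
    (0, 1, -(3 s^2 + 2 e s)); [m] is the coordinate of the image along it. *)
Lemma cusp_tangent s v0 v1 : onW W (cusp k) (pt e s) -> exists m : k, forall w, w \in W ->
  form w (pt3 v0 v1 0) (pt e s) +
  m * form w (cusp k) (pt3 0 1 (- (3%:R * s ^+ 2 + 2%:R * e * s))) = 0.
Proof.
move=> cs; have [P1 P2 _] := CP (@dual_local k); rewrite dual_scalarE in P1 P2.
pose p : 'I_3 -> dual k := pt3 (Dual 0 v0) (Dual 0 v1) 1.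
have pp : proj_point p by exists o2; rewrite /p pt3E dual_unitE oner_neq0.
have [|q [qq pq _]] := P2 _ pp.
  by rewrite /cubic /p !pt3E; apply: dualP => /=; ring.
have [_ cq] := P1 _ _ pp qq pq.
have rep : @dual_re k \o p =1 cusp k.
  by apply: ord3_ind; rewrite /p /cusp /= !pt3E.
have epsp : @dual_eps k \o p =1 pt3 v0 v1 0.
  by apply: ord3_ind; rewrite /p /= !pt3E.
pose qa := @dual_re k \o q; pose qb := @dual_eps k \o q.
have nzq : nz qa by case: qq => i; rewrite dual_unitE => qi; exists i.
have locus w : w \in W -> form w (cusp k) qa = 0 /\
    form w (cusp k) qb + form w (pt3 v0 v1 0) qa = 0.
  move=> wW; have E := pq w wW; split.
    by rewrite -(boolp.funext rep) -dual_re_form E.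
  by rewrite -(boolp.funext rep) -(boolp.funext epsp) -dual_eps_form E.
have [u u0 qaE] := unique_right CP (nz_cusp k) (nz_pt e s) nzq (cubic_cusp e) cs
  (fun w wW => (locus w wW).1).
move/(congr1 (@dual_eps k)) : cq; rewrite /cubic /=.
rewrite -![dual_re (q _)]/(qa _) -![dual_eps (q _)]/(qb _) !qaE /pt !pt3E => cq.
(* The image is determined up to a unit only; this is the eps-part of its affine coordinate q_1 /
   q_0. *)
exists ((qb o1 - s * qb o0) / u) => w wW; have [_] := locus w wW; have := cs w wW.
rewrite (boolp.funext qaE).
have qb2 : qb o2 = - (3%:R * s ^+ 2 + 2%:R * e * s) * (qb o1 - s * qb o0) -
    qb o0 * (s ^+ 3 + e * s ^+ 2).
  apply: (mulfI (expf_neq0 2 u0)); apply/eqP; rewrite -subr_eq0 -[X in _ == X]cq.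
  by apply/eqP; ring.
rewrite !formE /cusp /pt !pt3E qb2 => E1 E2.
apply: (mulfI u0); rewrite [RHS]mulr0; apply: (lincomb2_eq0 (y := 1) (z := - qb o0) E2 E1).
by field.
Qed.

(** If sigma sent the cusp to a smooth point, its differential would map a plane to a line. A vector
    (v0, v1) in the kernel makes (v0, v1, 0) a second preimage of that smooth point. *)
Lemma cusp_fixed : onW W (cusp k) (cusp k).
Proof.
have [q [qq cq _]] := pointsW_right CP (nz_cusp k) (cubic_cusp e).
have [_ q0] := pointsW CP (nz_cusp k) qq cq.
have [u u0 [qE|[s qE]]] := cubic_cases qq q0.
  apply: (onWZ (oner_neq0 k) u0); apply: (onW_ext _ _ cq) => // i; exact/esym/mul1r.
have cs : onW W (cusp k) (pt e s).
  apply: (onWZ (oner_neq0 k) u0); apply: (onW_ext _ _ cq) => // i; exact/esym/mul1r.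
have bad v0 v1 : (v0 != 0) || (v1 != 0) -> ~ onW W (pt3 v0 v1 0) (pt e s).
  move=> v vs; have nzv : nz (pt3 v0 v1 0).
    by case/orP: v => v; [exists o0 | exists o1]; rewrite pt3E.
  have [c c0 E] := unique_left CP nzv (nz_cusp k) (nz_pt e s) (cubic_pt e s) vs cs.
  by have /eqP := E o2; rewrite /cusp !pt3E mulr0 oner_eq0.
have [m0 E0] := cusp_tangent 1 0 cs; have [m1 E1] := cusp_tangent 0 1 cs.
have [m10|m1N0] := eqVneq m1 0.
  have := bad 0 1; rewrite oner_neq0 orbT => /(_ isT) [] w wW.
  by have := E1 w wW; rewrite m10 mul0r addr0.
have := bad m1 (- m0); rewrite m1N0 => /(_ isT) [] w wW.
have := E0 w wW; have := E1 w wW; rewrite !formE /cusp /pt !pt3E => F1 F0.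
by apply: (lincomb2_eq0 (y := m1) (z := - m0) F0 F1); ring.
Qed.

(** A smooth point sent to the cusp would be a second preimage of the cusp, which is already its own
    preimage. *)
Lemma sigma_pt t : exists s, onW W (pt e t) (pt e s).
Proof.
have [q [qq tq _]] := pointsW_right CP (nz_pt e t) (cubic_pt e t).
have [_ q0] := pointsW CP (nz_pt e t) qq tq.
have [u u0 [qE|[s qE]]] := cubic_cases qq q0.
  have tc : onW W (pt e t) (cusp k).
    apply: (onWZ (oner_neq0 k) u0); apply: (onW_ext _ _ tq) => // i; exact/esym/mul1r.
  have [c c0 E] := unique_left CP (nz_cusp k) (nz_pt e t) (nz_cusp k)
    (cubic_cusp e) cusp_fixed tc.
  by have /eqP := E o0; rewrite /cusp /pt !pt3E mulr0 oner_eq0.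
exists s; apply: (onWZ (oner_neq0 k) u0).
by apply: (onW_ext _ _ tq) => // i; exact/esym/mul1r.
Qed.

Lemma no_point_101 q : nz q -> ~ onW W (pt3 1 0 1) q.
Proof.
move=> qq pq; have pp : nz (pt3 1 0 1 : 'I_3 -> k) by exists o0; rewrite pt3E oner_neq0.
have [E _] := pointsW CP pp qq pq; move: E; rewrite /cubic !pt3E => E.
by case/eqP: (oner_neq0 k); rewrite -[RHS]E; ring.
Qed.

(** The map w |-> w((1, 0, 1), -) must be onto: a vector orthogonal to its image would be a partner
    of (1, 0, 1) in the zero locus of W. In particular dim W >= 3. *)
Lemma rows_onto (r : 'I_3 -> k) :
  exists2 w, w \in W & forall j, w o0 j + w o2 j = r j.
Proof.
have [L LE] : {L : {linear 'M[k]_3 -> 'rV[k]_3} | forall w, L w = row o0 w + row o2 w}.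
  apply: linear_of => [u v|a u]; first by rewrite !linearB /= addrACA opprD.
  by rewrite !linearZ scalerDr.
pose U := (linfun L @: W)%VS.
have [/eqP UT|UN] := boolP (U == fullv).
  have /memv_imgP [w wW wE] : \row_j r j \in U by rewrite UT memvf.
  exists w => // j; have /rowP/(_ j) := wE.
  by rewrite lfunE /= LE !mxE => <-.
pose B : 'M[k]_(\dim U, 3) := \matrix_i (vbasis U)`_i.
have dU : (\dim U < 3)%N.
  rewrite ltn_neqAle; have := dimvS (subvf U); rewrite dimvf /dim /= mul1n => ->.
  rewrite andbT; apply: contraNneq UN => dU.
  by rewrite eqEdim subvf dimvf /dim /= mul1n dU.
have : kermx B^T != 0.
  by rewrite kermx_eq0 /row_free mxrank_tr neq_ltn (leq_ltn_trans (rank_leq_row B) dU).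
case/rowV0Pn => v /sub_kermxP vB v0.
case: (@no_point_101 (v 0)) => [|w wW].
  by case/rV0Pn: v0 => i vi; exists i.
have : L w \in U by rewrite -lfunE memv_img.
move/coord_vbasis => Lw.
transitivity ((L w *m v^T) 0 0).
  by rewrite formE !pt3E mxE sum3 LE !mxE; ring.
rewrite Lw mulmx_suml summxE big1 // => i _.
rewrite -scalemxAl mxE (_ : ((vbasis U)`_i *m v^T) 0 0 = 0) ?mulr0 //.
have /matrixP/(_ 0 i) := vB; rewrite !mxE => E; rewrite -[RHS]E; apply: eq_bigr => j _.
by rewrite !mxE mulrC.
Qed.

End CuspFixed.

(** If p is not constant, p + 1 has a root, and there p takes the value -1. *)
Lemma poly_vanish (k : closedFieldType) (p : {poly k}) : (forall t, p.[t] = 0) -> p = 0.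
Proof.
move=> p0; have [/size_poly1P [c c0 pE]|] := boolP (size p == 1).
  by have /eqP := p0 0; rewrite pE hornerC (negbTE c0).
move=> p1; have [->//|pN0] := eqVneq p 0.
have szp : (1 < size p)%N by rewrite ltn_neqAle eq_sym p1 size_poly_gt0.
have [r] : exists r, root (p + 1) r.
  by apply/closed_rootP; rewrite size_polyDl ?size_poly1.
by rewrite /root hornerD p0 hornerC add0r oner_eq0.
Qed.

Lemma poly_vanish_off (k : closedFieldType) (g p : {poly k}) : g != 0 ->
  (forall t, g.[t] != 0 -> p.[t] = 0) -> p = 0.
Proof.
move=> g0 p0; apply: (mulfI g0); rewrite mulr0; apply: poly_vanish => t.
by rewrite hornerM; case: (eqVneq g.[t] 0) => [->|/p0 ->]; rewrite ?mul0r ?mulr0.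
Qed.

(** * The automorphism sigma as a polynomial map of the affine line *)

Section Sigma.
Variables (k : closedFieldType) (W : {vspace 'M[k]_3}) (e : k).
Hypothesis CP : cusp_points W e.

Definition ptX (S : {poly k}) : 'I_3 -> {poly k} :=
  pt3 1 S (- (S ^+ 3 + e%:P * S ^+ 2)).

Definition formX (w : 'M[k]_3) (P Q : 'I_3 -> {poly k}) : {poly k} :=
  form (map_mx polyC w) P Q.

Lemma horner_formX w P Q t :
  (formX w P Q).[t] = form w (fun i => (P i).[t]) (fun i => (Q i).[t]).
Proof. by rewrite /formX !formE !mxE !hornerE. Qed.

Lemma horner_ptX S t i : (ptX S i).[t] = pt e S.[t] i.
Proof.
by move: i; apply: ord3_ind; rewrite /ptX /pt !pt3E ?hornerE // !horner_exp.
Qed.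

(** [rho w j] is the coefficient of q_j in the form w(pt t, q). For q = pt s, eliminating the last
    coordinate from the equations of [a] and [b] gives D s = N, so that sigma is N / D as a rational
    function of t. *)
Let rho (w : 'M[k]_3) (j : 'I_3) : {poly k} := \sum_i (w i j)%:P * ptX 'X i.
Let D a b := rho a o1 * rho b o2 - rho a o2 * rho b o1.
Let N a b := rho a o2 * rho b o0 - rho a o0 * rho b o2.

Let rhoE w t q : form w (pt e t) q =
  (rho w o0).[t] * q o0 + (rho w o1).[t] * q o1 + (rho w o2).[t] * q o2.
Proof.
have E j : (rho w j).[t] = w o0 j * pt e t o0 + w o1 j * pt e t o1 + w o2 j * pt e t o2.
  by rewrite /rho sum3 !hornerD !hornerCM !horner_ptX hornerX.
by rewrite formE !E; ring.
Qed.

Let DN a b t s : a \in W -> b \in W -> onW W (pt e t) (pt e s) ->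
  (D a b).[t] * s = (N a b).[t].
Proof.
move=> aW bW ts; have := ts a aW; have := ts b bW; rewrite !rhoE /pt !pt3E => Eb Ea.
apply/eqP; rewrite -subr_eq0; apply/eqP.
apply: (lincomb2_eq0 (y := (rho b o2).[t]) (z := - (rho a o2).[t]) Ea Eb).
by rewrite /D /N !hornerE; ring.
Qed.

(** If all these minors vanish at t, the equations have a solution q = (0, y1, y2), a partner of
    [pt e t] distinct from its smooth image. *)
Let D_neq0 t : exists a b, [/\ a \in W, b \in W & (D a b).[t] != 0].
Proof.
apply: boolp.contrapT => D0.
have {}D0 a b : a \in W -> b \in W ->
    (rho a o1).[t] * (rho b o2).[t] = (rho a o2).[t] * (rho b o1).[t].
  move=> aW bW; apply/eqP; rewrite -subr_eq0; apply/negPn/negP => Dab.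
  by apply: D0; exists a, b; split=> //; rewrite /D !hornerE.
have [s ts] := sigma_pt CP t.
suff [y1 [y2 [y12 yE]]] : exists y1 y2, (y1 != 0) || (y2 != 0) /\
    forall w, w \in W -> (rho w o1).[t] * y1 + (rho w o2).[t] * y2 = 0.
  have yy : nz (pt3 0 y1 y2).
    by case/orP: y12 => y; [exists o1 | exists o2]; rewrite pt3E.
  have ty : onW W (pt e t) (pt3 0 y1 y2).
    by move=> w /yE E; rewrite rhoE !pt3E mulr0 add0r.
  have [u u0 E] := unique_right CP (nz_pt e t) yy (nz_pt e s) (cubic_pt e t) ty ts.
  by have /eqP := E o0; rewrite /pt !pt3E mulr0 oner_eq0.
have [[a [aW a12]]|no] := boolp.pselect (exists a, a \in W /\
    ((rho a o1).[t] != 0) || ((rho a o2).[t] != 0)).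
  exists (- (rho a o2).[t]), (rho a o1).[t]; split.
    by rewrite oppr_eq0 orbC.
  by move=> w wW; rewrite mulrN mulrC -(D0 a w aW wW) mulrC addNr.
exists 1, 0; rewrite oner_neq0; split=> // w wW; rewrite mulr0 addr0 mulr1.
by apply/eqP/negPn/negP => w1; apply: no; exists w; rewrite w1.
Qed.

(** Write sigma as a reduced fraction N' / D'. At a root c of D' take minors whose denominator does
    not vanish at c: the polynomial identity N' D2 = D' N2 then forces N'(c) = 0. Hence D' is
    constant. *)
Lemma sigma_poly : exists S, forall w, w \in W -> formX w (ptX 'X) (ptX S) = 0.
Proof.
have [a [b [aW bW D0]]] := D_neq0 0.
pose g := gcdp (D a b) (N a b); pose D' := D a b %/ g; pose N' := N a b %/ g.
have DN0 : D a b != 0 by apply: contraNneq D0 => ->; rewrite horner0.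
have g0 : g != 0 by rewrite gcdp_eq0 negb_and DN0.
have DE : D a b = D' * g by rewrite divpK // dvdp_gcdl.
have NE : N a b = N' * g by rewrite divpK // dvdp_gcdr.
have cop : coprimep D' N' by rewrite coprimep_div_gcd // DN0.
have DNs t s : g.[t] != 0 -> onW W (pt e t) (pt e s) -> D'.[t] * s = N'.[t].
  move=> gt /(DN aW bW); rewrite DE NE !hornerM => E.
  by apply: (mulIf gt); rewrite -E; ring.
have D'1 : size D' == 1.
  apply/negPn/negP => /closed_rootP [c rc].
  have N'c : N'.[c] != 0 by apply: coprimep_root rc.
  have [a2 [b2 [a2W b2W D2]]] := D_neq0 c.
  have E : N' * D a2 b2 - D' * N a2 b2 = 0.
    apply: (poly_vanish_off g0) => t gt; have [s ts] := sigma_pt CP t.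
    rewrite hornerD hornerN !hornerM -(DNs t s gt ts) -(DN a2W b2W ts); ring.
  have := congr1 (horner^~ c) E; rewrite hornerD hornerN !hornerM horner0.
  move/eqP: rc => ->; rewrite mul0r subr0 => /eqP.
  by rewrite mulf_eq0 (negbTE N'c) (negbTE D2).
have [d d0 dE] := size_poly1P _ D'1.
exists (d^-1 *: N') => w wW; apply: (poly_vanish_off g0) => t gt.
have [s ts] := sigma_pt CP t; have := ts w wW; have := DNs t s gt ts.
rewrite dE hornerC => sE wE.
rewrite horner_formX -[RHS]wE; congr form; apply: boolp.funext => i;
  rewrite horner_ptX ?hornerX // hornerZ -sE mulKf //.
Qed.

End Sigma.

Section Relations.
Variables (k : closedFieldType) (W : {vspace 'M[k]_3}) (e : k).
Hypothesis CP : cusp_points W e.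

Let col (w : 'M[k]_3) (j : 'I_3) : {poly k} :=
  (w o0 j)%:P + (w o1 j)%:P * 'X - (w o2 j)%:P * ('X^3 + e%:P * 'X^2).

Let colE w S : formX w (ptX e 'X) (ptX e S) =
  col w o0 + col w o1 * S - col w o2 * (S ^+ 3 + e%:P * S ^+ 2).
Proof. by rewrite /formX formE !mxE /ptX !pt3E /col; ring. Qed.

Let col_coef w j i : (col w j)`_i = w o0 j *+ (i == 0%N) + w o1 j *+ (i == 1%N)
  - (w o2 j * ((i == 3)%:R + e * (i == 2)%:R)).
Proof.
rewrite /col coefB coefD coefC !coefCM coefX coefD coefXn coefCM coefXn.
by case: i => [|[|[|[|i]]]] /=; rewrite ?mulr0 ?mulr1.
Qed.

Let col_eq0 w j : col w j = 0 -> forall i, w i j = 0.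
Proof.
move=> c0; have c i : (col w j)`_i = 0 by rewrite c0 coef0.
have := c 0%N; have := c 1%N; have := c 3%N; rewrite !col_coef /=.
rewrite !mulr0n !mulr1n !(mulr0, addr0, add0r, mulr1, subr0) => /eqP.
by rewrite oppr_eq0 => /eqP w2 w1 w0; apply: ord3_ind.
Qed.

Let size_col w j : (size (col w j) <= 4)%N.
Proof. by apply/leq_sizeP => -[|[|[|[|i]]]] //= _; rewrite col_coef /= !(mulr0, addr0, subr0). Qed.

Let size_col2 (w : 'M[k]_3) j : w o2 j = 0 -> (size (col w j) <= 2)%N.
Proof. by move=> w2; apply/leq_sizeP => -[|[|i]] //= _; rewrite col_coef w2 /= !(mul0r, addr0, subr0). Qed.

(** A constant S contradicts injectivity of sigma. If deg S >= 2, compare degrees in col_0 + col_1 S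
    = col_2 (S^3 + e S^2), where the columns have degree at most 3: first col_2 = 0, and if moreover
    the entry (2, 0) of w vanishes, then deg col_0 <= 1 gives col_1 = col_0 = 0. So w is determined
    by one entry, and dim W <= 1 contradicts [rows_onto]. *)
Lemma sigma_affine : exists a b, a != 0 /\
  forall w, w \in W -> formX w (ptX e 'X) (ptX e (a *: 'X + b%:P)) = 0.
Proof.
have [S SE] := sigma_poly CP.
have [sz1|sz1] := leqP (size S) 1.
  have [c cE] : exists c, S = c%:P by exists S`_0; apply: size1_polyC.
  have on t : onW W (pt e t) (pt e c).
    move=> w /SE wE; have := congr1 (horner^~ t) wE; rewrite horner0 horner_formX => E.
    rewrite -[RHS]E; congr form; apply: boolp.funext => i;
      by rewrite horner_ptX ?hornerX // cE hornerC.
  have [u u0 E] := unique_left CP (nz_pt e 0) (nz_pt e 1) (nz_pt e c) (cubic_pt e c)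
    (on 0) (on 1).
  by have /eqP := E o1; rewrite /pt !pt3E mulr0 oner_eq0.
have [sz2|sz3] := leqP (size S) 2.
  have szS : size S = 2 by apply/eqP; rewrite eqn_leq sz2.
  exists S`_1, S`_0; split; first by have := lead_coefE S; rewrite szS /= => <-; rewrite lead_coef_eq0 -size_poly_eq0 szS.
  suff -> : S`_1 *: 'X + (S`_0)%:P = S by [].
  apply/polyP => -[|[|i]]; rewrite coefD coefZ coefX coefC /= ?mulr0 ?add0r ?mulr1 ?addr0 //.
  by rewrite nth_default // szS.
have [d dS] : exists d, size S = d.+3 by case: (size S) sz3 => [|[|[|d]]] // _; exists d.
have S0 : S != 0 by rewrite -size_poly_gt0 dS.
have zero w : w \in W -> w o2 o0 = 0 -> w = 0.
  move=> wW w20; have := SE w wW; rewrite colE => /eqP; rewrite subr_eq0 => /eqP E.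
  have szS3 : size (S ^+ 3 + e%:P * S ^+ 2) = (d.+2 * 3)%N.+1.
    have s3 : size (S ^+ 3) = (d.+2 * 3)%N.+1.
      by rewrite -[LHS]prednK ?size_poly_gt0 ?expf_neq0 // size_exp dS.
    rewrite size_polyDl ?s3 // mul_polyC (leq_ltn_trans (size_scale_leq _ _)) //.
    rewrite -[size _]prednK ?size_poly_gt0 ?expf_neq0 // size_exp dS; lia.
  have c2 : col w o2 = 0.
    apply/eqP/negPn/negP => c2.
    have : (size (col w o2 * (S ^+ 3 + e%:P * S ^+ 2))%R <= d.+3 + 3)%N.
      rewrite -E (leq_trans (size_polyD _ _)) // geq_max; have := size_col w o0.
      have := size_polyMleq (col w o1) S; have := size_col w o1; lia.
    rewrite size_mul //; last by rewrite -size_poly_gt0 szS3.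
    have : (0 < size (col w o2))%N by rewrite size_poly_gt0.
    rewrite szS3; move: (size _) => m; clear; lia.
  have c1 : col w o1 = 0.
    apply/eqP/negPn/negP => c1.
    have /eqP := E; rewrite c2 mul0r addrC addr_eq0 => /eqP E1.
    have := size_col2 w20; rewrite -size_polyN -E1 size_mul // dS.
    have : (0 < size (col w o1))%N by rewrite size_poly_gt0.
    by move: (size _) => m; clear; lia.
  have c0 : col w o0 = 0 by move: E; rewrite c1 c2 !mul0r addr0.
  have cj j : col w j = 0 by move: j; apply: ord3_ind.
  by apply/matrixP => i j; rewrite mxE; apply/col_eq0/cj.
have [w1 w1W w1E] := rows_onto CP (pt3 1 0 0).
have [w2 w2W w2E] := rows_onto CP (pt3 0 1 0).
have wW : w2 o2 o0 *: w1 - w1 o2 o0 *: w2 \in W by rewrite memvB ?memvZ.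
have w0 i j : w2 o2 o0 * w1 i j - w1 o2 o0 * w2 i j = 0.
  have /matrixP/(_ i j) : w2 o2 o0 *: w1 - w1 o2 o0 *: w2 = 0.
    by apply: zero wW _; rewrite !mxE; ring.
  by rewrite !mxE.
have w10 : w1 o2 o0 = 0.
  have := w1E o1; have := w2E o1; rewrite !pt3E => E2 E1.
  rewrite -[LHS]mulr1 -E2; apply/eqP; rewrite -oppr_eq0; apply/eqP.
  transitivity (w2 o2 o0 * (w1 o0 o1 + w1 o2 o1) - w1 o2 o0 * (w2 o0 o1 + w2 o2 o1)).
    by rewrite E1; ring.
  by apply: (lincomb2_eq0 (y := 1) (z := 1) (w0 o0 o1) (w0 o2 o1)); ring.
have := w1E o0; rewrite (zero w1 w1W w10) !mxE pt3E addr0 => /esym/eqP.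
by rewrite oner_eq0.
Qed.

End Relations.

(** * Bilinear forms vanishing on the graph of sigma *)

(* The bilinear forms vanishing on the graph of t |-> a t + b, the point t being
   (1, t, -(t^3 + e t^2)). *)
Definition graph_rel (k : fieldType) (a b e : k) (m : 'M[k]_3) : Prop :=
  [/\ m o2 o2 = 0, m o2 o1 = - a ^+ 2 * m o1 o2,
    m o2 o0 = - (b + e * a) * m o2 o1 - a ^+ 3 * m o0 o2
              - (3%:R * a ^+ 2 * b + e * a ^+ 2) * m o1 o2,
    a * m o1 o1 = e * b * m o2 o1 + e * m o2 o0
              + (3%:R * a ^+ 2 * b + e * a ^+ 2) * m o0 o2
              + (3%:R * a * b ^+ 2 + 2%:R * e * a * b) * m o1 o2
    & m o1 o0 = - a * m o0 o1 - b * m o1 o1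
              + (3%:R * a * b ^+ 2 + 2%:R * e * a * b) * m o0 o2
              + (b ^+ 3 + e * b ^+ 2) * m o1 o2
      /\ m o0 o0 = - b * m o0 o1 + (b ^+ 3 + e * b ^+ 2) * m o0 o2].

(** The equations are the coefficients of X^6, X^4, X^3, X^2, X and 1, in this order, each
    simplified by the preceding ones; cancelling powers of a is legitimate as a is nonzero. *)
Lemma graph_relP (k : closedFieldType) (a b e : k) m : a != 0 ->
  formX m (ptX e 'X) (ptX e (a *: 'X + b%:P)) = 0 -> graph_rel a b e m.
Proof.
move=> a0; rewrite /formX formE !mxE /ptX !pt3E -!mul_polyC.
set L := (L in L = 0) => E.
pose t0 := - m o0 o2 * (b ^+ 3 + e * b ^+ 2) + b * m o0 o1 + m o0 o0.
pose t1 := - (m o0 o2 * (3%:R * a * b ^+ 2 + 2%:R * e * a * b)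
  + m o1 o2 * (b ^+ 3 + e * b ^+ 2)) + a * m o0 o1 + b * m o1 o1 + m o1 o0.
pose t2 := - (m o0 o2 * (3%:R * a ^+ 2 * b + e * a ^+ 2)
  + m o1 o2 * (3%:R * a * b ^+ 2 + 2%:R * e * a * b))
  + e * m o2 o2 * (b ^+ 3 + e * b ^+ 2) - e * b * m o2 o1 + a * m o1 o1 - e * m o2 o0.
pose t3 := - (m o0 o2 * a ^+ 3 + m o1 o2 * (3%:R * a ^+ 2 * b + e * a ^+ 2))
  + e * m o2 o2 * (3%:R * a * b ^+ 2 + 2%:R * e * a * b)
  + m o2 o2 * (b ^+ 3 + e * b ^+ 2) - b * m o2 o1 - e * a * m o2 o1 - m o2 o0.
pose t4 := - m o1 o2 * a ^+ 3 + e * m o2 o2 * (3%:R * a ^+ 2 * b + e * a ^+ 2)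
  + m o2 o2 * (3%:R * a * b ^+ 2 + 2%:R * e * a * b) - a * m o2 o1.
pose t5 := e * m o2 o2 * a ^+ 3 + m o2 o2 * (3%:R * a ^+ 2 * b + e * a ^+ 2).
pose t6 := m o2 o2 * a ^+ 3.
have LE : L = t0%:P + t1%:P * 'X + t2%:P * 'X^2 + t3%:P * 'X^3 + t4%:P * 'X^4
    + t5%:P * 'X^5 + t6%:P * 'X^6.
  by rewrite /L /t0 /t1 /t2 /t3 /t4 /t5 /t6; ring.
have c i : (t0%:P + t1%:P * 'X + t2%:P * 'X^2 + t3%:P * 'X^3 + t4%:P * 'X^4
    + t5%:P * 'X^5 + t6%:P * 'X^6)`_i = 0 by rewrite -LE E coef0.
have cE i : (t0%:P + t1%:P * 'X + t2%:P * 'X^2 + t3%:P * 'X^3 + t4%:P * 'X^4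
    + t5%:P * 'X^5 + t6%:P * 'X^6)`_i = t0 *+ (i == 0)%N + t1 * (i == 1)%N%:R
    + t2 * (i == 2)%N%:R + t3 * (i == 3)%N%:R + t4 * (i == 4)%N%:R
    + t5 * (i == 5)%N%:R + t6 * (i == 6)%N%:R.
  rewrite !coefD !coefCM coefC coefX !coefXn.
  by case: (i == 0%N); rewrite ?mulr1n ?mulr0n.
have := (c 0%N, c 1%N, c 2%N, c 3%N, c 4%N, c 6%N); rewrite !cE /=.
rewrite !(mulr0, mulr1, mulr0n, mulr1n, addr0, add0r) => -[[[[[E0 E1] E2] E3] E4] E6].
have m22 : m o2 o2 = 0.
  by move/eqP: E6; rewrite /t6 mulf_eq0 expf_eq0 (negbTE a0) andbF orbF => /eqP.
have m21 : m o2 o1 = - a ^+ 2 * m o1 o2.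
  apply: (mulfI a0); apply/eqP; rewrite -subr_eq0 -[X in _ == X]oppr0 -[X in _ == - X]E4.
  by rewrite /t4 m22; apply/eqP; ring.
split=> //.
- apply/eqP; rewrite -subr_eq0 -[X in _ == X]oppr0 -[X in _ == - X]E3 /t3 m22.
  by apply/eqP; ring.
- apply/eqP; rewrite -subr_eq0 -[X in _ == X]E2 /t2 m22.
  by apply/eqP; ring.
split.
  by apply/eqP; rewrite -subr_eq0 -[X in _ == X]E1 /t1; apply/eqP; ring.
by apply/eqP; rewrite -subr_eq0 -[X in _ == X]E0 /t0; apply/eqP; ring.
Qed.

Lemma graph_relB (k : fieldType) (a b e : k) (m m' : 'M[k]_3) :
  graph_rel a b e m -> graph_rel a b e m' -> graph_rel a b e (m - m').
Proof.
case=> E1 E2 E3 E4 [E5 E6] [F1 F2 F3 F4 [F5 F6]].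
split; rewrite !mxE.
- by rewrite E1 F1 subrr.
- by rewrite E2 F2; ring.
- by rewrite E3 F3; ring.
- by rewrite mulrBr E4 F4; ring.
by rewrite E5 F5 E6 F6; split; ring.
Qed.

(* 3 b + e (1 - a) is the class of sigma^* O(1) - O(1) in Pic^0 of the cubic, up to
   a unit. *)
Lemma graph_rel_separated (k : fieldType) (a b e : k) (m : 'M[k]_3) : a != 0 ->
  3%:R * b + e * (1 - a) != 0 -> graph_rel a b e m ->
  (forall j, m o0 j + m o2 j = 0) -> m = 0.
Proof.
move=> a0 c0 [E1 E2 E3 E4 [E5 E6]] m0.
have m02 : m o0 o2 = 0 by have := m0 o2; rewrite E1 addr0.
have m01 : m o0 o1 = a ^+ 2 * m o1 o2.
  by have := m0 o1; rewrite E2 => /eqP; rewrite mulNr subr_eq0 => /eqP.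
(* The hypothesis on column 0 has become - a^2 (3 b + e (1 - a)) m_12 = 0. *)
have m12 : m o1 o2 = 0.
  apply: (mulfI c0); apply: (mulfI (expf_neq0 2 a0)); rewrite !mulr0.
  apply/eqP; rewrite -oppr_eq0 -[X in _ == X](m0 o0) E6 E3 E2 m02 m01.
  by apply/eqP; ring.
rewrite m12 mulr0 in m01; rewrite m12 in E2.
have m20 : m o2 o0 = 0 by rewrite E3 E2 m02 m12; ring.
have m11 : m o1 o1 = 0.
  by apply: (mulfI a0); rewrite E4 E2 m20 m02 m12; ring.
have m10 : m o1 o0 = 0 by rewrite E5 m01 m11 m02 m12; ring.
have m00 : m o0 o0 = 0 by rewrite E6 m01 m02; ring.
apply/matrixP => i j; rewrite mxE.
by elim/ord3_ind: i; elim/ord3_ind: j; rewrite ?E2 ?mulr0.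
Qed.

(** W is contained in [graph_rel]. Contraction with (1, 0, 1) is onto on W and injective on
    [graph_rel], so the two coincide. *)
Lemma cusp_points_graph (k : closedFieldType) (W : {vspace 'M[k]_3}) (e : k) :
  cusp_points W e -> exists a b, [/\ a != 0, 3%:R * b + e * (1 - a) != 0
    & forall m, m \in W <-> graph_rel a b e m].
Proof.
move=> CP; have [a [b [a0 vanish]]] := sigma_affine CP.
have WG m : m \in W -> graph_rel a b e m by move=> /vanish; apply: graph_relP.
have c0 : 3%:R * b + e * (1 - a) != 0.
  apply/eqP => c0.
  (* This [q] cancels the contributions of m_01 and m_02 to the contraction with (1, 0, 1); what is
     left is a multiple of 3 b + e (1 - a). *)
  pose q : 'I_3 -> k := pt3 1 b (a ^+ 3 - (b ^+ 3 + e * b ^+ 2)).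
  case: (@no_point_101 _ _ _ CP q).
    by exists o0; rewrite /q pt3E oner_neq0.
  move=> m /WG [E1 E2 E3 E4 [E5 E6]]; rewrite formE /q !pt3E E6 E3 E2 E1.
  transitivity (- a ^+ 2 * m o1 o2 * (3%:R * b + e * (1 - a))); first by ring.
  by rewrite c0 mulr0.
exists a, b; split=> // m; split; first exact: WG.
move=> Gm; have [w wW wE] := rows_onto CP (fun j => m o0 j + m o2 j).
suff -> : m = w by [].
apply/eqP; rewrite -subr_eq0; apply/eqP.
apply: (graph_rel_separated a0 c0); first by apply: graph_relB => //; apply: WG.
by move=> j; rewrite !mxE addrACA -opprD wE subrr.
Qed.

(** With c = 3 b + e (1 - a), the slices with fixed first index give a T_111 = - a^3 c T_012, and
    those with fixed last index give a T_111 = - a^4 c T_012. For a <> 1 this forces T_012 = 0, and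
    the other entries then vanish successively. *)
Lemma graph_rel_tensor (k : fieldType) (a b e : k) (T : 'I_3 -> 'M[k]_3) :
  a != 0 -> 3%:R * b + e * (1 - a) != 0 ->
  (forall l, graph_rel a b e (T l)) ->
  (forall j, graph_rel a b e (\matrix_(l, i) T l i j)) ->
  (exists l, T l != 0) -> a = 1.
Proof.
move=> a0 c0 G N [l0 Tl0].
have [A1 A2 A3 A4 [A5 A6]] := G o0.
have [B1 B2 B3 B4 [B5 B6]] := G o1.
have [C1 C2 C3 C4 [C5 C6]] := G o2.
have [] := N o2; rewrite !mxE => P1 P2 P3 P4 [P5 P6].
have [] := N o1; rewrite !mxE => Q1 Q2 Q3 Q4 [Q5 Q6].
have x2 : T o2 o1 o2 = 0 by rewrite P2 B1 mulr0.
have y2 : T o2 o0 o2 = 0 by rewrite P3 P2 A1 B1; ring.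
have x1 : T o1 o1 o2 = 0.
  by apply: (mulfI a0); rewrite P4 x2 y2 A1 B1; ring.
have y1 : T o1 o0 o2 = - a * T o0 o1 o2 by rewrite P5 x1 A1 B1; ring.
have y0 : T o0 o0 o2 = - b * T o0 o1 o2 by rewrite P6 A1; ring.
have z2 : T o2 o0 o1 = a ^+ 5 * T o0 o1 o2 by rewrite Q3 Q2 A2 B2 x1; ring.
have T211 : T o2 o1 o1 = 0 by rewrite Q2 B2 x1; ring.
have T111 : a * T o1 o1 o1 = - (a ^+ 3) * (3%:R * b + e * (1 - a)) * T o0 o1 o2.
  by rewrite B4 B3 B2 x1 y1; ring.
have T111' : a * T o1 o1 o1 = - (a ^+ 4) * (3%:R * b + e * (1 - a)) * T o0 o1 o2.
  by rewrite Q4 T211 z2 A2 B2 x1; ring.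
apply/eqP; rewrite -subr_eq0; apply/negPn/negP => a1.
have x0 : T o0 o1 o2 = 0.
  apply: (mulfI (expf_neq0 3 a0)); apply: (mulfI c0); apply: (mulfI a1).
  have E : - (a ^+ 3) * (3%:R * b + e * (1 - a)) * T o0 o1 o2 -
      - (a ^+ 4) * (3%:R * b + e * (1 - a)) * T o0 o1 o2 = 0.
    by rewrite -T111 T111' subrr.
  by rewrite !mulr0 -[RHS]E; ring.
have T11 : T o1 o1 o1 = 0 by apply: (mulfI a0); rewrite T111 x0; ring.
have z1 : T o1 o0 o1 = - a * T o0 o1 o1 by rewrite Q5 T11 A2 B2 x0 x1; ring.
have m20 : T o0 o2 o0 = 0 by rewrite A3 A2 y0 x0; ring.
have T01 : T o0 o1 o1 = 0 by apply: (mulfI a0); rewrite A4 A2 m20 y0 x0; ring.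
have z0 : T o0 o0 o1 = 0 by rewrite Q6 T01 A2 x0; ring.
have zero m : graph_rel a b e m -> m o1 o2 = 0 -> m o0 o2 = 0 -> m o0 o1 = 0 -> m = 0.
  case=> E1 E2 E3 E4 [E5 E6] F1 F2 F3.
  have G21 : m o2 o1 = 0 by rewrite E2 F1 mulr0.
  have G20 : m o2 o0 = 0 by rewrite E3 G21 F1 F2; ring.
  have G11 : m o1 o1 = 0 by apply: (mulfI a0); rewrite E4 G21 G20 F1 F2; ring.
  have G10 : m o1 o0 = 0 by rewrite E5 G11 F1 F2 F3; ring.
  have G00 : m o0 o0 = 0 by rewrite E6 F2 F3; ring.
  by apply/matrixP => i j; rewrite mxE; elim/ord3_ind: i; elim/ord3_ind: j.
case/eqP: Tl0; move: l0; apply: ord3_ind; apply: zero => //.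
- by rewrite y0 x0 mulr0.
- by rewrite y1 x0 mulr0.
- by rewrite z1 T01 mulr0.
- by rewrite z2 x0 mulr0.
Qed.

(** * The relations of the theorem and the scaling of the curve *)

Definition cusp_rel1 (k : fieldType) : 'M[k]_3 :=
  delta_mx o0 o1 - (delta_mx o1 o0 + delta_mx o0 o0).
Definition cusp_rel2 (k : fieldType) : 'M[k]_3 :=
  delta_mx o2 o0 - (delta_mx o0 o2 + delta_mx o0 o0 + 3%:R *: delta_mx o1 o1).
Definition cusp_rel3 (k : fieldType) : 'M[k]_3 :=
  delta_mx o2 o1 - (delta_mx o1 o2 - 3%:R *: delta_mx o1 o1 - 2%:R *: delta_mx o0 o2
    - 2%:R *: delta_mx o0 o1).

Lemma cusp_relationsE (k : fieldType) m : m \in cusp_relations k <->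
  exists a b c, m = a *: cusp_rel1 k + b *: cusp_rel2 k + c *: cusp_rel3 k.
Proof.
have -> : cusp_relations k = <<[:: cusp_rel1 k; cusp_rel2 k; cusp_rel3 k]>>%VS by [].
rewrite !span_cons span_nil addv0; split.
  case/memv_addP => u /vlineP [a ->] [v /memv_addP [u' /vlineP [b ->] [v' /vlineP [c ->] ->]] ->].
  by exists a, b, c; rewrite addrA.
move=> [a [b [c ->]]]; rewrite -addrA memv_add ?memv_add //; apply/vlineP;
  by [exists a | exists b | exists c].
Qed.

(** This is the origin of the relations: they span the forms vanishing on the graph of t |-> t + 1
    on y^3 + x^2 z. *)
Lemma cusp_relationsP (k : fieldType) m :
  m \in cusp_relations k <-> graph_rel 1 1 0 m.
Proof.
rewrite cusp_relationsE; split.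
  move=> [a [b [c ->]]].
  have mE i j : (a *: cusp_rel1 k + b *: cusp_rel2 k + c *: cusp_rel3 k) i j =
    a * cusp_rel1 k i j + b * cusp_rel2 k i j + c * cusp_rel3 k i j by rewrite !mxE.
  by split; [..|split]; rewrite !mE !mxE !(ord3_neq, eqxx) /=; ring.
case=> E1 E2 E3 E4 [E5 E6].
exists (m o0 o1 + 2%:R * m o1 o2), (- (m o0 o2 + 2%:R * m o1 o2)), (- m o1 o2).
have E4' : m o1 o1 = 3%:R * m o0 o2 + 3%:R * m o1 o2.
  by rewrite -[m o1 o1]mul1r E4; ring.
apply/matrixP => i j; rewrite !mxE.
elim/ord3_ind: i; elim/ord3_ind: j; rewrite !(ord3_neq, eqxx) /=
  ?E6 ?E5 ?E4' ?E3 ?E2 ?E1; ring.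
Qed.

(** The scaling (x, y, z) |-> (x, c y, c^3 z) multiplies y^3 + x^2 z by c^3, hence preserves the
    curve, and it conjugates translation by b into translation by b / c. *)
Lemma graph_rel_scale (k : fieldType) (b c : k) (m m' : 'M[k]_3) : c != 0 ->
  (forall i j, m' i j = pt3 1 c (c ^+ 3) i * m i j * pt3 1 c (c ^+ 3) j) ->
  graph_rel 1 b 0 m -> graph_rel 1 (b / c) 0 m'.
Proof.
move=> c0 m'E [E1 E2 E3 E4 [E5 E6]].
have E4' : m o1 o1 = 3%:R * b * m o0 o2 + 3%:R * b ^+ 2 * m o1 o2.
  by rewrite -[m o1 o1]mul1r E4; ring.
split; rewrite !m'E !pt3E ?E1 ?E5 ?E6 ?E4' ?E3 ?E2; try by field.
by split; field.
Qed.

Lemma cuspidal_relations (k : closedFieldType) (A : algType k) (gr : nat -> A -> Prop) :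
  regular_algebra gr 3 -> has_cuspidal_point_scheme gr ->
  3%:R != 0 :> k /\ exists x : 'I_3 -> A, quadratic_algebra gr x (cusp_relations k).
Proof.
move=> reg [x [W [AxW [F [/cuspidalP [g [e [g_unit e3 FE]]] scheme]]]]].
pose conj (h w : 'M[k]_3) := h^T *m w *m h.
have congr_space (V : {vspace 'M[k]_3}) (h : 'M[k]_3) : h \in unitmx ->
    exists V' : {vspace 'M[k]_3}, forall w, (w \in V') = (h^T *m w *m h \in V).
  move=> h_unit; have [L LE] : {L : {linear 'M[k]_3 -> 'M[k]_3} | L =1 conj h}.
    apply: linear_of => [u v|c u]; rewrite /conj; first by rewrite mulmxBr mulmxBl.
    by rewrite -scalemxAr -scalemxAl.
  exists (linfun L @^-1: V)%VS => w.
  by rewrite -memv_preim lfunE /= LE.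
have [W1 W1E] := congr_space W g g_unit.
have Ax1 := quadratic_algebra_change AxW g_unit W1E.
have CP := cusp_points_change g_unit FE W1E scheme.
have [a [b [a0 c0 W1G]]] := cusp_points_graph CP.
have [T [Tn TW TW']] := regular_tensor Ax1 reg.
have a1 : a = 1.
  apply: (graph_rel_tensor a0 c0 (T := T)) => // [l|j]; apply/W1G; first exact: TW.
  exact: TW'.
move: c0; rewrite a1 subrr mulr0 addr0 mulf_eq0 negb_or => /andP[n3 b0].
split=> //; have e0 : e = 0 by apply/eqP/negPn/negP => /e3/eqP; rewrite (negbTE n3).
pose d : 'M[k]_3 := diag_mx (\row_j pt3 1 b^-1 (b^-1 ^+ 3) j).
have d_unit : d \in unitmx.
  rewrite unitmxE det_diag unitfE; apply/prodf_neq0 => i _; rewrite mxE.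
  by elim/ord3_ind: i; rewrite !pt3E ?oner_neq0 ?expf_neq0 ?invr_neq0.
eexists; apply: (quadratic_algebra_change Ax1 d_unit) => w.
have dE i j : (d^T *m w *m d) i j = pt3 1 b^-1 (b^-1 ^+ 3) i * w i j *
    pt3 1 b^-1 (b^-1 ^+ 3) j.
  by rewrite tr_diag_mx mul_mx_diag mul_diag_mx !mxE.
apply/idP/idP => [/cusp_relationsP G|/W1G G]; [apply/W1G | apply/cusp_relationsP].
  rewrite a1 e0 (_ : graph_rel 1 b 0 = graph_rel 1 (1 / b^-1) 0); last by rewrite div1r invrK.
  by apply: graph_rel_scale G; rewrite ?invr_eq0.
rewrite a1 e0 in G; rewrite (_ : graph_rel 1 1 0 = graph_rel 1 (b / b) 0); last by rewrite divff.
apply: (graph_rel_scale b0 _ G) => i j; rewrite dE.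
by elim/ord3_ind: i; elim/ord3_ind: j; rewrite !pt3E; field.
Qed.

(** * The PBW basis *)

(* Reflexive decision of linear identities with integer coefficients. *)
Inductive zexp := Zatom of nat | Zzero | Zadd of zexp & zexp | Zopp of zexp
  | Zmuln of zexp & nat.

Fixpoint zeval (V : zmodType) (env : seq V) (e : zexp) : V :=
  match e with
  | Zatom i => nth 0 env i
  | Zzero => 0
  | Zadd e1 e2 => zeval env e1 + zeval env e2
  | Zopp e1 => - zeval env e1
  | Zmuln e1 n => zeval env e1 *+ n
  end.

Fixpoint zcoef (e : zexp) (i : nat) : int :=
  match e with
  | Zatom j => (i == j)%:R
  | Zzero => 0
  | Zadd e1 e2 => zcoef e1 i + zcoef e2 i
  | Zopp e1 => - zcoef e1 i
  | Zmuln e1 n => zcoef e1 i *+ n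
  end.

Lemma zeval_coef (V : zmodType) (env : seq V) e :
  zeval env e = \sum_(i < size env) nth 0 env i *~ zcoef e i.
Proof.
elim: e => [j||e1 IH1 e2 IH2|e1 IH1|e1 IH1 n] /=.
- have [js|sj] := ltnP j (size env); last first.
    rewrite nth_default // big1 // => i _.
    by rewrite (ltn_eqF (leq_trans (ltn_ord i) sj)) mulr0z.
  rewrite (bigD1 (Ordinal js)) //= eqxx mulr1z big1 ?addr0 // => i ij.
  by rewrite (_ : (i == j :> nat) = false) ?mulr0z //; apply: negbTE.
- by rewrite big1 // => i _; rewrite mulr0z.
- by rewrite IH1 IH2 -big_split; apply: eq_bigr => i _; rewrite mulrzDr.
- by rewrite IH1 -sumrN; apply: eq_bigr => i _; rewrite mulrNz.
rewrite IH1 -sumrMnl; apply: eq_bigr => i _.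
by rewrite pmulrn -mulrzA -mulr_natr natz.
Qed.

Lemma zeval_eq (V : zmodType) (env : seq V) e1 e2 :
  all (fun i => zcoef e1 i == zcoef e2 i) (iota 0 (size env)) ->
  zeval env e1 = zeval env e2.
Proof.
move=> /allP E; rewrite !zeval_coef; apply: eq_bigr => i _.
by rewrite (eqP (E i _)) // mem_iota add0n ltn_ord.
Qed.

(* Atoms are compared up to conversion, as one operation may occur through
   several canonical structures. *)
Ltac zatom_idx a l :=
  match l with
  | cons a _ => constr:(O)
  | cons ?b _ => let _ := constr:(erefl a : a = b) in constr:(O)
  | cons _ ?l' => let i := zatom_idx a l' in constr:(S i)
  end.
Ltac zatom_add a l :=
  match l with
  | _ => let _ := zatom_idx a l in l
  | _ => constr:(cons a l)
  end.
Ltac zatoms e l :=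
  lazymatch e with
  | @GRing.add _ ?a ?b => let l1 := zatoms a l in zatoms b l1
  | @GRing.opp _ ?a => zatoms a l
  | @GRing.natmul _ ?a _ => zatoms a l
  | @GRing.zero _ => l
  | _ => zatom_add e l
  end.
Ltac zreify e l :=
  lazymatch e with
  | @GRing.add _ ?a ?b =>
      let e1 := zreify a l in let e2 := zreify b l in constr:(Zadd e1 e2)
  | @GRing.opp _ ?a => let e1 := zreify a l in constr:(Zopp e1)
  | @GRing.natmul _ ?a ?n => let e1 := zreify a l in constr:(Zmuln e1 n)
  | @GRing.zero _ => constr:(Zzero)
  | _ => let i := zatom_idx e l in constr:(Zatom i)
  end.
Ltac abelian :=
  repeat rewrite scaler_nat;
  lazymatch goal with
  | |- @eq ?T ?a ?b =>
      let l := zatoms a (@nil T) in let l := zatoms b l in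
      let e1 := zreify a l in let e2 := zreify b l in
      let H := fresh in
      have H := @zeval_eq _ l e1 e2; apply: H; vm_compute; reflexivity
  end.

Section LinearExtension.
Variables (K : choiceType) (R : nzRingType) (V : lmodType R) (h : K -> V).

Definition lin_ext : malg K R -> V := malg_sum (fun t c => c *: h t).

Lemma lin_extB u v : lin_ext (u - v) = lin_ext u - lin_ext v.
Proof. by apply: malg_sumB => t c d; apply: scalerBl. Qed.

Lemma lin_extZ c u : lin_ext (c *: u) = c *: lin_ext u.
Proof.
move: u; apply: malg_ext => [u v|u v|t b].
- by rewrite scalerBr lin_extB.
- by rewrite lin_extB scalerBr.
have sB (s : K) (a d : R) : (a - d) *: h s = a *: h s - d *: h s by exact: scalerBl.
by rewrite malgUZ /lin_ext !(malg_sumU sB) scalerA.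
Qed.

Lemma lin_ext_linear : linear lin_ext.
Proof. by move=> c u v; rewrite (additiveD lin_extB) lin_extZ. Qed.

HB.instance Definition _ :=
  GRing.isLinear.Build R (malg K R) V *:%R lin_ext lin_ext_linear.

Lemma lin_extU t : lin_ext << 1 *g t >> = h t.
Proof. by rewrite /lin_ext malg_sumU ?scale1r // => s a d; apply: scalerBl. Qed.

Lemma malgUE (c : R) (t : K) : << c *g t >> = c *: << 1 *g t >>.
Proof. by rewrite malgUZ mulr1. Qed.

End LinearExtension.

Lemma malg_lin_ext (K : choiceType) (R : nzRingType) (V : lmodType R)
    (f g : malg K R -> V) : linear f -> linear g ->
  (forall t, f << 1 *g t >> = g << 1 *g t >>) -> f =1 g.
Proof.
move=> fL gL fg; apply: malg_ext; [exact: linear_sub|exact: linear_sub|move=> t u].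
by rewrite malgUE (linear_Z fL) (linear_Z gL) fg.
Qed.

(** A space with a basis indexed by triples, given through its universal property and its
    coordinates. The abstract form lets the model space and, after transport, A itself be instances
    with the same operators. *)
Record based (k : fieldType) (E : lmodType k) := Based {
  bs_e : nat -> nat -> nat -> E;
  bs_ext : forall V : lmodType k, (nat -> nat -> nat -> V) -> {linear E -> V};
  bs_cf : nat -> nat -> nat -> E -> k;
  bs_extE : forall (V : lmodType k) (h : nat -> nat -> nat -> V) c b a,
    bs_ext h (bs_e c b a) = h c b a;
  bs_ind : forall P : E -> Prop, (forall x u v, P u -> P v -> P (x *: u + v)) ->
    P 0 -> (forall c b a, P (bs_e c b a)) -> forall v, P v;
  bs_cfB : forall c b a u v, bs_cf c b a (u - v) = bs_cf c b a u - bs_cf c b a v;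
  bs_cfZ : forall c b a x u, bs_cf c b a (x *: u) = x * bs_cf c b a u;
  bs_cfP : forall u v, (forall c b a, bs_cf c b a u = bs_cf c b a v) -> u = v }.

Arguments bs_ind [k E] b0 [P].
Arguments bs_cfP [k E] b0 [u v].

Lemma based_exists (k : fieldType) : exists E : lmodType k, inhabited (based E).
Proof.
pose E := malg (nat * nat * nat)%type k; exists E; constructor.
have extP (V : lmodType k) (h : nat -> nat -> nat -> V) :
    {f : {linear E -> V} | forall c b a, f << 1 *g (c, b, a) >> = h c b a}.
  pose f : {linear E -> V} := lin_ext (fun t : nat * nat * nat => h t.1.1 t.1.2 t.2).
  by exists f => c b a; apply: lin_extU.
apply: (@Based k E (fun c b a => << 1 *g (c, b, a) >>)
    (fun V h => projT1 (extP V h)) (fun c b a u => mcoeff (c, b, a) u)).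
- by move=> V h c b a /=; case: (extP V h).
- move=> P PD P0 Pe u; rewrite [u]monalgE.
  elim: (enum_fset _) => [|[[c b] a] s IHs]; first by rewrite big_nil.
  by rewrite big_cons malgUE; apply: PD.
- by move=> c b a u v; apply: mcoeffB.
- by move=> c b a x u; apply: mcoeffZ.
by move=> u v uv; apply/malgP => -[[c b] a]; apply: uv.
Qed.

Lemma bs_eq (k : fieldType) (E V : lmodType k) (X : based E) (f g : E -> V) :
  linear f -> linear g ->
  (forall c b a, f (bs_e X c b a) = g (bs_e X c b a)) -> f =1 g.
Proof.
move=> fL gL fg v; move: v; apply: (bs_ind X) => // [x u v fu fv|]; first by rewrite fL gL fu fv.
by rewrite (additive0 (linear_sub fL)) (additive0 (linear_sub gL)).
Qed.

Section Model.
Variables (k : fieldType) (E : lmodType k) (X : based E).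

Notation e3 := (bs_e X).

Definition rmul1 : {linear E -> E} := bs_ext X (fun c b a => e3 c b a.+1).
(** From x1^a x2 = x2 x1^a + a x1^(a+1). *)
Definition rmul2 : {linear E -> E} := bs_ext X (fun c b a =>
  e3 c b.+1 a + a%:R *: e3 c b a.+1).

(** Right multiplication of x3^c x2^b by x3: the factor x3 is moved to the left by x2 x3 = x3 x2 + 2
    x3 x1 - 3 x2^2 + 2 x2 x1. Then [r3] treats the factors x1 by x1 x3 = x3 x1 - x1^2 - 3 x2^2. *)
Fixpoint r3_b (c b : nat) : E := if b is b'.+1 then
    rmul2 (r3_b c b') + 2%:R *: rmul1 (r3_b c b') - 3%:R *: rmul2 (rmul2 (e3 c b' 0))
      + 2%:R *: rmul1 (rmul2 (e3 c b' 0))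
  else e3 c.+1 0 0.

Fixpoint r3 (c b a : nat) : E := if a is a'.+1 then
    rmul1 (r3 c b a') - rmul1 (rmul1 (e3 c b a')) - 3%:R *: rmul2 (rmul2 (e3 c b a'))
  else r3_b c b.

Definition rmul3 : {linear E -> E} := bs_ext X r3.

Lemma rmul1E c b a : rmul1 (e3 c b a) = e3 c b a.+1. Proof. exact: bs_extE. Qed.
Lemma rmul2E c b a : rmul2 (e3 c b a) = e3 c b.+1 a + a%:R *: e3 c b a.+1.
Proof. exact: bs_extE. Qed.
Lemma rmul3E c b a : rmul3 (e3 c b a) = r3 c b a. Proof. exact: bs_extE. Qed.

Lemma bs_cfD c b a u v : bs_cf X c b a (u + v) = bs_cf X c b a u + bs_cf X c b a v.
Proof. exact: (additiveD (bs_cfB X c b a)). Qed.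
Lemma bs_cfN c b a u : bs_cf X c b a (- u) = - bs_cf X c b a u.
Proof. exact: (additiveN (bs_cfB X c b a)). Qed.

Lemma rmul2_rmul1 v : rmul2 (rmul1 v) = rmul1 (rmul2 v) + rmul1 (rmul1 v).
Proof.
move: v; apply: (bs_eq (X := X)) => [x u w|x u w|c b a].
- by rewrite /= !linearP.
- by rewrite !linearP scalerDr addrACA.
rewrite rmul1E !rmul2E !linearD !linearZ_LR !rmul1E.
by rewrite -natr1 scalerDl scale1r addrA.
Qed.

Lemma rmul3_rmul1 v : rmul3 (rmul1 v) = rmul1 (rmul3 v) - rmul1 (rmul1 v) - 3%:R *: rmul2 (rmul2 v).
Proof.
move: v; apply: (bs_eq (X := X)) => [x u w|x u w|c b a].
- by rewrite /= !linearP.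
- by rewrite !linearP; apply: (bs_cfP X) => c b a; rewrite !(bs_cfD, bs_cfN, bs_cfZ); ring.
by rewrite [in LHS]rmul1E !rmul3E.
Qed.

(** On e_{c,b,0} this is the definition of [r3_b]. The induction step, from u to u x1, is the
    resolution of x1 x2 x3, the only overlap of the three rewriting rules. *)
Lemma rmul3_rmul2 v : rmul3 (rmul2 v) =
  rmul2 (rmul3 v) + 2%:R *: rmul1 (rmul3 v) - 3%:R *: rmul2 (rmul2 v) + 2%:R *: rmul1 (rmul2 v).
Proof.
move: v; apply: (bs_eq (X := X)) => [x u w|x u w|c b a].
- by rewrite /= !linearP.
- by rewrite !linearP; apply: (bs_cfP X) => c b a; rewrite !(bs_cfD, bs_cfN, bs_cfZ); ring.
elim: a => [|a IHa].
  by rewrite rmul2E scale0r addr0 !rmul3E /= rmul2E scale0r addr0.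
rewrite -rmul1E; move: (e3 c b a) IHa => u IH.
have [B1 Z1] := (linearB rmul1, linearZ_LR rmul1); have [B2 Z2] := (linearB rmul2, linearZ_LR rmul2).
have [D1 D2 D3] := And3 (linearD rmul1) (linearD rmul2) (linearD rmul3).
rewrite rmul2_rmul1 D3 !rmul3_rmul1 IH !(B1, D1, Z1, B2, D2, Z2, rmul2_rmul1).
by apply: (bs_cfP X) => *; rewrite !(bs_cfD, bs_cfN, bs_cfZ); ring.
Qed.

End Model.

Lemma cusp_relations_sum (k : fieldType) (V : lmodType k) (F : 'I_3 -> 'I_3 -> V) :
  (forall w, w \in cusp_relations k -> \sum_i \sum_j w i j *: F i j = 0) <->
  [/\ F o0 o1 = F o1 o0 + F o0 o0,
      F o2 o0 = F o0 o2 + F o0 o0 + 3%:R *: F o1 o1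
    & F o2 o1 = F o1 o2 - 3%:R *: F o1 o1 - 2%:R *: F o0 o2 - 2%:R *: F o0 o1].
Proof.
pose S (w : 'M[k]_3) : V := \sum_i \sum_j w i j *: F i j.
have sE : (forall v : V, 1 *: v = v) * (forall v : V, 0 *: v = 0) *
    (forall (c : k) (v : V), (- c) *: v = - (c *: v)).
  by split; [split|] => *; rewrite ?scale1r ?scale0r ?scaleNr.
have S1 : S (cusp_rel1 k) = F o0 o1 - (F o1 o0 + F o0 o0).
  rewrite /S !sum3 !mxE !(ord3_neq, eqxx) /= !(add0r, subr0, addr0, sub0r, oppr0) !sE.
  by abelian.
have S2 : S (cusp_rel2 k) = F o2 o0 - (F o0 o2 + F o0 o0 + 3%:R *: F o1 o1).
  rewrite /S !sum3 !mxE !(ord3_neq, eqxx) /=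
    !(mulr0, mulr1, add0r, subr0, addr0, sub0r, oppr0) !sE.
  by abelian.
have S3 : S (cusp_rel3 k) = F o2 o1 -
    (F o1 o2 - 3%:R *: F o1 o1 - 2%:R *: F o0 o2 - 2%:R *: F o0 o1).
  rewrite /S !sum3 !mxE !(ord3_neq, eqxx) /=
    !(mulr0, mulr1, add0r, subr0, addr0, sub0r, oppr0, opprK) !sE.
  by abelian.
split=> [F0|[E1 E2 E3] w /cusp_relationsE [a [b [c ->]]]].
  have F0' w : w \in cusp_relations k -> S w = 0 by exact: F0.
  by split; apply/eqP; rewrite -subr_eq0 -?S1 -?S2 -?S3 F0' //; apply/cusp_relationsE;
    [exists 1, 0, 0 | exists 0, 1, 0 | exists 0, 0, 1];
    rewrite !(scale0r, scale1r, addr0, add0r).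
have SL : linear S.
  move=> d u v; rewrite /S scaler_sumr -big_split; apply: eq_bigr => i _.
  rewrite scaler_sumr -big_split; apply: eq_bigr => j _.
  by rewrite !mxE scalerDl scalerA.
rewrite -/(S _) !(additiveD (linear_sub SL)) !(linear_Z SL).
by rewrite S1 {1}E1 S2 {1}E2 S3 {1}E3 !subrr !scaler0 !addr0.
Qed.

Lemma act_exists (k : fieldType) n (E : lmodType k) (T : 'I_n -> {linear E -> E}) :
  exists act : free_alg k n -> E -> E,
    [/\ forall v, linear (act^~ v), forall f, linear (act f),
        forall v, act 1 v = v, forall i v, act (free_gen k i) v = T i v
      & forall f g v, act (f * g) v = act g (act f v)].
Proof.
pose act f v : E := words_to (fun s => foldl (fun u i => T i u) v s) f.
have actw s v : act (word k s) v = foldl (fun u i => T i u) v s by rewrite /act words_toE.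
have actl v : linear (act^~ v) by move=> *; apply: words_to_linear.
have actr f : linear (act f).
  move=> c u v; move: f; apply: free_ext => //.
    move=> d f g /=; rewrite !actl !scalerDr !scalerA addrACA.
    by rewrite [c * d]mulrC.
  move=> s; rewrite !actw; elim: s u v => //= i s IHs u v.
  by rewrite linearP IHs.
exists act; split=> // [v|i v|f g v].
- by rewrite -(word0 k n) actw.
- by rewrite -word1 actw.
move: f; apply: free_ext => [c f f'|c f f'|s].
- by rewrite /= mulrDl -scalerAl actl.
- by rewrite actl actr.
move: g; apply: free_ext => [c f f'|c f f'|t].
- by rewrite /= mulrDr -malg_scaleAr actl.
- by rewrite actl.
by rewrite -word_cat !actw foldl_cat.
Qed.

Section PBW.
Variables (k : fieldType) (A : algType k) (gr : nat -> A -> Prop) (x : 'I_3 -> A).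
Hypothesis AxW : quadratic_algebra gr x (cusp_relations k).

Notation x1 := (x o0).
Notation x2 := (x o1).
Notation x3 := (x o2).

Lemma cusp_alg_rel : [/\ x1 * x2 = x2 * x1 + x1 * x1,
  x1 * x3 = x3 * x1 - x1 * x1 - 3%:R *: (x2 * x2) &
  x2 * x3 = x3 * x2 + 2%:R *: (x3 * x1) - 3%:R *: (x2 * x2) + 2%:R *: (x2 * x1)].
Proof.
have [E1 E2 E3] := (cusp_relations_sum (fun i j => x i * x j)).1 (@quad_rel _ _ _ _ _ _ AxW).
split=> //; first by rewrite E2; abelian.
rewrite E3 E1 E2 !(scalerDr, scalerA) -?natrM; abelian.
Qed.

Definition mono c b a : A := x3 ^+ c * x2 ^+ b * x1 ^+ a.

(** The operators imitate the rewriting of a monomial times a generator, so they agree with right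
    multiplication wherever the relations hold. The lemma serves the map from the model to A and
    later, with [h] the identity, A itself. *)
Lemma mono_R (E : lmodType k) (X : based E) (h : {linear E -> A}) :
  (forall c b a, h (bs_e X c b a) = mono c b a) ->
  [/\ forall v, h (rmul1 X v) = h v * x1, forall v, h (rmul2 X v) = h v * x2
    & forall v, h (rmul3 X v) = h v * x3].
Proof.
have [x12 x13 x23] := cusp_alg_rel; move=> hE.
have [[hN hD] hZ] := (linearN h, linearD h, linearZ_LR h).
have lM (y : A) : linear (fun v => h v * y).
  by move=> c u v; rewrite linearP mulrDl scalerAl.
have lR (f : {linear E -> E}) : linear (fun v => h (f v)) by move=> c u v; rewrite !linearP.
have h1 v : h (rmul1 X v) = h v * x1.
  apply: (bs_eq (X := X) (lR _) (lM _)) => c b a.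
  by rewrite rmul1E !hE /mono exprSr !mulrA.
have h2 v : h (rmul2 X v) = h v * x2.
  apply: (bs_eq (X := X) (lR _) (lM _)) => c b a.
  rewrite rmul2E linearD linearZ_LR !hE /mono -!mulrA.
  have -> : x1 ^+ a * x2 = x2 * x1 ^+ a + a%:R *: x1 ^+ a.+1.
    elim: a => [|a IHa]; first by rewrite mul1r mulr1 scale0r addr0.
    rewrite exprS -mulrA IHa mulrDr mulrA x12 mulrDl -!mulrA -!exprS -scalerAr -exprS.
    by rewrite -addrA -[in RHS]natr1 scalerDl scale1r [_ + x1 ^+ _]addrC.
  by rewrite !mulrDr -!scalerAr [x2 ^+ b.+1]exprSr !mulrA.
have h3b c b : h (r3_b X c b) = mono c b 0 * x3.
  elim: b => [|b IHb]; first by rewrite hE /mono !mulr1 exprSr.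
  rewrite /= !(hD, hN, hZ) /= !(h1, h2) hE IHb.
  have -> : mono c b.+1 0 * x3 = mono c b 0 * (x2 * x3) by rewrite /mono exprSr !mulr1 !mulrA.
  by rewrite x23 !(mulrDr, mulrN) -!scalerAr !mulrA.
have h3 v : h (rmul3 X v) = h v * x3.
  apply: (bs_eq (X := X) (lR _) (lM _)) => c b a.
  rewrite rmul3E hE; elim: a => [|a IHa] //=.
  rewrite !(hD, hN, hZ) /= !(h1, h2) hE IHa.
  have -> : mono c b a.+1 * x3 = mono c b a * (x1 * x3) by rewrite /mono exprSr !mulrA.
  by rewrite x13 !(mulrDr, mulrN) -!scalerAr !mulrA.
by [].
Qed.

Lemma cusp_right_action (E : lmodType k) (X : based E) (v0 : E) :
  exists phi : A -> E, [/\ linear phi, phi 1 = v0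
    & forall i a, phi (a * x i) = pt3 (rmul1 X) (rmul2 X) (rmul3 X) i (phi a)].
Proof.
pose T := pt3 (rmul1 X) (rmul2 X) (rmul3 X).
have [act [actl actr act1 actg actM]] := act_exists T.
have act0 f : in_quad_ideal (cusp_relations k) f -> act f v0 = 0.
  case=> m [f1 [f2 [w [wW ->]]]].
  rewrite (additive_sum (linear_sub (actl v0))) big1 // => i _; rewrite !actM.
  rewrite (_ : act (quad_tensor (w i)) _ = 0) ?(additive0 (linear_sub (actr _))) //.
  move: (act _ v0) => v; rewrite (additive_sum (linear_sub (actl v))).
  transitivity (\sum_p \sum_q w i p q *: T q (T p v)).
    apply: eq_bigr => p _; rewrite (additive_sum (linear_sub (actl v))).
    by apply: eq_bigr => q _; rewrite (linear_Z (actl v)) actM !actg.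
  move: (w i) (wW i); apply/cusp_relations_sum; rewrite /T !pt3E.
  rewrite rmul3_rmul2 rmul3_rmul1 rmul2_rmul1; split; abelian.
pose F a := projT1 (boolp.cid (qa_onto AxW a)).
have EF a : eval_free x (F a) = a by rewrite /F; case: boolp.cid.
have qE f g : eval_free x f = eval_free x g -> act f v0 = act g v0.
  move=> E'; apply/eqP; rewrite -subr_eq0 -(linear_sub (actl v0)); apply/eqP/act0.
  by apply/(qa_kernel AxW); rewrite eval_freeB E' subrr.
exists (fun a => act (F a) v0); split=> [c a b||i a].
- by rewrite -actl; apply: qE; rewrite eval_free_linear !EF.
- by rewrite -[RHS]act1; apply: qE; rewrite EF eval_free1.
by rewrite -actg -actM; apply: qE; rewrite eval_freeM !EF eval_free_gen.
Qed.

Lemma based_transport (E V : lmodType k) (X : based E) (f : {linear V -> E})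
    (g : {linear E -> V}) : cancel f g -> cancel g f ->
  {Y : based V | forall c b a, bs_e Y c b a = g (bs_e X c b a)}.
Proof.
move=> fK gK.
unshelve eexists (@Based k V (fun c b a => g (bs_e X c b a))
  (fun U h => bs_ext X h \o f) (fun c b a v => bs_cf X c b a (f v)) _ _ _ _ _) => //.
- by move=> U h c b a /=; rewrite gK bs_extE.
- move=> P PD P0 Pe v; rewrite -(fK v); move: (f v).
  apply: (bs_ind X) => [c u w Pu Pw||//]; first by rewrite linearP; apply: PD.
  by rewrite linear0.
- by move=> c b a u v; rewrite /= linearB bs_cfB.
- by move=> c b a y u; rewrite /= linearZ_LR bs_cfZ.
by move=> u v uv; apply: (can_inj fK); apply: (bs_cfP X).
Qed.

(** The model is a right A-module, and a |-> e_{0,0,0} a is inverse to e_{c,b,a} |-> x3^c x2^b x1^a: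
    one composite is checked by multiplying with generators, the other on the basis. *)
Lemma pbw : exists X : based A, forall c b a, bs_e X c b a = mono c b a.
Proof.
have [E [X]] := based_exists k.
have [phi [phiL phi1 phiM]] := cusp_right_action X (bs_e X 0 0 0).
have [f fE] : {f : {linear A -> E} | f =1 phi}.
  by apply: linear_of; [exact: linear_sub | exact: linear_Z].
pose g : {linear E -> A} := bs_ext X mono.
have gE c b a : g (bs_e X c b a) = mono c b a by exact: bs_extE.
have [g1 g2 g3] := mono_R gE.
have f1 a : f (a * x1) = rmul1 X (f a) by rewrite !fE phiM pt3E.
have f2 a : f (a * x2) = rmul2 X (f a) by rewrite !fE phiM pt3E.
have f3 a : f (a * x3) = rmul3 X (f a) by rewrite !fE phiM pt3E.
have gM i v : g (pt3 (rmul1 X) (rmul2 X) (rmul3 X) i v) = g v * x i.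
  by elim/ord3_ind: i; rewrite pt3E.
have fK : cancel f g.
  move=> a; have [h ->] := qa_onto AxW a; move: h; apply: free_ind => [|c u v IHu IHv|u i IHu].
  - by rewrite eval_free1 fE phi1 gE /mono !mulr1.
  - by rewrite eval_free_linear !linearP IHu IHv.
  by rewrite eval_freeM eval_free_gen fE phiM -fE gM IHu.
have gK : cancel g f.
  apply: (bs_eq (X := X)) => [c u v|//|c b a]; first by rewrite !linearP.
  rewrite gE /mono; elim: a => [|a IHa]; last by rewrite exprSr mulrA f1 IHa rmul1E.
  rewrite mulr1; elim: b => [|b IHb].
    rewrite mulr1; elim: c => [|c IHc]; first by rewrite fE phi1.
    by rewrite exprSr f3 IHc rmul3E.
  by rewrite exprSr mulrA f2 IHb rmul2E scale0r addr0.
have [Y YE] := based_transport X fK gK; exists Y => c b a.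
by rewrite YE gE.
Qed.

End PBW.

(** * Filtered Koszul complexes *)

(* A complex V -> V^3 -> V^3 -> V whose differentials are those of the Koszul
   complex of three commuting shifts S1, S2, S3 of weights 1, 2, 4, up to terms
   of lower weight.  The left inverses Q_i of the S_i (division by x_i) provide a contracting homotopy h of the leading complex, and on cycles
   f |-> f - d (h f) lowers the weight. *)
Section Filtered.
Variables (V : zmodType) (F : nat -> V -> Prop).
Hypothesis F0 : forall n, F n 0.
Hypothesis FB : forall n u v, F n u -> F n v -> F n (u - v).
Hypothesis F_triv : forall v, F 0 v -> v = 0.
Hypothesis F_ex : forall v, exists n, F n v.
Hypothesis F_le : forall m n v, (m <= n)%N -> F m v -> F n v.

Definition raises (w : nat) (T : V -> V) : Prop :=
  forall n v, F n v -> F (n + w)%N (T v).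
(* T raises the weight by less than w. *)
Definition minor (w : nat) (T : V -> V) : Prop :=
  forall n v, F n.+1 v -> F (n + w)%N (T v).
Definition lowers w (T : V -> V) : Prop :=
  forall n v, F n v -> F (n - w)%N (T v).

Variables S1 S2 S3 Q1 Q2 Q3 : {additive V -> V}.
Hypotheses (Q1F : lowers 1 Q1) (Q2F : lowers 2 Q2) (Q3F : lowers 4 Q3).
Hypotheses (S1F : raises 1 S1) (S2F : raises 2 S2).
Hypotheses (Q1S1 : cancel S1 Q1) (Q2S2 : cancel S2 Q2) (Q3S3 : cancel S3 Q3).
Hypotheses (Q1S2 : forall v, Q1 (S2 v) = S2 (Q1 v)) (Q1S3 : forall v, Q1 (S3 v) = S3 (Q1 v)).
Hypotheses (Q2S1 : forall v, Q2 (S1 v) = S1 (Q2 v)) (Q2S3 : forall v, Q2 (S3 v) = S3 (Q2 v)).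
Hypotheses (S12 : forall v, S1 (S2 v) = S2 (S1 v)) (S13 : forall v, S1 (S3 v) = S3 (S1 v)).
Hypothesis S23 : forall v, S2 (S3 v) = S3 (S2 v).

Variables D1 D2 D3 e11 e12 e13 e21 e22 e23 e31 e32 : {additive V -> V}.
Hypotheses (D1S : minor 1 (D1 \- S1)) (D2S : minor 2 (D2 \- S2)) (D3S : minor 4 (D3 \- S3)).
Hypotheses (E11 : minor 5 e11) (E12 : minor 4 (e12 \- S3)) (E13 : minor 2 (e13 \+ S2)).
Hypotheses (E21 : minor 4 (e21 \+ S3)) (E22 : minor 3 e22) (E23 : minor 1 (e23 \- S1)).
Hypotheses (E31 : minor 2 (e31 \- S2)) (E32 : minor 1 (e32 \+ S1)).
Hypothesis dd1 : forall v, D1 (e11 v) + D2 (e21 v) + D3 (e31 v) = 0.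
Hypothesis dd2 : forall v, D1 (e12 v) + D2 (e22 v) + D3 (e32 v) = 0.
Hypothesis dd3 : forall v, D1 (e13 v) + D2 (e23 v) = 0.
Hypothesis ddd1 : forall v, e11 (D1 v) + e12 (D2 v) + e13 (D3 v) = 0.
Hypothesis ddd2 : forall v, e21 (D1 v) + e22 (D2 v) + e23 (D3 v) = 0.
Hypothesis ddd3 : forall v, e31 (D1 v) + e32 (D2 v) = 0.

Let FN n u : F n u -> F n (- u).
Proof. by move=> Fu; rewrite -sub0r; apply: FB. Qed.
Let FD n u v : F n u -> F n v -> F n (u + v).
Proof. by move=> Fu Fv; rewrite -[v]opprK; apply: FB => //; apply: FN. Qed.

(** The indices use truncated subtraction; this is harmless because level 0 of the filtration is
    zero. *)
Let minorF w u n (T : V -> V) v : minor w T -> T 0 = 0 -> (w <= u)%N ->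
  F (n.+1 - u)%N v -> F (n - (u - w))%N (T v).
Proof.
move=> Tw T0 wu; have [nu|un] := ltnP n u.
  by rewrite (eqP (_ : n.+1 - u == 0)%N) ?subn_eq0 // => /F_triv ->; rewrite T0.
by rewrite subSn // => /Tw; rewrite (_ : n - u + w = n - (u - w))%N //; lia.
Qed.

(** The part of v that is not divisible by x1. *)
Let Z1 v := v - S1 (Q1 v).
Let Z2 v := v - S2 (Q2 v).

Let ZF w n v (S Q : {additive V -> V}) : raises w S -> lowers w Q -> F n v -> F n (v - S (Q v)).
Proof.
move=> Sw Qw Fv; apply: FB => //; have := Qw _ _ Fv.
have [nw|wn] := leqP n w; last by move/Sw; rewrite subnK // ltnW.
by rewrite (eqP (_ : n - w == 0)%N) ?subn_eq0 // => /F_triv ->; rewrite raddf0.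
Qed.

Let F_common a b c u v w : exists n, [/\ F (n - a) u, F (n - b) v & F (n - c) w].
Proof.
have [n1 F1] := F_ex u; have [n2 F2] := F_ex v; have [n3 F3] := F_ex w.
exists (n1 + n2 + n3 + a + b + c)%N.
by split; [apply: F_le F1 | apply: F_le F2 | apply: F_le F3]; lia.
Qed.

Let diff0 (u v w : V) : u = 0 -> v = 0 -> w = u - v -> w = 0.
Proof. by move=> -> ->; rewrite subr0. Qed.

Lemma filtered_inj v : D1 v = 0 -> v = 0.
Proof.
move=> dv; have [n] := F_ex v; elim: n => [/F_triv //|n IHn Fv]; apply: IHn.
have := Q1F (FN (D1S Fv)); rewrite addn1 subn1 /= dv sub0r opprK.
by rewrite Q1S1.
Qed.

Lemma filtered_exact2 g1 g2 g3 :
  e11 g1 + e12 g2 + e13 g3 = 0 -> e21 g1 + e22 g2 + e23 g3 = 0 -> e31 g1 + e32 g2 = 0 ->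
  exists h, [/\ g1 = D1 h, g2 = D2 h & g3 = D3 h].
Proof.
(* g1, g2 and g3 are the coefficients of the Koszul generators e2^e3, e1^e3 and e1^e2, of weights 2
   + 4, 1 + 4 and 1 + 2; that of h has weight 7. *)
have [n [F1 F2 F3]] := F_common 6 5 3 g1 g2 g3.
elim: n g1 g2 g3 F1 F2 F3 => [|n IHn] g1 g2 g3.
  move=> /F_triv -> /F_triv -> /F_triv -> _ _ _.
  by exists 0; rewrite !raddf0.
move=> F1 F2 F3 E1 E2 E3; pose h := Q1 g1.
have Fh : F (n.+1 - 7) h by have := Q1F F1; rewrite -subnDA.
(* By E3, and by E2 below, the leading combinations equal minor terms, so they lie one level lower
   than expected. *)
have lead3 : F (n - 4) (S2 g1 - S1 g2).
  rewrite (_ : S2 g1 - S1 g2 = - ((e31 \- S2) g1 + (e32 \+ S1) g2)).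
    apply: FN; apply: FD; [apply: minorF E31 _ _ F1|apply: minorF E32 _ _ F2] => //=.
      by rewrite !raddf0 addr0.
    by rewrite !raddf0 addr0.
  by rewrite /= -[LHS]subr0 -E3; abelian.
have lead2 : F (n - 2) (S1 g3 - S3 g1).
  rewrite (_ : S1 g3 - S3 g1 = - ((e21 \+ S3) g1 + e22 g2 + (e23 \- S1) g3)).
    apply: FN; apply: FD; [apply: FD|]; [apply: minorF E21 _ _ F1|
      apply: minorF E22 _ _ F2|apply: minorF E23 _ _ F3] => //=; rewrite !raddf0 ?addr0 //.
  by rewrite /= -[LHS]subr0 -E2; abelian.
have [||||||h' [h1 h2 h3]] := IHn (g1 - D1 h) (g2 - D2 h) (g3 - D3 h).
- rewrite (_ : g1 - D1 h = Z1 (Q2 (S2 g1 - S1 g2)) - (D1 \- S1) h).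
    apply: FB; last by apply: minorF D1S _ _ Fh; rewrite //= !raddf0 addr0.
    apply: ZF; [exact: S1F | exact: Q1F |].
    by have := Q2F lead3; rewrite -subnDA.
  rewrite /Z1 /h !raddfB /= !Q2S2 !Q2S1 Q1S1; abelian.
- rewrite (_ : g2 - D2 h = - Q1 (S2 g1 - S1 g2) - (D2 \- S2) h).
    apply: FB; last by apply: minorF D2S _ _ Fh; rewrite //= !raddf0 addr0.
    by apply: FN; have := Q1F lead3; rewrite -subnDA.
  rewrite /h !raddfB /= Q1S1 Q1S2; abelian.
- rewrite (_ : g3 - D3 h = Q1 (S1 g3 - S3 g1) - (D3 \- S3) h).
    apply: FB; last by apply: minorF D3S _ _ Fh; rewrite //= !raddf0 addr0.
    by have := Q1F lead2; rewrite -subnDA.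
  rewrite /h !raddfB /= Q1S1 Q1S3; abelian.
- by apply: (diff0 E1 (ddd1 h)); rewrite !raddfB /=; abelian.
- by apply: (diff0 E2 (ddd2 h)); rewrite !raddfB /=; abelian.
- by apply: (diff0 E3 (ddd3 h)); rewrite !raddfB /=; abelian.
exists (h + h'); rewrite !raddfD /= -h1 -h2 -h3; split; abelian.
Qed.

Lemma filtered_exact1 f1 f2 f3 : D1 f1 + D2 f2 + D3 f3 = 0 ->
  exists g1 g2 g3, [/\ f1 = e11 g1 + e12 g2 + e13 g3,
    f2 = e21 g1 + e22 g2 + e23 g3 & f3 = e31 g1 + e32 g2].
Proof.
have [n [F1 F2 F3]] := F_common 1 2 4 f1 f2 f3.
elim: n f1 f2 f3 F1 F2 F3 => [|n IHn] f1 f2 f3.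
  move=> /F_triv -> /F_triv -> /F_triv -> _.
  by exists 0, 0, 0; rewrite !raddf0 !addr0.
(* The contracting homotopy of the leading complex: divide by x1 where possible, and divide the part
   free of x1 by x2. *)
move=> F1 F2 F3 E; pose g1 := Q2 (Z1 f3); pose g2 := - Q1 f3; pose g3 := Q1 f2.
have G1 : F (n.+1 - 6) g1.
  by have := Q2F (ZF S1F Q1F F3); rewrite -subnDA.
have G2 : F (n.+1 - 5) g2 by apply: FN; have := Q1F F3; rewrite -subnDA.
have G3 : F (n.+1 - 3) g3 by have := Q1F F2; rewrite -subnDA.
have lead : F n (S1 f1 + S2 f2 + S3 f3).
  rewrite (_ : _ + _ = - ((D1 \- S1) f1 + (D2 \- S2) f2 + (D3 \- S3) f3)).
    rewrite -[n in F n]subn0; apply: FN; apply: FD; [apply: FD|];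
      [apply: minorF D1S _ (leqnn _) F1 | apply: minorF D2S _ (leqnn _) F2
      | apply: minorF D3S _ (leqnn _) F3] => //=; rewrite !raddf0 addr0 //.
  by rewrite /= -[LHS]subr0 -E; abelian.
have Z1L : Z1 (S1 f1 + S2 f2 + S3 f3) = S2 (Z1 f2) + S3 (Z1 f3).
  by rewrite /Z1 !raddfD /= Q1S1 Q1S2 Q1S3 !raddfN S12 S13; abelian.
have Q2L : Q2 (Z1 (S1 f1 + S2 f2 + S3 f3)) = Z1 f2 + S3 g1.
  by rewrite Z1L raddfD /= Q2S2 Q2S3.
have Q3L : Q3 (Z2 (Z1 (S1 f1 + S2 f2 + S3 f3))) = Z1 f3 - S2 g1.
  rewrite {1}/Z2 Q2L Z1L (raddfD S2) /= S23 -[RHS]Q3S3; congr (Q3 _).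
  by rewrite raddfB /=; abelian.
have [||||k1 [k2 [k3 [E1 E2 E3]]]] := IHn (f1 - (e11 g1 + e12 g2 + e13 g3))
  (f2 - (e21 g1 + e22 g2 + e23 g3)) (f3 - (e31 g1 + e32 g2)).
- rewrite (_ : f1 - _ = Q1 (S1 f1 + S2 f2 + S3 f3) - (e11 g1 + (e12 \- S3) g2 + (e13 \+ S2) g3)).
    apply: FB; first exact: Q1F.
    apply: FD; [apply: FD|]; [apply: minorF E11 _ _ G1 | apply: minorF E12 _ _ G2
      | apply: minorF E13 _ _ G3] => //=; rewrite !raddf0 ?addr0 //.
  rewrite !(raddfD Q1) /= Q1S1 Q1S2 Q1S3 /g2 /g3 (raddfN S3); abelian.
- rewrite (_ : f2 - _ = Q2 (Z1 (S1 f1 + S2 f2 + S3 f3)) -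
      ((e21 \+ S3) g1 + e22 g2 + (e23 \- S1) g3)).
    apply: FB; first exact: Q2F (ZF S1F Q1F lead).
    apply: FD; [apply: FD|]; [apply: minorF E21 _ _ G1 | apply: minorF E22 _ _ G2
      | apply: minorF E23 _ _ G3] => //=; rewrite !raddf0 ?addr0 //.
  rewrite Q2L /= /g3 /Z1; abelian.
- rewrite (_ : f3 - _ = Q3 (Z2 (Z1 (S1 f1 + S2 f2 + S3 f3))) -
      ((e31 \- S2) g1 + (e32 \+ S1) g2)).
    apply: FB; first exact: Q3F (ZF S2F Q2F (ZF S1F Q1F lead)).
    apply: FD; [apply: minorF E31 _ _ G1 | apply: minorF E32 _ _ G2] => //=;
      rewrite !raddf0 ?addr0 //.
  rewrite Q3L /= /g2 /Z1 !raddfN; abelian.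
- have := congr2 +%R (congr2 +%R (dd1 g1) (dd2 g2)) (dd3 g3); rewrite !addr0.
  by move/(diff0 E); apply; rewrite !raddfB !raddfD /=; abelian.
exists (g1 + k1), (g2 + k2), (g3 + k3); rewrite !raddfD /=.
split; [rewrite -[LHS](subrK (e11 g1 + e12 g2 + e13 g3)) E1
  | rewrite -[LHS](subrK (e21 g1 + e22 g2 + e23 g3)) E2
  | rewrite -[LHS](subrK (e31 g1 + e32 g2)) E3]; abelian.
Qed.

(** Successive division by S1, S2 and S3 leaves a remainder in [F 1], where [e] is injective. *)
Lemma filtered_exact0 (M : zmodType) (e : {additive V -> M}) v :
  (forall u, F 1 (Z1 u - S2 (Q2 (Z1 u)) - S3 (Q3 (Z2 (Z1 u))))) ->
  (forall u, F 1 u -> e u = 0 -> u = 0) ->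
  (forall u, e (D1 u) = 0) -> (forall u, e (D2 u) = 0) -> (forall u, e (D3 u) = 0) ->
  e v = 0 -> exists f1 f2 f3, v = D1 f1 + D2 f2 + D3 f3.
Proof.
move=> FZ e1 eD1 eD2 eD3 ev; have [n] := F_ex v; elim: n v ev => [|n IHn] v ev Fv.
  by exists 0, 0, 0; rewrite (F_triv Fv) !raddf0 !addr0.
case: n IHn Fv => [|n] IHn Fv.
  by exists 0, 0, 0; rewrite (e1 _ Fv ev) !raddf0 !addr0.
pose f1 := Q1 v; pose f2 := Q2 (Z1 v); pose f3 := Q3 (Z2 (Z1 v)).
have FZ1 : F n.+2 (Z1 v) := ZF S1F Q1F Fv.
have FZ2 : F n.+2 (Z2 (Z1 v)) := ZF S2F Q2F FZ1.
have [||g1 [g2 [g3 E]]] := IHn (v - (D1 f1 + D2 f2 + D3 f3)).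
- by rewrite raddfB !(raddfD e) /= eD1 eD2 eD3 ev !addr0 subrr.
- rewrite (_ : _ - _ = (Z1 v - S2 f2 - S3 f3) -
      ((D1 \- S1) f1 + (D2 \- S2) f2 + (D3 \- S3) f3)); last by rewrite /= /Z1 /f1; abelian.
  apply: FB; first exact: F_le (FZ v).
  rewrite -[n.+1]subn0; apply: FD; [apply: FD|];
    [apply: minorF D1S _ (leqnn _) (Q1F Fv) | apply: minorF D2S _ (leqnn _) (Q2F FZ1)
    | apply: minorF D3S _ (leqnn _) (Q3F FZ2)] => //=; rewrite !raddf0 addr0 //.
exists (f1 + g1), (f2 + g2), (f3 + g3).
by rewrite !raddfD /= -[LHS](subrK (D1 f1 + D2 f2 + D3 f3)) E; abelian.
Qed.

End Filtered.

Section Weights.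
Variables (k : fieldType) (E : lmodType k) (X : based E).
Notation e3 := (bs_e X).

(* The generators have weights 1, 2, 4: in each relation the terms other than
   x_i x_j - x_j x_i then have smaller weight than x_i x_j. *)
Definition wt (c b a : nat) := (4 * c + 2 * b + a)%N.

(** Keeps the basis elements of weight less than n. Thus trunc n v = v is membership in level n of
    the filtration, and level 0 is zero. *)
Definition trunc n : {linear E -> E} :=
  bs_ext X (fun c b a => if (wt c b a < n)%N then e3 c b a else 0).

Lemma truncE n c b a : trunc n (e3 c b a) = if (wt c b a < n)%N then e3 c b a else 0.
Proof. exact: bs_extE. Qed.

Lemma trunc_le m n v : (m <= n)%N -> trunc n (trunc m v) = trunc m v.
Proof.
move=> mn; apply: (bs_eq (X := X) (f := trunc n \o trunc m)) => [x u w|x u w|c b a].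
- by rewrite /= !linearP.
- by rewrite linearP.
rewrite /= truncE; case: ifP => [le|_]; last by rewrite linear0.
by rewrite truncE (leq_trans le mn).
Qed.

Lemma trunc0 v : trunc 0 v = 0.
Proof.
apply: (bs_eq (X := X) (g := fun=> 0)) => [x u w|x u w|c b a]; first by rewrite linearP.
  by rewrite scaler0 addr0.
by rewrite truncE.
Qed.

Lemma trunc_ex v : exists n, trunc n v = v.
Proof.
move: v; apply: (bs_ind X) => [x u v [m um] [n vn]||c b a].
- exists (m + n)%N; rewrite linearP -um -vn !trunc_le ?leq_addr ?leq_addl //.
- by exists 0%N; rewrite linear0.
by exists (wt c b a).+1; rewrite truncE ltnSn.
Qed.

Lemma trunc_stable (f : nat -> nat) (T : {linear E -> E}) :
  (forall c b a n, (wt c b a < n)%N -> trunc (f n) (T (e3 c b a)) = T (e3 c b a)) ->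
  forall n v, trunc (f n) (T (trunc n v)) = T (trunc n v).
Proof.
move=> fT n v.
apply: (bs_eq (X := X) (f := trunc (f n) \o T \o trunc n) (g := T \o trunc n)) => [x u w|x u w|c b a].
- by rewrite /= !linearP.
- by rewrite /= !linearP.
by rewrite /= truncE; case: ifP => [le|_]; rewrite ?linear0 // fT.
Qed.

Definition shift2 : {linear E -> E} := bs_ext X (fun c b a => e3 c b.+1 a).
Definition shift3 : {linear E -> E} := bs_ext X (fun c b a => e3 c.+1 b a).
Definition quo1 : {linear E -> E} := bs_ext X (fun c b a => if a is a'.+1 then e3 c b a' else 0).
Definition quo2 : {linear E -> E} := bs_ext X (fun c b a => if b is b'.+1 then e3 c b' a else 0).
Definition quo3 : {linear E -> E} := bs_ext X (fun c b a => if c is c'.+1 then e3 c' b a else 0).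
Notation shift1 := (rmul1 X).

Lemma shiftE c b a :
  (shift1 (e3 c b a) = e3 c b a.+1) * (shift2 (e3 c b a) = e3 c b.+1 a) * (shift3 (e3 c b a) = e3 c.+1 b a).
Proof. by rewrite rmul1E !bs_extE. Qed.

Lemma divE c b a : (quo1 (e3 c b a) = if a is a'.+1 then e3 c b a' else 0) *
  (quo2 (e3 c b a) = if b is b'.+1 then e3 c b' a else 0) *
  (quo3 (e3 c b a) = if c is c'.+1 then e3 c' b a else 0).
Proof. by rewrite !bs_extE. Qed.

Lemma shift_commutes v :
  [/\ quo1 (shift1 v) = v, quo2 (shift2 v) = v & quo3 (shift3 v) = v] /\
  [/\ quo1 (shift2 v) = shift2 (quo1 v), quo1 (shift3 v) = shift3 (quo1 v), quo2 (shift1 v) = shift1 (quo2 v) &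
      quo2 (shift3 v) = shift3 (quo2 v)] /\
  [/\ shift1 (shift2 v) = shift2 (shift1 v), shift1 (shift3 v) = shift3 (shift1 v) & shift2 (shift3 v) = shift3 (shift2 v)].
Proof.
have C (f g f' g' : {linear E -> E}) :
    (forall c b a, f (g (e3 c b a)) = f' (g' (e3 c b a))) -> f (g v) = f' (g' v).
  move=> fg; apply: (bs_eq (X := X) (f := f \o g) (g := f' \o g')) => //= x u w.
    by rewrite !linearP.
  by rewrite !linearP.
do !split; first [apply: (C _ _ idfun idfun) | apply: C] => c b a;
  rewrite ?(shiftE, divE) //; by [case: a => [|a]; rewrite ?linear0 ?(shiftE, divE)
   | case: b => [|b]; rewrite ?linear0 ?(shiftE, divE)].
Qed.

Lemma trunc_R1 n v : trunc n.+1 (shift1 (trunc n v)) = shift1 (trunc n v).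
Proof.
apply: trunc_stable => c b a m cm; rewrite shiftE truncE ifT //; move: cm; rewrite /wt; lia.
Qed.

Lemma trunc_S2 n v : trunc n.+2 (shift2 (trunc n v)) = shift2 (trunc n v).
Proof.
apply: (trunc_stable (f := fun n => n.+2)) => c b a m cm.
by rewrite shiftE truncE ifT //; move: cm; rewrite /wt; lia.
Qed.

Lemma trunc_S3 n v : trunc (n + 4) (shift3 (trunc n v)) = shift3 (trunc n v).
Proof.
apply: (trunc_stable (f := addn^~ 4%N)) => c b a m cm.
by rewrite shiftE truncE ifT //; move: cm; rewrite /wt; lia.
Qed.

Lemma trunc_div n v :
  [/\ trunc (n - 1) (quo1 (trunc n v)) = quo1 (trunc n v),
      trunc (n - 2) (quo2 (trunc n v)) = quo2 (trunc n v)
    & trunc (n - 4) (quo3 (trunc n v)) = quo3 (trunc n v)].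
Proof.
by split; [apply: (trunc_stable (f := subn^~ 1)) | apply: (trunc_stable (f := subn^~ 2))
  | apply: (trunc_stable (f := subn^~ 4))] => c b a m cm; rewrite divE;
  [case: a cm => [|a] cm | case: b cm => [|b] cm | case: c cm => [|c] cm];
  rewrite ?linear0 // truncE ifT //; move: cm; rewrite /wt; lia.
Qed.

Lemma trunc_low2 n v : trunc n.+2 (rmul2 X (trunc n.+1 v) - shift2 (trunc n.+1 v)) =
  rmul2 X (trunc n.+1 v) - shift2 (trunc n.+1 v).
Proof.
have := trunc_stable (f := fun n => n.+1) (T := rmul2 X \- shift2) _ n.+1 v; apply=> c b a m cm.
rewrite /= rmul2E shiftE addrC addKr linearZ_LR truncE ifT //; move: cm; rewrite /wt; lia.
Qed.

Let In_D n u v : trunc n u = u -> trunc n v = v -> trunc n (u + v) = u + v.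
Proof. by rewrite linearD => -> ->. Qed.
Let In_N n u : trunc n u = u -> trunc n (- u) = - u.
Proof. by rewrite linearN => ->. Qed.
Let In_Z n c u : trunc n u = u -> trunc n (c *: u) = c *: u.
Proof. by rewrite linearZ_LR => ->. Qed.
Let In_le m n u : (m <= n)%N -> trunc m u = u -> trunc n u = u.
Proof. by move=> mn <-; apply: trunc_le. Qed.
Let In_R1 n u : trunc n u = u -> trunc n.+1 (shift1 u) = shift1 u.
Proof. by move=> <-; apply: trunc_R1. Qed.
Let In_R2 n u : trunc n u = u -> trunc n.+2 (rmul2 X u) = rmul2 X u.
Proof.
case: n => [<-|n un]; first by rewrite trunc0 !linear0.
rewrite -[rmul2 X u](subrK (shift2 u)); apply: In_D; last by rewrite -un; apply: trunc_S2.
by apply: (@In_le n.+2) => //; rewrite -un; apply: trunc_low2.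
Qed.
Let In_e n c b a : (wt c b a < n)%N -> trunc n (e3 c b a) = e3 c b a.
Proof. by rewrite truncE => ->. Qed.

Lemma trunc_R2 n v : trunc n.+2 (rmul2 X (trunc n v)) = rmul2 X (trunc n v).
Proof. by apply/In_R2/trunc_le. Qed.

(** Rewriting x2 x3, of weight 6, produces besides x3 x2 only terms of weight at most 5; rewriting
    x1 x3, of weight 5, besides x3 x1 only terms of weight at most 4. The claim follows by induction
    on b and then on a. *)
Lemma trunc_low3 n v : trunc (n + 4) (rmul3 X (trunc n.+1 v) - shift3 (trunc n.+1 v)) =
  rmul3 X (trunc n.+1 v) - shift3 (trunc n.+1 v).
Proof.
have B2 u w : rmul2 X (u - w) = rmul2 X u - rmul2 X w by exact: linearB.
have B1 u w : shift1 (u - w) = shift1 u - shift1 w by exact: linearB.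
have H c b a : trunc (wt c b a + 4) (r3 X c b a - e3 c.+1 b a) = r3 X c b a - e3 c.+1 b a.
  elim: a => [|a IHa].
    elim: b => [|b IHb]; first by rewrite /= subrr linear0.
    rewrite /= (_ : _ - _ = rmul2 X (r3_b X c b - e3 c.+1 b 0) + 2%:R *: shift1 (r3_b X c b)
      - 3%:R *: rmul2 X (rmul2 X (e3 c b 0)) + 2%:R *: shift1 (rmul2 X (e3 c b 0))); last first.
      by rewrite B2 (rmul2E X c.+1) scale0r; abelian.
    have He : trunc (wt c b 0).+1 (e3 c b 0) = e3 c b 0 by apply: In_e.
    apply: In_D; [apply: In_D; [apply: In_D|]|].
    - by apply: In_le (In_R2 IHb); rewrite /wt; lia.
    - apply/In_Z/(@In_le (wt c b 0 + 6)); first by rewrite /wt; lia.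
      rewrite addnS; apply: In_R1; rewrite -[r3_b X c b](subrK (e3 c.+1 b 0)).
      apply: In_D; first by apply: In_le IHb; rewrite /wt; lia.
      by apply: In_e; rewrite /wt; lia.
    - by apply/In_N/In_Z; apply: In_le (In_R2 (In_R2 He)); rewrite /wt; lia.
    by apply/In_Z; apply: In_le (In_R1 (In_R2 He)); rewrite /wt; lia.
  rewrite /= (_ : _ - _ = shift1 (r3 X c b a - e3 c.+1 b a) - shift1 (shift1 (e3 c b a))
      - 3%:R *: rmul2 X (rmul2 X (e3 c b a))); last first.
    by rewrite B1 (rmul1E X c.+1); abelian.
  have He : trunc (wt c b a).+1 (e3 c b a) = e3 c b a by apply: In_e.
  apply: In_D; [apply: In_D|].
  - by apply: In_le (In_R1 IHa); rewrite /wt; lia.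
  - by apply/In_N; apply: In_le (In_R1 (In_R1 He)); rewrite /wt; lia.
  by apply/In_N/In_Z; apply: In_le (In_R2 (In_R2 He)); rewrite /wt; lia.
have := trunc_stable (f := fun n => (n.-1 + 4)%N) (T := rmul3 X \- shift3) _ n.+1 v; apply=> c b a m cm.
by rewrite /= rmul3E shiftE; apply: In_le (H c b a); lia.
Qed.

Lemma trunc_const u : let Z1 v := v - shift1 (quo1 v) in let Z2 v := v - shift2 (quo2 v) in
  trunc 1 (Z1 u - shift2 (quo2 (Z1 u)) - shift3 (quo3 (Z2 (Z1 u)))) =
  Z1 u - shift2 (quo2 (Z1 u)) - shift3 (quo3 (Z2 (Z1 u))).
Proof.
pose z2 : {linear E -> E} := idfun \- (shift2 \o quo2).
pose t : {linear E -> E} := (z2 \- (shift3 \o quo3 \o z2)) \o (idfun \- (shift1 \o quo1)).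
have tE u' : t u' = (u' - shift1 (quo1 u')) - shift2 (quo2 (u' - shift1 (quo1 u'))) -
    shift3 (quo3 ((u' - shift1 (quo1 u')) - shift2 (quo2 (u' - shift1 (quo1 u'))))) by [].
move=> Z1 Z2; rewrite -/(Z1 u) /Z2 -tE.
apply: (bs_eq (X := X) (f := trunc 1 \o t)) => [x v w|x v w|c b a].
- exact: (linearP (trunc 1 \o t)).
- exact: (linearP t).
rewrite -[LHS]/(trunc 1 (t _)) tE !divE.
case: a => [|a]; last by rewrite !shiftE subrr !(linear0, subr0, addr0).
rewrite !(linear0, subr0, addr0) !divE; case: b => [|b].
  rewrite !(linear0, subr0, addr0) !divE.
  case: c => [|c]; last by rewrite !shiftE subrr linear0.
  by rewrite !(linear0, subr0, addr0) truncE.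
by rewrite !shiftE subrr !(linear0, subr0, addr0).
Qed.

End Weights.

(* With x_i acting on the right by R_i and on the left by L_i, the entries are
   those of the bimodule resolution given by the superpotential
   Omega = x1 w1 + x2 w2 + x3 w3 = w1 x1 + w2 x2 + w3 x3, where
   w1 = x2 x3 - x3 x2 - x1 x2 - x2 x1 - x1 x3 - x3 x1,
   w2 = x3 x1 - x1 x3 - x1^2 - 3 x2^2 and w3 = x1 x2 - x2 x1 - x1^2
   span the relations. *)
Section KoszulOperators.
Variables (V : zmodType) (R1 R2 R3 L1 L2 L3 : {additive V -> V}).

Definition kz_d1 : {additive V -> V} := R1 \- L1.
Definition kz_d2 : {additive V -> V} := R2 \- L2.
Definition kz_d3 : {additive V -> V} := R3 \- L3.
Definition kz_11 : {additive V -> V} := \- (R2 \+ R3 \+ L2 \+ L3).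
Definition kz_12 : {additive V -> V} := R3 \- R1 \- L3 \- L1.
Definition kz_13 : {additive V -> V} := L2 \- L1 \- R2 \- R1.
Definition kz_21 : {additive V -> V} := L3 \- L1 \- R1 \- R3.
Definition kz_22 : {additive V -> V} := \- ((R2 \+ L2) \+ (R2 \+ L2) \+ (R2 \+ L2)).
Definition kz_23 : {additive V -> V} := R1 \- L1.
Definition kz_31 : {additive V -> V} := R2 \- R1 \- L1 \- L2.
Definition kz_32 : {additive V -> V} := L1 \- R1.

Hypothesis R21 : forall v, R2 (R1 v) = R1 (R2 v) + R1 (R1 v).
Hypothesis R31 : forall v, R3 (R1 v) = R1 (R3 v) - R1 (R1 v) - R2 (R2 v) *+ 3.
Hypothesis R32 : forall v, R3 (R2 v) = R2 (R3 v) + R1 (R3 v) *+ 2 - R2 (R2 v) *+ 3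
  + R1 (R2 v) *+ 2.
Hypothesis L12 : forall v, L1 (L2 v) = L2 (L1 v) + L1 (L1 v).
Hypothesis L13 : forall v, L1 (L3 v) = L3 (L1 v) - L1 (L1 v) - L2 (L2 v) *+ 3.
Hypothesis L23 : forall v, L2 (L3 v) = L3 (L2 v) + L3 (L1 v) *+ 2 - L2 (L2 v) *+ 3
  + L2 (L1 v) *+ 2.
Hypothesis RL : forall v,
  [/\ R1 (L1 v) = L1 (R1 v), R1 (L2 v) = L2 (R1 v) & R1 (L3 v) = L3 (R1 v)] /\
  [/\ R2 (L1 v) = L1 (R2 v), R2 (L2 v) = L2 (R2 v) & R2 (L3 v) = L3 (R2 v)] /\
  [/\ R3 (L1 v) = L1 (R3 v), R3 (L2 v) = L2 (R3 v) & R3 (L3 v) = L3 (R3 v)].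

Lemma kz_complex v :
  [/\ kz_d1 (kz_11 v) + kz_d2 (kz_21 v) + kz_d3 (kz_31 v) = 0,
      kz_d1 (kz_12 v) + kz_d2 (kz_22 v) + kz_d3 (kz_32 v) = 0
    & kz_d1 (kz_13 v) + kz_d2 (kz_23 v) = 0] /\
  [/\ kz_11 (kz_d1 v) + kz_12 (kz_d2 v) + kz_13 (kz_d3 v) = 0,
      kz_21 (kz_d1 v) + kz_22 (kz_d2 v) + kz_23 (kz_d3 v) = 0
    & kz_31 (kz_d1 v) + kz_32 (kz_d2 v) = 0].
Proof.
have [[c11 c12 c13] [[c21 c22 c23] [c31 c32 c33]]] := RL v.
have D (f : {additive V -> V}) u w : f (u + w) = f u + f w by exact: raddfD.
have N (f : {additive V -> V}) u : f (- u) = - f u by exact: raddfN.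
have rD := (D R1, D R2, D R3, D L1, D L2, D L3).
have rN := (N R1, N R2, N R3, N L1, N L2, N L3).
rewrite /kz_d1 /kz_d2 /kz_d3 /kz_11 /kz_12 /kz_13 /kz_21 /kz_22 /kz_23 /kz_31 /kz_32 /=.
by split; split; rewrite /GRing.add_fun /GRing.sub_fun /= !(rD, rN, c11, c12, c13, c21, c22, c23, c31, c32, c33, R21, R31, R32, L12, L13, L23); abelian.
Qed.

End KoszulOperators.

(** * The Koszul complex of A (x) M *)

(* A (x)_k M as a left A-module, with tn m = 1 (x) m. *)
Record tensor (k : fieldType) (A : algType k) (M : lmodType A) := Tensor {
  tn_sort : lmodType A;
  tn : M -> tn_sort;
  tnB : forall u v, tn (u - v) = tn u - tn v;
  tnZ : forall (c : k) m, tn ((c%:A : A) *: m) = (c%:A : A) *: tn m;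
  tn_ind : forall P : tn_sort -> Prop, (forall u v, P u -> P v -> P (u - v)) ->
    (forall a m, P (a *: tn m)) -> forall v, P v;
  tn_map : {linear A -> A} -> {additive tn_sort -> tn_sort};
  tn_mapE : forall f a m, tn_map f (a *: tn m) = f a *: tn m;
  tn_lift : forall (V : lmodType A) (phi : M -> V),
    (forall u v, phi (u - v) = phi u - phi v) ->
    (forall (c : k) m, phi ((c%:A : A) *: m) = (c%:A : A) *: phi m) ->
    exists f : {linear tn_sort -> V}, forall m, f (tn m) = phi m;
  tn_proj : projective tn_sort }.

Lemma tn_eq (k : fieldType) (A : algType k) (M : lmodType A) (T : tensor M)
    (V : zmodType) (f g : tn_sort T -> V) :
  (forall u v, f (u - v) = f u - f v) -> (forall u v, g (u - v) = g u - g v) ->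
  (forall a m, f (a *: tn T m) = g (a *: tn T m)) -> f =1 g.
Proof.
move=> fB gB fg v; move: v; apply: (@tn_ind _ _ _ T) => // u v fu fv.
by rewrite fB gB fu fv.
Qed.

Section TensorKoszul.
Variables (k : fieldType) (A : algType k) (gr : nat -> A -> Prop) (x : 'I_3 -> A).
Hypothesis AxW : quadratic_algebra gr x (cusp_relations k).
Variables (X : based A).
Hypothesis XE : forall c b a, bs_e X c b a = mono x c b a.
Variables (M : lmodType A) (T : tensor M).
Notation N := (tn_sort T).

Definition tensor_ops (R L : 'I_3 -> {linear N -> N}) (e : {linear N -> M}) : Prop :=
  [/\ forall i a m, R i (a *: tn T m) = (a * x i) *: tn T m,
      forall i a m, L i (a *: tn T m) = a *: tn T (x i *: m)
    & forall a m, e (a *: tn T m) = a *: m].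

Lemma tensor_ops_exist : exists R L e, tensor_ops R L e.
Proof.
have Rx i : exists f : {linear N -> N}, forall a m, f (a *: tn T m) = (a * x i) *: tn T m.
  have [r rE] : {r : {linear A -> A} | forall a, r a = a * x i}.
    by apply: linear_of => [u v|c u]; rewrite ?mulrBl ?scalerAl.
  have [f fE] : {f : {linear N -> N} | f =1 tn_map T r}.
    apply: linear_of => [u v|a u]; first by rewrite raddfB.
    apply: (tn_eq (f := fun u => tn_map T r (a *: u)) (g := fun u => a *: tn_map T r u))
      => [v w|v w|b m]; rewrite ?scalerBr ?raddfB ?scalerBr //.
    by rewrite scalerA !tn_mapE !rE scalerA mulrA.
  by exists f => a m; rewrite fE tn_mapE rE.
have Lx i : exists f : {linear N -> N}, forall a m, f (a *: tn T m) = a *: tn T (x i *: m).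
  have [|c m|f fE] := @tn_lift _ _ _ T N (fun m => tn T (x i *: m)).
  - by move=> u v; rewrite scalerBr tnB.
  - rewrite scalerA (_ : x i * c%:A = c%:A * x i) ?mulr_algl ?mulr_algr //.
    by rewrite -mulr_algl -scalerA tnZ.
  by exists f => a m; rewrite linearZ_LR fE.
have [R RE] := boolp.choice Rx; have [L LE] := boolp.choice Lx.
have [//|//|e eE] := @tn_lift _ _ _ T M id.
by exists R, L, e; split=> // a m; rewrite linearZ_LR eE.
Qed.

Variables (R L : 'I_3 -> {linear N -> N}) (e : {linear N -> M}).
Hypothesis ops : tensor_ops R L e.

Notation Rx1 := (R o0). Notation Rx2 := (R o1). Notation Rx3 := (R o2).
Notation Lx1 := (L o0). Notation Lx2 := (L o1). Notation Lx3 := (L o2).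

Let RE i a m : R i (a *: tn T m) = (a * x i) *: tn T m. Proof. by case: ops. Qed.
Let LE i a m : L i (a *: tn T m) = a *: tn T (x i *: m). Proof. by case: ops. Qed.
Let eE a m : e (a *: tn T m) = a *: m. Proof. by case: ops. Qed.

Let RL i j v : R i (L j v) = L j (R i v).
Proof.
by apply: (tn_eq (f := R i \o L j) (g := L j \o R i)) v => [u v|u v|a m];
  rewrite /= ?raddfB // !(RE, LE).
Qed.

Let tnD u v : tn T (u + v) = tn T u + tn T v.
Proof. exact: (additiveD (tnB T)). Qed.
Let tnN u : tn T (- u) = - tn T u.
Proof. exact: (additiveN (tnB T)). Qed.

Let RLrel : forall v : N,
  [/\ Rx2 (Rx1 v) = Rx1 (Rx2 v) + Rx1 (Rx1 v),
      Rx3 (Rx1 v) = Rx1 (Rx3 v) - Rx1 (Rx1 v) - Rx2 (Rx2 v) *+ 3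
    & Rx3 (Rx2 v) = Rx2 (Rx3 v) + Rx1 (Rx3 v) *+ 2 - Rx2 (Rx2 v) *+ 3 + Rx1 (Rx2 v) *+ 2] /\
  [/\ Lx1 (Lx2 v) = Lx2 (Lx1 v) + Lx1 (Lx1 v),
      Lx1 (Lx3 v) = Lx3 (Lx1 v) - Lx1 (Lx1 v) - Lx2 (Lx2 v) *+ 3
    & Lx2 (Lx3 v) = Lx3 (Lx2 v) + Lx3 (Lx1 v) *+ 2 - Lx2 (Lx2 v) *+ 3 + Lx2 (Lx1 v) *+ 2].
Proof.
have [x12] := cusp_alg_rel AxW; rewrite !scaler_nat => x13 x23.
have tnM n (m : M) : tn T (m *+ n) = tn T m *+ n.
  by elim: n => [|n IHn]; rewrite ?mulr0n ?(additive0 (tnB T)) // !mulrS tnD IHn.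
apply: (@tn_ind _ _ _ T) => [u v [[r1 r2 r3] [l1 l2 l3]] [[r1' r2' r3'] [l1' l2' l3']]|a m].
  split; split; rewrite !(raddfB Rx1, raddfB Rx2, raddfB Rx3, raddfB Lx1, raddfB Lx2, raddfB Lx3) /=.
  - by rewrite r1 r1'; abelian.
  - by rewrite r2 r2'; abelian.
  - by rewrite r3 r3'; abelian.
  - by rewrite l1 l1'; abelian.
  - by rewrite l2 l2'; abelian.
  - by rewrite l3 l3'; abelian.
have LA i j : L i (L j (a *: tn T m)) = a *: tn T ((x i * x j) *: m).
  by rewrite !LE scalerA.
split; split; rewrite ?(LA, RE) -?mulrA ?(x12, x13, x23) ?(mulrDr, mulrN, mulrnAr);
  rewrite ?(scalerDl, scaleNr) -?scalerMnl ?(tnD, tnN, tnM) ?(scalerDr, scalerN) -?scalerMnr;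
  abelian.
Qed.

Let tm := tn_map T.
Let F n v := tm (trunc X n) v = v.

Let XR : [/\ forall a, rmul1 X a = a * x o0, forall a, rmul2 X a = a * x o1
  & forall a, rmul3 X a = a * x o2].
Proof. exact: (mono_R AxW (h := idfun) XE). Qed.

Let tm_eq (f : {linear A -> A}) (g : N -> N) : (forall u v, g (u - v) = g u - g v) ->
  (forall a m, f a *: tn T m = g (a *: tn T m)) -> tm f =1 g.
Proof.
move=> gB fg; apply: tn_eq => // [u v|a m]; first exact: raddfB.
by rewrite /tm tn_mapE fg.
Qed.

Let tm_comp (f g : {linear A -> A}) v : tm (f \o g) v = tm f (tm g v).
Proof.
apply: (tm_eq (g := tm f \o tm g)) => [u w|a m]; first by rewrite /= !raddfB.
by rewrite /= /tm !tn_mapE.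
Qed.

Let tm_comp2 (f g f' g' : {linear A -> A}) v : (forall a, f (g a) = f' (g' a)) ->
  tm f (tm g v) = tm f' (tm g' v).
Proof.
move=> fg; rewrite -!tm_comp.
apply: (tm_eq (g := tm (f' \o g'))) => [u w|a m]; first exact: raddfB.
by rewrite /tm tn_mapE /= fg.
Qed.

Let tm_id v : tm idfun v = v.
Proof. by apply: (tm_eq (g := idfun)). Qed.

Let F_tm p (f : {linear A -> A}) q v : (forall a, trunc X p (f (trunc X q a)) = f (trunc X q a)) ->
  F q v -> F p (tm f v).
Proof.
move=> pfq <-; rewrite /F -!tm_comp.
apply: (tm_eq (g := tm (f \o trunc X q))) => [u w|a m]; first exact: raddfB.
by rewrite /tm tn_mapE /= pfq.
Qed.

Let F0 n : F n 0. Proof. by rewrite /F raddf0. Qed.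
Let FB n u v : F n u -> F n v -> F n (u - v).
Proof. by rewrite /F raddfB => -> ->. Qed.
Let FN n u : F n u -> F n (- u). Proof. by rewrite /F raddfN => ->. Qed.
Let FD n u v : F n u -> F n v -> F n (u + v). Proof. by rewrite /F raddfD => -> ->. Qed.
Let F_triv v : F 0 v -> v = 0.
Proof.
move=> <-; apply: (tm_eq (g := fun=> 0)) => [u w|a m]; first by rewrite subrr.
by rewrite trunc0 scale0r.
Qed.
Let F_le m n v : (m <= n)%N -> F m v -> F n v.
Proof. by move=> mn Fv; rewrite -[v]tm_id; apply: F_tm Fv => a; apply: trunc_le. Qed.
Let F_ex v : exists n, F n v.
Proof.
move: v; apply: (@tn_ind _ _ _ T) => [u v [m Fu] [n Fv]|a m].
  by exists (m + n)%N; apply: FB; [apply: F_le Fu | apply: F_le Fv]; lia.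
by have [n an] := trunc_ex X a; exists n; rewrite /F /tm tn_mapE an.
Qed.

Let tmR : [/\ forall v, Rx1 v = tm (rmul1 X) v, forall v, Rx2 v = tm (rmul2 X) v
  & forall v, Rx3 v = tm (rmul3 X) v].
Proof.
have [x1 x2 x3] := XR; split=> v; apply/esym; move: v; apply: tm_eq => *;
  by rewrite ?RE ?x1 ?x2 ?x3 //; apply: raddfB.
Qed.

Let F_L i n v : F n v -> F n (L i v).
Proof.
have E u : tm (trunc X n) (L i u) = L i (tm (trunc X n) u).
  apply: (tn_eq (f := tm (trunc X n) \o L i) (g := L i \o tm (trunc X n))) u => [u v'|u v'|a m] /=;
    by rewrite ?raddfB // LE /tm !tn_mapE LE.
by rewrite /F E => ->.
Qed.

Let S2F n v : F n v -> F (n + 2) (tm (shift2 X) v).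
Proof. by apply: F_tm => a; rewrite addn2; apply: trunc_S2. Qed.
Let R1F n v : F n v -> F (n + 1) (Rx1 v).
Proof. by have [-> _ _] := tmR; apply: F_tm => a; rewrite addn1; apply: trunc_R1. Qed.
Let R2F n v : F n v -> F (n + 2) (Rx2 v).
Proof. by have [_ -> _] := tmR; apply: F_tm => a; rewrite addn2; apply: trunc_R2. Qed.

Let tm_sub (f g : {linear A -> A}) v : tm (f \- g) v = tm f v - tm g v.
Proof.
apply: (tm_eq (g := tm f \- tm g)) => [u w|a m]; last by rewrite /= /tm !tn_mapE scalerBl.
by rewrite /= (raddfB (tm f)) (raddfB (tm g)); abelian.
Qed.

Let low2 n v : F n.+1 v -> F (n + 2) (Rx2 v - tm (shift2 X) v).
Proof.
have [_ -> _] := tmR; rewrite -tm_sub; apply: F_tm => a.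
by rewrite addn2; apply: trunc_low2.
Qed.
Let low3 n v : F n.+1 v -> F (n + 4) (Rx3 v - tm (shift3 X) v).
Proof. by have [_ _ ->] := tmR; rewrite -tm_sub; apply: F_tm => a; apply: trunc_low3. Qed.

Let Q1F : lowers F 1 (tm (quo1 X)).
Proof. by move=> n v; apply: F_tm => a; case: (trunc_div X n a). Qed.
Let Q2F : lowers F 2 (tm (quo2 X)).
Proof. by move=> n v; apply: F_tm => a; case: (trunc_div X n a). Qed.
Let Q3F : lowers F 4 (tm (quo3 X)).
Proof. by move=> n v; apply: F_tm => a; case: (trunc_div X n a). Qed.

(** Only the factor A carries weights, so the L_i, acting on M, do not raise them. The leading part
    of each entry therefore comes from the R_i alone, and there from the shifts. *)
Lemma kz_minor :
  [/\ minor F 1 (kz_d1 Rx1 Lx1 \- tm (rmul1 X)), minor F 2 (kz_d2 Rx2 Lx2 \- tm (shift2 X))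
    & minor F 4 (kz_d3 Rx3 Lx3 \- tm (shift3 X))] /\
  [/\ minor F 5 (kz_11 Rx2 Rx3 Lx2 Lx3), minor F 4 (kz_12 Rx1 Rx3 Lx1 Lx3 \- tm (shift3 X))
    & minor F 2 (kz_13 Rx1 Rx2 Lx1 Lx2 \+ tm (shift2 X))] /\
  [/\ minor F 4 (kz_21 Rx1 Rx3 Lx1 Lx3 \+ tm (shift3 X)), minor F 3 (kz_22 Rx2 Lx2)
    & minor F 1 (kz_23 Rx1 Lx1 \- tm (rmul1 X))] /\
  [/\ minor F 2 (kz_31 Rx1 Rx2 Lx1 Lx2 \- tm (shift2 X)) & minor F 1 (kz_32 Rx1 Lx1 \+ tm (rmul1 X))].
Proof.
have facts n v (Fv : F n.+1 v) w : (0 < w)%N ->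
    [/\ F (n + w) (Lx1 v), F (n + w) (Lx2 v) & F (n + w) (Lx3 v)] /\
    ((1 < w)%N -> F (n + w) (Rx1 v) /\ F (n + w) (Rx2 v - tm (shift2 X) v)) /\
    ((2 < w)%N -> F (n + w) (Rx2 v)) /\
    ((3 < w)%N -> F (n + w) (Rx3 v - tm (shift3 X) v)) /\
    ((4 < w)%N -> F (n + w) (Rx3 v)).
  move=> w0; have FL i : F (n + w) (L i v) by apply: F_le (F_L i Fv); lia.
  split=> //; split=> [w1|].
    by split; [apply: F_le (R1F Fv) | apply: F_le (low2 Fv)]; lia.
  split=> [w2|]; first by apply: F_le (R2F Fv); lia.
  split=> [w3|w4]; first by apply: F_le (low3 Fv); lia.
  rewrite -[Rx3 v](subrK (tm (shift3 X) v)); apply: FD; first by apply: F_le (low3 Fv); lia.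
  by apply: F_le (F_tm (p := n.+1 + 4) _ Fv) => [|a]; [lia | apply: trunc_S3].
have Z v : Rx1 v = tm (rmul1 X) v by case: tmR.
split; [split|split; [split|split; [split|split]]] => n v /facts F1.
- have [[l1 _ _] _] := F1 1%N isT; rewrite (_ : _ v = - Lx1 v); first exact: FN.
  by rewrite /= -Z; abelian.
- have [[_ l2 _] [r _]] := F1 2%N isT; have [_ r2] := r isT.
  rewrite (_ : _ v = (Rx2 v - tm (shift2 X) v) - Lx2 v); first exact: FB.
  by rewrite /=; abelian.
- have [[_ _ l3] [_ [_ [r3 _]]]] := F1 4%N isT.
  rewrite (_ : _ v = (Rx3 v - tm (shift3 X) v) - Lx3 v); first by apply: FB => //; apply: r3.
  by rewrite /=; abelian.
- have [[_ l2 l3] [_ [r2 [_ r3]]]] := F1 5%N isT.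
  by apply: FN; do !apply: FD => //; [apply: r2 | apply: r3].
- have [[l1 _ l3] [r1 [_ [r3 _]]]] := F1 4%N isT; have [{}r1 _] := r1 isT.
  rewrite (_ : _ v = (Rx3 v - tm (shift3 X) v) - Rx1 v - Lx3 v - Lx1 v).
    by do 3!apply: FB => //; apply: r3.
  by rewrite /=; abelian.
- have [[l1 l2 _] [r _]] := F1 2%N isT; have [r1 r2] := r isT.
  rewrite (_ : _ v = Lx2 v - Lx1 v - (Rx2 v - tm (shift2 X) v) - Rx1 v).
    by do 3!apply: FB => //.
  by rewrite /=; abelian.
- have [[l1 _ l3] [r1 [_ [r3 _]]]] := F1 4%N isT; have [{}r1 _] := r1 isT.
  rewrite (_ : _ v = Lx3 v - Lx1 v - Rx1 v - (Rx3 v - tm (shift3 X) v)).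
    by apply: FB; [do 2!apply: FB => // | apply: r3].
  by rewrite /=; abelian.
- have [[_ l2 _] [_ [r2 _]]] := F1 3%N isT.
  by apply: FN; do !apply: FD => //; apply: r2.
- have [[l1 _ _] _] := F1 1%N isT; rewrite (_ : _ v = - Lx1 v); first exact: FN.
  by rewrite /= -Z; abelian.
- have [[l1 l2 _] [r _]] := F1 2%N isT; have [r1 r2] := r isT.
  rewrite (_ : _ v = (Rx2 v - tm (shift2 X) v) - Rx1 v - Lx1 v - Lx2 v).
    by do 3!apply: FB => //.
  by rewrite /=; abelian.
have [[l1 _ _] _] := F1 1%N isT; rewrite (_ : _ v = Lx1 v) //.
by rewrite /= -Z; abelian.
Qed.

Let shifts : [/\ forall v, tm (quo1 X) (tm (rmul1 X) v) = v, forall v, tm (quo2 X) (tm (shift2 X) v) = v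
    & forall v, tm (quo3 X) (tm (shift3 X) v) = v] /\
  [/\ forall v, tm (quo1 X) (tm (shift2 X) v) = tm (shift2 X) (tm (quo1 X) v),
      forall v, tm (quo1 X) (tm (shift3 X) v) = tm (shift3 X) (tm (quo1 X) v),
      forall v, tm (quo2 X) (tm (rmul1 X) v) = tm (rmul1 X) (tm (quo2 X) v)
    & forall v, tm (quo2 X) (tm (shift3 X) v) = tm (shift3 X) (tm (quo2 X) v)] /\
  [/\ forall v, tm (rmul1 X) (tm (shift2 X) v) = tm (shift2 X) (tm (rmul1 X) v),
      forall v, tm (rmul1 X) (tm (shift3 X) v) = tm (shift3 X) (tm (rmul1 X) v)
    & forall v, tm (shift2 X) (tm (shift3 X) v) = tm (shift3 X) (tm (shift2 X) v)].
Proof.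
have inv (f g : {linear A -> A}) : (forall a, f (g a) = a) -> forall v, tm f (tm g v) = v.
  move=> fg v; rewrite -tm_comp; apply: (tm_eq (g := idfun)) => // a m.
  by rewrite /= fg.
split; first by split=> v; apply: inv => a; case: (shift_commutes X a) => -[].
split; split=> v; apply: tm_comp2 => a; by case: (shift_commutes X a) => _ [[] ? ? ? ? []].
Qed.

Definition tensor_square_zero v := kz_complex (fun v => let: conj (And3 a _ _) _ := RLrel v in a)
  (fun v => let: conj (And3 _ a _) _ := RLrel v in a)
  (fun v => let: conj (And3 _ _ a) _ := RLrel v in a)
  (fun v => let: conj _ (And3 a _ _) := RLrel v in a)
  (fun v => let: conj _ (And3 _ a _) := RLrel v in a)
  (fun v => let: conj _ (And3 _ _ a) := RLrel v in a)
  (fun v => conj (And3 (RL o0 o0 v) (RL o0 o1 v) (RL o0 o2 v))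
    (conj (And3 (RL o1 o0 v) (RL o1 o1 v) (RL o1 o2 v))
      (And3 (RL o2 o0 v) (RL o2 o1 v) (RL o2 o2 v)))) v.

Lemma tensor_complex v :
  [/\ e (kz_d1 Rx1 Lx1 v) = 0, e (kz_d2 Rx2 Lx2 v) = 0 & e (kz_d3 Rx3 Lx3 v) = 0].
Proof.
have eB u w : e (u - w) = e u - e w by exact: raddfB.
have E i u : e (R i u - L i u) = 0.
  apply: (tn_eq (f := fun u => e (R i u - L i u)) (g := fun=> 0)) u => [u w|u w|a m].
  - by rewrite !(raddfB (R i), raddfB (L i)) !eB; abelian.
  - by rewrite subrr.
  by rewrite RE LE eB !eE scalerA subrr.
by split; apply: E.
Qed.

Lemma tensor_koszul :
  [/\ forall v, kz_d1 Rx1 Lx1 v = 0 -> v = 0,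
   forall g1 g2 g3,
     kz_11 Rx2 Rx3 Lx2 Lx3 g1 + kz_12 Rx1 Rx3 Lx1 Lx3 g2 + kz_13 Rx1 Rx2 Lx1 Lx2 g3 = 0 ->
     kz_21 Rx1 Rx3 Lx1 Lx3 g1 + kz_22 Rx2 Lx2 g2 + kz_23 Rx1 Lx1 g3 = 0 ->
     kz_31 Rx1 Rx2 Lx1 Lx2 g1 + kz_32 Rx1 Lx1 g2 = 0 ->
     exists h, [/\ g1 = kz_d1 Rx1 Lx1 h, g2 = kz_d2 Rx2 Lx2 h & g3 = kz_d3 Rx3 Lx3 h],
   forall f1 f2 f3, kz_d1 Rx1 Lx1 f1 + kz_d2 Rx2 Lx2 f2 + kz_d3 Rx3 Lx3 f3 = 0 ->
     exists g1 g2 g3,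
     [/\ f1 = kz_11 Rx2 Rx3 Lx2 Lx3 g1 + kz_12 Rx1 Rx3 Lx1 Lx3 g2 + kz_13 Rx1 Rx2 Lx1 Lx2 g3,
       f2 = kz_21 Rx1 Rx3 Lx1 Lx3 g1 + kz_22 Rx2 Lx2 g2 + kz_23 Rx1 Lx1 g3
     & f3 = kz_31 Rx1 Rx2 Lx1 Lx2 g1 + kz_32 Rx1 Lx1 g2]
   & forall v, e v = 0 -> exists f1 f2 f3,
     v = kz_d1 Rx1 Lx1 f1 + kz_d2 Rx2 Lx2 f2 + kz_d3 Rx3 Lx3 f3].
Proof.
have [[q1 q2 q3] [[q12 q13 q21 q23] [s12 s13 s23]]] := shifts.
have [[m1 m2 m3] [[m11 m12 m13] [[m21 m22 m23] [m31 m32]]]] := kz_minor.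
have S1F : raises F 1 (tm (rmul1 X)) by have [E _ _] := tmR => n v; rewrite -E; apply: R1F.
split=> [v|g1 g2 g3|f1 f2 f3|v ev].
- exact: (filtered_inj F0 FB F_triv F_ex Q1F q1 m1).
- apply: (filtered_exact2 F0 FB F_triv F_ex F_le Q1F Q2F S1F q1 q2 q12 q13 q21
    m1 m2 m3 m21 m22 m23 m31 m32) => h; by case: (tensor_square_zero h) => _ [].
- apply: (filtered_exact1 F0 FB F_triv F_ex F_le Q1F Q2F Q3F S1F S2F q1 q2 q3 q12 q13 q23
    s12 s13 s23 m1 m2 m3 m11 m12 m13 m21 m22 m23 m31 m32) => h; by case: (tensor_square_zero h) => -[].
apply: (filtered_exact0 F0 FB F_triv F_ex F_le Q1F Q2F Q3F S1F S2F m1 m2 m3 _ _ _ _ _ ev);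
  try by move=> u; case: (tensor_complex u).
- move=> u; pose z2 : {linear A -> A} := idfun \- (shift2 X \o quo2 X).
  pose z : {linear A -> A} := (z2 \- (shift3 X \o quo3 X \o z2)) \o (idfun \- (rmul1 X \o quo1 X)).
  have zE w : tm z w = (w - tm (rmul1 X) (tm (quo1 X) w)) -
      tm (shift2 X) (tm (quo2 X) (w - tm (rmul1 X) (tm (quo1 X) w))) -
      tm (shift3 X) (tm (quo3 X) ((w - tm (rmul1 X) (tm (quo1 X) w)) -
        tm (shift2 X) (tm (quo2 X) (w - tm (rmul1 X) (tm (quo1 X) w))))).
    by rewrite tm_comp tm_sub !tm_comp tm_sub !tm_comp tm_sub !tm_comp !tm_id.
  rewrite /F -zE -[in RHS](tm_id u); apply: tm_comp2 => a; exact: trunc_const.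
(* The lowest level consists of the elements 1 (x) m, and [e] sends such an element to m. *)
move=> u <- eu; have [m um] : exists m, tm (trunc X 1) u = tn T m.
  move: (u); apply: (@tn_ind _ _ _ T) => [v1 v2 [m1' vm] [m2' wm]|a m].
    by exists (m1' - m2'); rewrite raddfB vm wm tnB.
  rewrite /tm tn_mapE; have [c ->] : exists c : k, trunc X 1 a = c%:A.
    move: a {m}; apply: (bs_ind X) => [c a b [ca ea] [cb eb]||c b a].
    - by exists (c * ca + cb); rewrite linearP ea eb scalerDl scalerA.
    - by exists 0; rewrite linear0 scale0r.
    rewrite truncE XE; case: ifP => [|_]; last by exists 0; rewrite scale0r.
    rewrite /wt => w1; exists 1; rewrite scale1r.
    have [-> -> ->] : [/\ c = 0, b = 0 & a = 0]%N by split; lia.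
    by rewrite /mono !mulr1.
  by exists (c%:A *: m); rewrite tnZ.
have m0 : m = 0 by rewrite -[m]scale1r -(eE 1 m) scale1r -um; exact: eu.
by rewrite um m0 (additive0 (tnB T)).
Qed.

End TensorKoszul.

(** * Vector space bases of modules and the tensor product A (x) M *)

Section Basis.
Variables (k : fieldType) (A : algType k) (M : lmodType A).

Let scB (c d : k) (m : M) : ((c - d)%:A : A) *: m = (c%:A : A) *: m - (d%:A : A) *: m.
Proof. by rewrite scalerBl scalerBl. Qed.

Let scM (c d : k) (m : M) : (c%:A : A) *: ((d%:A : A) *: m) = ((c * d)%:A : A) *: m.
Proof. by rewrite scalerA mulr_algl scalerA. Qed.

Definition lincomb (I : choiceType) (b : I -> M) : malg I k -> M :=
  malg_sum (fun i c => (c%:A : A) *: b i).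

Lemma lincombB (I : choiceType) (b : I -> M) u v :
  lincomb b (u - v) = lincomb b u - lincomb b v.
Proof. by apply: malg_sumB => i c d; apply: scB. Qed.

Lemma lincombU (I : choiceType) (b : I -> M) i c :
  lincomb b << c *g i >> = (c%:A : A) *: b i.
Proof. by apply: malg_sumU => j d d'; apply: scB. Qed.

Lemma lincombZ (I : choiceType) (b : I -> M) c u :
  lincomb b (c *: u) = (c%:A : A) *: lincomb b u.
Proof.
move: u; apply: (malg_ext (f := fun u => lincomb b (c *: u))
  (g := fun u => (c%:A : A) *: lincomb b u)) => [u v|u v|i d].
- by rewrite scalerBr lincombB.
- by rewrite lincombB scalerBr.
by rewrite malgUZ !lincombU scM.
Qed.

Let supported (B : M -> Prop) (u : malg M k) : Prop := forall m, mcoeff m u != 0 -> B m.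
Let free (B : M -> Prop) : Prop :=
  forall u, supported B u -> lincomb id u = 0 -> u = 0.

Let supportedZ B c u : supported B u -> supported B (c *: u).
Proof. by move=> Bu m; rewrite mcoeffZ mulf_eq0 negb_or => /andP[_ /Bu]. Qed.

Let chain_supported (F : (M -> Prop) -> Prop) (s : seq M) :
  classical_sets.total_on F classical_sets.subset ->
  (forall m, m \in s -> exists2 B, F B & B m) ->
  s = [::] \/ exists2 B, F B & forall m, m \in s -> B m.
Proof.
move=> chain; elim: s => [|m s IHs] sF; first by left.
right; have [B FB Bm] := sF m (mem_head _ _).
have [|s0|[B' FB' B's]] := IHs; first by move=> m' ms; apply: sF; rewrite inE ms orbT.
  by exists B => // m'; rewrite s0 inE => /eqP ->.
have [BB'|B'B] := chain B B' FB FB'; [exists B' | exists B] => // m'; rewrite inE.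
  by case/orP => [/eqP ->|/B's //]; apply: BB'.
by case/orP => [/eqP -> //|/B's/B'B].
Qed.

(** By Zorn's lemma. A vector outside the span of a maximal free set could be added to it: if its
    coefficient in a vanishing combination were nonzero, dividing by that coefficient would put the
    vector into the span. *)
Lemma maximal_free : exists B : M -> Prop,
  free B /\ forall m, exists2 u, supported B u & lincomb id u = m.
Proof.
have [F FP chain|B [Bfree Bmax]] := @classical_sets.Zorn_bigcup M free.
  move=> u uF u0; have [m mu|u00|[B FB Bu]] := @chain_supported F (enum_fset (msupp u)) chain.
  - by apply: uF; rewrite mcoeff_neq0.
  - apply/malgP => m; rewrite mcoeff0; apply/eqP/negPn/negP.
    by rewrite mcoeff_neq0 => mu; have : m \in enum_fset (msupp u) by []; rewrite u00.
  by apply: (FP B FB u) => // m; rewrite mcoeff_neq0; apply: Bu.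
exists B; split=> // m; apply: boolp.contrapT => mB; apply: (Bmax (fun m' => B m' \/ m' = m)).
  split=> [m' Bm'|sub]; first by left.
  apply: mB; exists << 1 *g m >>; last by rewrite lincombU !scale1r.
  move=> m'; rewrite mcoeffU; have [<- _|_] := eqVneq m m'; last by rewrite mulr0n eqxx.
  by apply: sub; right.
move=> u uB' u0; have [c0|c0] := eqVneq (mcoeff m u) 0.
  by apply: Bfree => // m' m'u; case: (uB' m' m'u) => // m'm; rewrite m'm c0 eqxx in m'u.
case: mB; pose c := mcoeff m u; exists (- c^-1 *: (u - << c *g m >>)).
  apply: supportedZ => m'; rewrite mcoeffB mcoeffU; have [<-|mm'] := eqVneq m m'.
    by rewrite mulr1n subrr eqxx.
  by rewrite mulr0n subr0 => /uB' [//|m'm]; rewrite m'm eqxx in mm'.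
by rewrite lincombZ lincombB u0 lincombU sub0r scalerN scM mulNr mulVf // scaleN1r scaleNr opprK scale1r.
Qed.

Lemma basis_exists : exists (I : choiceType) (b : I -> M) (cf : M -> malg I k),
  cancel (lincomb b) cf /\ cancel cf (lincomb b).
Proof.
have [B [Bfree Bspan]] := maximal_free.
pose I : choiceType := {m : M | boolp.asbool (B m)}; pose b : I -> M := val.
pose ext : malg I k -> malg M k := malg_sum (fun i c => << c *g b i >>).
have extB u v : ext (u - v) = ext u - ext v.
  by apply: malg_sumB => i c d; apply: monalgUB.
have extU i c : ext << c *g i >> = << c *g b i >>.
  by apply: malg_sumU => j d d'; apply: monalgUB.
have ext_lin u : lincomb id (ext u) = lincomb b u.
  move: u; apply: malg_ext => [u v|u v|i c]; rewrite ?extB ?lincombB //.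
  by rewrite extU !lincombU.
have ext_supp u : supported B (ext u).
  move=> m mu; apply: boolp.contrapT => mB; move/eqP: mu; apply; move: u.
  apply: malg_ext (fun u => mcoeff m (ext u)) (fun=> 0) _ _ _ => [u v|u v|i c].
  - by rewrite extB mcoeffB.
  - by rewrite subrr.
  rewrite extU mcoeffU; have [bm|_] := eqVneq (b i) m; last by rewrite mulr0n.
  by case: mB; rewrite -bm; have := valP i => /boolp.asboolP.
have ext_cf u i : mcoeff (b i) (ext u) = mcoeff i u.
  move: u; apply: malg_ext (fun u => mcoeff (b i) (ext u)) (mcoeff i) _ _ _ => [u v|u v|j c].
  - by rewrite extB mcoeffB.
  - by rewrite mcoeffB.
  by rewrite extU !mcoeffU (inj_eq val_inj).
have inj u : lincomb b u = 0 -> u = 0.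
  rewrite -ext_lin => /(Bfree _ (ext_supp u)) u0; apply/malgP => i.
  by rewrite -ext_cf u0 !mcoeff0.
have onto m : exists u, lincomb b u = m.
  have [u uB <-] := Bspan m; rewrite /lincomb {2}/malg_sum.
  have D v w : (exists u, lincomb b u = v) -> (exists u, lincomb b u = w) ->
      exists u, lincomb b u = v + w.
    by move=> [v' <-] [w' <-]; exists (v' + w'); rewrite (additiveD (@lincombB _ b)).
  rewrite big_seq; elim/big_rec: _ => [|m' v mu Dv].
    by exists 0; apply: additive0 (@lincombB _ b).
  apply: D Dv; have /boolp.asboolP Bm' : B m' by apply: uB; rewrite mcoeff_neq0.
  by exists << mcoeff m' u *g (exist _ m' Bm' : I) >>; rewrite lincombU.
have [cf cfE] := boolp.choice onto; exists I, b, cf; split=> // u.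
by apply/eqP; rewrite -subr_eq0; apply/eqP/inj; rewrite lincombB cfE subrr.
Qed.

End Basis.

Section FreeModule.
Variables (k : fieldType) (A : algType k) (M : lmodType A).
Variables (I : choiceType) (b : I -> M) (cf : M -> malg I k).
Hypotheses (lincombK : cancel (lincomb b) cf) (cfK : cancel cf (lincomb b)).

Notation N := (malg I A).

Lemma cfB u v : cf (u - v) = cf u - cf v.
Proof. by rewrite -{1}[u]cfK -{1}[v]cfK -lincombB lincombK. Qed.

Lemma coef_ext (V : zmodType) (f g : M -> V) :
  (forall u v, f (u - v) = f u - f v) -> (forall u v, g (u - v) = g u - g v) ->
  (forall i (c : k), f ((c%:A : A) *: b i) = g ((c%:A : A) *: b i)) -> f =1 g.
Proof.
move=> fB gB fg m; rewrite -[m]cfK; move: (cf m).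
apply: (malg_ext (f := fun u => f (lincomb b u)) (g := fun u => g (lincomb b u))).
- by move=> u v; rewrite lincombB fB.
- by move=> u v; rewrite lincombB gB.
by move=> i c; rewrite lincombU fg.
Qed.

Let one_tensor (m : M) : N := malg_sum (fun i (c : k) => << c%:A *g i >>) (cf m).

Let algB (c d : k) : (c - d)%:A = c%:A - d%:A :> A.
Proof. exact: scalerBl. Qed.

Let otB u v : one_tensor (u - v) = one_tensor u - one_tensor v.
Proof.
by rewrite /one_tensor cfB; apply: malg_sumB => i c d; rewrite algB; apply: monalgUB.
Qed.

Let otU i (c : k) : one_tensor ((c%:A : A) *: b i) = << c%:A *g i >>.
Proof.
rewrite /one_tensor -(lincombU b) lincombK; apply: malg_sumU => j d d'.
by rewrite algB; apply: monalgUB.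
Qed.

Let otZ (c : k) m : one_tensor ((c%:A : A) *: m) = (c%:A : A) *: one_tensor m.
Proof.
move: m; apply: coef_ext => [u v|u v|i d].
- by rewrite scalerBr otB.
- by rewrite otB scalerBr.
by rewrite scalerA mulr_algl scalerA !otU malgUZ mulr_algl scalerA.
Qed.

Lemma free_projective : projective N.
Proof.
move=> U V f g fsurj.
have [h hE] := boolp.choice (fun i : I => fsurj (g << 1 *g i >>)).
have [q qE] : {q : {linear N -> U} | q =1 lin_ext h}.
  by apply: linear_of; [exact: lin_extB | exact: lin_extZ].
exists q => v; apply: (malg_lin_ext (f := f \o q) (g := g)) => [c u w|c u w|i].
- by rewrite /= !linearP.
- by rewrite linearP.
by rewrite /= qE lin_extU hE.
Qed.

Let map_coef (f : {linear A -> A}) : N -> N := malg_sum (fun i a => << f a *g i >>).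

Let map_coefB f u v : map_coef f (u - v) = map_coef f u - map_coef f v.
Proof. by apply: malg_sumB => i a c; rewrite linearB; apply: monalgUB. Qed.

Let map_coefU (f : {linear A -> A}) i a : map_coef f << a *g i >> = << f a *g i >>.
Proof. by apply: malg_sumU => j c d; rewrite linearB; apply: monalgUB. Qed.

(** A (x) M is realised as the free A-module on a k-basis of M, which makes it projective for every
    M. *)
Lemma free_tensor : inhabited (tensor M).
Proof.
have mapP f : {g : {additive N -> N} | g =1 map_coef f}.
  pose g : {additive N -> N} := HB.pack (map_coef f)
    (GRing.isZmodMorphism.Build N N (map_coef f) (map_coefB f)).
  by exists g.
constructor; apply: (@Tensor k A M N one_tensor otB otZ _ (fun f => projT1 (mapP f))).
- move=> P PB PA v; have P0 : P 0 by have := PB _ _ (PA 0 0) (PA 0 0); rewrite subrr.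
  have PD u w : P u -> P w -> P (u + w).
    by move=> Pu Pw; rewrite -[w]opprK; apply: (PB) => //; rewrite -sub0r; apply: PB.
  rewrite [v]monalgE; elim: (enum_fset _) => [|i s IHs]; first by rewrite big_nil.
  rewrite big_cons; apply: (PD) IHs; have := PA (mcoeff i v) (b i).
  by rewrite -[b i]scale1r -{1}[1](scale1r (1 : A)) otU malgUZ scale1r mulr1.
- move=> f a m /=; case: (mapP f) => g /= gE; rewrite gE.
  move: m; apply: (coef_ext (f := fun m => map_coef f (a *: one_tensor m))
    (g := fun m => f a *: one_tensor m)) => [u v|u v|i c].
  - by rewrite otB scalerBr map_coefB.
  - by rewrite otB scalerBr.
  by rewrite otU !malgUZ map_coefU !mulr_algr linearZ_LR.
- move=> V phi phiB phiZ.
  have [q qE] : {q : {linear N -> V} | q =1 lin_ext (fun i => phi (b i))}.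
    by apply: linear_of; [exact: lin_extB | exact: lin_extZ].
  exists q => m; move: m; apply: (coef_ext (f := fun m => q (one_tensor m))) => [u v|//|i c].
    by rewrite otB linearB.
  by rewrite otU malgUE linearZ_LR qE lin_extU phiZ.
exact: free_projective.
Qed.

End FreeModule.

Lemma tensor_exists (k : fieldType) (A : algType k) (M : lmodType A) :
  inhabited (tensor M).
Proof. by have [I [b [cf [K1 K2]]]] := basis_exists M; apply: (free_tensor K1 K2). Qed.

Lemma projective_prod (R : nzRingType) (P Q : lmodType R) :
  projective P -> projective Q -> projective (P * Q)%type.
Proof.
move=> hP hQ M N f g fsurj.
have [gl glE] : {gl : {linear P -> N} | forall p, gl p = g (p, 0)}.
  apply: linear_of => [u v|a u]; first by rewrite -linearB; congr (g (_, _)); rewrite subr0.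
  by rewrite -linearZ_LR; congr (g (_, _)); rewrite scaler0.
have [gr grE] : {gr : {linear Q -> N} | forall q, gr q = g (0, q)}.
  apply: linear_of => [u v|a u]; first by rewrite -linearB; congr (g (_, _)); rewrite subr0.
  by rewrite -linearZ_LR; congr (g (_, _)); rewrite scaler0.
have [hl hlE] := hP _ _ f gl fsurj; have [hr hrE] := hQ _ _ f gr fsurj.
have [h hE] : {h : {linear (P * Q)%type -> M} | forall z, h z = hl z.1 + hr z.2}.
  apply: linear_of => [u v|a u].
    by rewrite [(u - v).1]/(u.1 - v.1) [(u - v).2]/(u.2 - v.2) !linearB /= opprD addrACA.
  by rewrite [(a *: u).1]/(a *: u.1) [(a *: u).2]/(a *: u.2) !linearZ_LR /= scalerDr.
exists h => -[p q]; rewrite hE linearD hlE hrE glE grE -linearD.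
by congr (g (_, _)); rewrite ?addr0 ?add0r.
Qed.

(** * Assembling a projective resolution of length three *)

Section Resolution.
Variables (R : nzRingType) (M N : lmodType R) (e : {linear N -> M}).
Variables D1 D2 D3 e11 e12 e13 e21 e22 e23 e31 e32 : {linear N -> N}.

Let N3 : lmodType R := (N * N * N)%type.

Hypothesis projN : projective N.
Hypothesis e_onto : forall m, exists v, e v = m.
Hypothesis e_d : forall v, [/\ e (D1 v) = 0, e (D2 v) = 0 & e (D3 v) = 0].
Hypothesis dd : forall v,
  [/\ D1 (e11 v) + D2 (e21 v) + D3 (e31 v) = 0,
      D1 (e12 v) + D2 (e22 v) + D3 (e32 v) = 0
    & D1 (e13 v) + D2 (e23 v) = 0] /\
  [/\ e11 (D1 v) + e12 (D2 v) + e13 (D3 v) = 0,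
      e21 (D1 v) + e22 (D2 v) + e23 (D3 v) = 0
    & e31 (D1 v) + e32 (D2 v) = 0].
Hypothesis ex3 : forall v, D1 v = 0 -> v = 0.
Hypothesis ex2 : forall g1 g2 g3, e11 g1 + e12 g2 + e13 g3 = 0 ->
  e21 g1 + e22 g2 + e23 g3 = 0 -> e31 g1 + e32 g2 = 0 ->
  exists h, [/\ g1 = D1 h, g2 = D2 h & g3 = D3 h].
Hypothesis ex1 : forall f1 f2 f3, D1 f1 + D2 f2 + D3 f3 = 0 ->
  exists g1 g2 g3, [/\ f1 = e11 g1 + e12 g2 + e13 g3,
    f2 = e21 g1 + e22 g2 + e23 g3 & f3 = e31 g1 + e32 g2].
Hypothesis ex0 : forall v, e v = 0 -> exists f1 f2 f3, v = D1 f1 + D2 f2 + D3 f3.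

Lemma short_resolution : proj_dim_le M 3.
Proof.
have p1 (u v : N3) : (u - v).1.1 = u.1.1 - v.1.1 by [].
have p2 (u v : N3) : (u - v).1.2 = u.1.2 - v.1.2 by [].
have p3 (u v : N3) : (u - v).2 = u.2 - v.2 by [].
have q1 a (u : N3) : (a *: u).1.1 = a *: u.1.1 by [].
have q2 a (u : N3) : (a *: u).1.2 = a *: u.1.2 by [].
have q3 a (u : N3) : (a *: u).2 = a *: u.2 by [].
have pB (a b c a' b' c' : N) :
    ((a, b, c) : N3) - (a', b', c') = (a - a', b - b', c - c') by [].
have pZ r (a b c : N) : r *: ((a, b, c) : N3) = (r *: a, r *: b, r *: c) by [].
have [d1 d1E] : {d : {linear N3 -> N} | forall f, d f = D1 f.1.1 + D2 f.1.2 + D3 f.2}.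
  apply: linear_of => [u v|a u].
    by rewrite p1 p2 p3 (linearB D1) (linearB D2) (linearB D3) /=; abelian.
  by rewrite q1 q2 q3 !linearZ_LR -!scalerDr.
have [d2 d2E] : {d : {linear N3 -> N3} | forall g, d g =
    (e11 g.1.1 + e12 g.1.2 + e13 g.2, e21 g.1.1 + e22 g.1.2 + e23 g.2,
     e31 g.1.1 + e32 g.1.2)}.
  apply: linear_of => [u v|a u].
    rewrite p1 p2 p3 (linearB e11) (linearB e12) (linearB e13) (linearB e21) (linearB e22)
      (linearB e23) (linearB e31) (linearB e32) /=.
    by rewrite pB; congr (_, _, _); abelian.
  rewrite q1 q2 q3 (linearZ_LR e11) (linearZ_LR e12) (linearZ_LR e13) (linearZ_LR e21)
    (linearZ_LR e22) (linearZ_LR e23) (linearZ_LR e31) (linearZ_LR e32).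
  by rewrite pZ !scalerDr.
have [d3 d3E] : {d : {linear N -> N3} | forall h, d h = (D1 h, D2 h, D3 h)}.
  apply: linear_of => [u v|a u].
    by rewrite (linearB D1) (linearB D2) (linearB D3).
  by rewrite (linearZ_LR D1) (linearZ_LR D2) (linearZ_LR D3).
have [z zE] : {d : {linear 'rV[R]_0 -> N} | forall v, d v = 0}.
  by apply: linear_of => [u v|a u]; rewrite ?subrr ?scaler0.
pose P i : lmodType R := match i with
  | 0%N => N | 1%N => N3 | 2%N => N3 | 3%N => N | _ => 'rV[R]_0 end.
pose dP i : {linear P i.+1 -> P i} := match i return {linear P i.+1 -> P i} with
  | 0%N => d1 | 1%N => d2 | 2%N => d3 | 3%N => z | _.+4 => idfun end.
have projN3 : projective N3 by do 2!apply: projective_prod => //.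
exists P, dP, e; split; last first.
  by move=> [|[|[|[|i]]]] // _ y; apply: thinmx0.
have row0 (u v : 'rV[R]_0) : u = v by rewrite [u]thinmx0 [v]thinmx0.
split=> [[|[|[|[|i]]]]||y|[|[|[|i]]] y] //=; try exact: projective_row.
- split=> [|[f ->]]; last first.
    by rewrite d1E !linearD /=; case: (e_d f.1.1) (e_d f.1.2) (e_d f.2) => -> _ _ [_ -> _] [_ _ ->]; rewrite !addr0.
  by case/ex0 => f1 [f2 [f3 ->]]; exists (f1, f2, f3); rewrite d1E.
- split=> [|[g ->]].
    rewrite d1E => /ex1 [g1 [g2 [g3 [E1 E2 E3]]]]; exists (g1, g2, g3).
    by rewrite d2E -E1 -E2 -E3; case: (y) => -[].
  rewrite d1E d2E /= !(linearD D1, linearD D2, linearD D3) /=.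
  have [[a1 _ _] _] := dd g.1.1; have [[_ a2 _] _] := dd g.1.2; have [[_ _ a3] _] := dd g.2.
  have := congr2 +%R (congr2 +%R a1 a2) a3; rewrite !addr0 => <-; abelian.
- split=> [|[h ->]].
    rewrite d2E => -[g1 g2 g3]; have [h [h1 h2 h3]] := ex2 g1 g2 g3; exists h.
    by rewrite d3E -h1 -h2 -h3; case: (y) => -[].
  by rewrite d2E d3E /=; have [_ [-> -> ->]] := dd h.
- rewrite d3E; split=> [[/ex3 -> _ _]|[w ->]]; first by exists 0; rewrite linear0.
  by rewrite zE !linear0.
by case: i y => [|i] y; split=> _; try (by exists 0; apply: row0); rewrite ?zE //; apply: row0.
Qed.

End Resolution.

Section Dimension.
Variables (k : fieldType) (A : algType k) (gr : nat -> A -> Prop) (x : 'I_3 -> A).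
Hypothesis AxW : quadratic_algebra gr x (cusp_relations k).

Lemma cusp_proj_dim (M : lmodType A) : proj_dim_le M 3.
Proof.
have [X XE] := pbw AxW; have [T] := tensor_exists M.
have [R [L [e ops]]] := tensor_ops_exist x T.
have [inj3 ex2 ex1 ex0] := tensor_koszul AxW XE ops.
have sq := tensor_square_zero AxW ops.
have e0 := tensor_complex ops.
apply: (@short_resolution A M (tn_sort T) e (R o0 \- L o0) (R o1 \- L o1) (R o2 \- L o2)
  (\- (R o1 \+ R o2 \+ L o1 \+ L o2)) (R o2 \- R o0 \- L o2 \- L o0)
  (L o1 \- L o0 \- R o1 \- R o0) (L o2 \- L o0 \- R o0 \- R o2)
  (\- ((R o1 \+ L o1) \+ (R o1 \+ L o1) \+ (R o1 \+ L o1))) (R o0 \- L o0)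
  (R o1 \- R o0 \- L o0 \- L o1) (L o0 \- R o0) (@tn_proj _ _ _ T) _ e0 sq inj3 ex2 ex1 ex0) => m.
by exists (1 *: tn T m); case: ops => _ _ ->; rewrite scale1r.
Qed.

End Dimension.

(** * The grading *)

Section Grading.
Variables (k : fieldType) (E : lmodType k) (X : based E).
Notation e3 := (bs_e X).

Definition hom_part n : {linear E -> E} :=
  bs_ext X (fun c b a => if (c + b + a == n)%N then e3 c b a else 0).

Lemma hom_partE n c b a : hom_part n (e3 c b a) = if (c + b + a == n)%N then e3 c b a else 0.
Proof. exact: bs_extE. Qed.

Lemma hom_part_hom_part n m v : hom_part n (hom_part m v) = if n == m then hom_part m v else 0.
Proof.
apply: (bs_eq (X := X) (f := hom_part n \o hom_part m) (g := fun v => if n == m then hom_part m v else 0))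
  => [x u w|x u w|c b a].
- by rewrite /= !linearP.
- by case: eqP => _; rewrite ?linearP // scaler0 addr0.
rewrite /= !hom_partE; have [<-|] := eqVneq (c + b + a)%N m; last by rewrite linear0 if_same.
by rewrite hom_partE eq_sym.
Qed.

Let In n u := hom_part n u = u.

Let InD n u v : In n u -> In n v -> In n (u + v).
Proof. by rewrite /In linearD => -> ->. Qed.
Let InN n u : In n u -> In n (- u).
Proof. by rewrite /In linearN => ->. Qed.
Let InZ n (x : k) u : In n u -> In n (x *: u).
Proof. by rewrite /In linearZ_LR => ->. Qed.

Let In_map (f : {linear E -> E}) :
  (forall c b a, In (c + b + a).+1 (f (e3 c b a))) -> forall n v, In n v -> In n.+1 (f v).
Proof.
move=> fe n v <-; apply: (bs_eq (X := X) (f := hom_part n.+1 \o f \o hom_part n) (g := f \o hom_part n))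
  => [x u w|x u w|c b a].
- by rewrite /= !linearP.
- by rewrite /= !linearP.
by rewrite /= hom_partE; case: eqP => [<-|_]; rewrite ?linear0 //; apply: fe.
Qed.

Let In_e c b a n : (c + b + a = n)%N -> In n (e3 c b a).
Proof. by move=> <-; rewrite /In hom_partE eqxx. Qed.

Lemma hom_part_R1 n v : hom_part n v = v -> hom_part n.+1 (rmul1 X v) = rmul1 X v.
Proof. by apply: In_map => c b a; rewrite rmul1E; apply: In_e; rewrite addnS. Qed.

Lemma hom_part_R2 n v : hom_part n v = v -> hom_part n.+1 (rmul2 X v) = rmul2 X v.
Proof.
apply: In_map => c b a; rewrite rmul2E; apply: InD; last apply: InZ;
  by apply: In_e; rewrite ?(addnS, addSn).
Qed.

Lemma hom_part_R3 n v : hom_part n v = v -> hom_part n.+1 (rmul3 X v) = rmul3 X v.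
Proof.
apply: In_map => c b a; rewrite rmul3E; elim: a => [|a IHa].
  rewrite addn0; elim: b => [|b IHb]; first by apply: In_e; rewrite !addn0.
  have eb : In (c + b) (e3 c b 0) by apply: In_e; rewrite addn0.
  rewrite addnS; apply: InD; [apply: InD; [apply: InD|]|].
  - exact: hom_part_R2.
  - by apply/InZ/hom_part_R1.
  - by apply/InN/InZ/hom_part_R2/hom_part_R2.
  by apply/InZ/hom_part_R1/hom_part_R2.
rewrite addnS; have ea : In (c + b + a) (e3 c b a) by apply: In_e.
apply: InD; [apply: InD|]; first exact: hom_part_R1.
  by apply/InN/hom_part_R1/hom_part_R1.
by apply/InN/InZ/hom_part_R2/hom_part_R2.
Qed.

Lemma hom_part_sum v : exists N, forall n, (N <= n)%N ->
  hom_part n v = 0 /\ v = \sum_(i < n) hom_part i v.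
Proof.
move: v; apply: (bs_ind X) => [x u v [N1 H1] [N2 H2]||c b a].
- exists (N1 + N2)%N => n nN; have [|u0 uE] := H1 n; first exact: leq_trans (leq_addr _ _) nN.
  have [|v0 vE] := H2 n; first exact: leq_trans (leq_addl _ _) nN.
  rewrite linearP u0 v0 scaler0 addr0; split=> //.
  under eq_bigr do rewrite linearP.
  by rewrite big_split /= -scaler_sumr -uE -vE.
- by exists 0%N => n _; rewrite linear0 big1 // => i _; rewrite linear0.
exists (c + b + a).+1 => n nN; rewrite hom_partE (ltn_eqF nN); split=> //.
rewrite (bigD1 (Ordinal nN)) //= hom_partE eqxx big1 ?addr0 // => i ne.
rewrite hom_partE; case: eqP => // cba; case/eqP: ne.
by apply: val_inj.
Qed.

End Grading.

Section CuspGraded.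
Variables (k : fieldType) (A : algType k) (gr : nat -> A -> Prop) (x : 'I_3 -> A).
Hypothesis AxW : quadratic_algebra gr x (cusp_relations k).
Variables (X : based A).
Hypothesis XE : forall c b a, bs_e X c b a = mono x c b a.

Let grE n a : gr n a <-> word_span x n a. Proof. exact: qa_grading AxW n a. Qed.

Lemma gr_hom_part n a : gr n a -> hom_part X n a = a.
Proof.
have [/= x1 x2 x3] := mono_R AxW (h := idfun) XE.
move=> /grE [c ->]; rewrite linear_sum; apply: eq_bigr => t _.
rewrite linearZ_LR; congr (_ *: _).
case: t => s /= /eqP <-; elim/last_ind: s => [|s i IHs].
  rewrite big_nil (_ : 1 = bs_e X 0 0 0) ?hom_partE // XE /mono !mulr1 //.
rewrite -cats1 big_cat big_seq1 size_cat addn1 /=; move: IHs; set p := (\prod_(i <- s) x i) => IHs.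
by elim/ord3_ind: i; [rewrite -x1; apply: hom_part_R1 | rewrite -x2; apply: hom_part_R2
  | rewrite -x3; apply: hom_part_R3].
Qed.

Lemma hom_part_gr n a : gr n (hom_part X n a).
Proof.
move: a; apply: (bs_ind X) => [c u v gu gv||c b a].
- by rewrite linearP; apply/grE; apply: word_span_lin; apply/grE.
- by rewrite linear0; apply/grE/word_span0.
rewrite hom_partE; case: eqP => [<-|_]; last exact/grE/word_span0.
have pow i m : word_span x m (x i ^+ m).
  elim: m => [|m IHm]; last by rewrite exprS; apply: (word_spanM (m := 1)) => //; apply: word_span1.
  by have := word_span_prod x (erefl (size (Nil 'I_3))); rewrite big_nil.
rewrite XE; apply/grE; do !apply: word_spanM; exact: pow.
Qed.

Lemma gr_ids : internal_direct_sum gr.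
Proof.
apply: (@ids_of_projector _ _ _ (fun n => hom_part X n)).
- by move=> n; apply/grE/word_span0.
- by move=> n u v /grE gu /grE gv; apply/grE/word_spanB.
split=> [n v|n u v|n v gv|i j v gv ji|v].
- exact: hom_part_gr.
- exact: linearB.
- exact: gr_hom_part.
- by rewrite -(gr_hom_part gv) hom_part_hom_part (negbTE ji).
have [N NE] := hom_part_sum X v; exists (iota 0 N); split.
- exact: iota_uniq.
- by move=> i; rewrite mem_iota /= add0n -leqNgt => /NE [].
by have [_ {1}->] := NE N (leqnn N); rewrite -(big_mkord xpredT (fun i => hom_part X i v)) /index_iota subn0.
Qed.

Lemma cusp_graded : graded_algebra gr.
Proof.
split; first exact: gr_ids.
- by move=> m n a b /grE ga /grE gb; apply/grE/word_spanM.
- move=> a; rewrite grE; split=> [[c ->]|[c ->]]; last first.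
    by apply: word_spanZ; have := word_span_prod x (erefl (size (Nil 'I_3))); rewrite big_nil.
  exists (c [tuple]); rewrite (bigD1 [tuple]) //= big_nil big1 ?addr0 // => t.
  by rewrite (tuple0 t) => /eqP.
move=> S S1 SD SM Sx a; have [f ->] := qa_onto AxW a; move: f.
apply: free_ind => [|c f g Sf Sg|f i Sf].
- by rewrite eval_free1.
- by rewrite eval_free_linear; apply: SD.
rewrite eval_freeM eval_free_gen; apply: (SM) => //.
by apply/Sx/grE/word_span1.
Qed.

Lemma cusp_growth : polynomial_growth gr.
Proof.
exists 1%N, 2%N => n; rewrite mul1n.
(* The index encodes c and b in base n + 1. For c + b > n the subtraction truncates, the monomial
   has degree different from n, and [hom_part] kills it. *)
pose v (i : 'I_(n.+1 ^ 2)) : A := hom_part X n (mono x (i %/ n.+1) (i %% n.+1) (n - i %/ n.+1 - i %% n.+1)).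
exists v; split=> [i|a /gr_hom_part <-]; first exact: hom_part_gr.
move: a; apply: (bs_ind X) => [y u w [cu uE] [cw wE]||c b a].
- exists (fun i => y * cu i + cw i); rewrite linearP uE wE scaler_sumr -big_split.
  by apply: eq_bigr => i _; rewrite scalerDl scalerA.
- by exists (fun=> 0); rewrite linear0 big1 // => i _; rewrite scale0r.
rewrite hom_partE; case: eqP => [cba|_]; last first.
  by exists (fun=> 0); rewrite big1 // => i _; rewrite scale0r.
have lt : (c * n.+1 + b < n.+1 ^ 2)%N by rewrite -mulnn; nia.
exists (fun i => (i == Ordinal lt)%:R); rewrite (bigD1 (Ordinal lt)) //= eqxx scale1r.
rewrite big1 ?addr0 => [|i /negbTE ->]; last by rewrite scale0r.
have bn : (b < n.+1)%N by lia.
rewrite /v /= divnMDl // divn_small // addn0 modnMDl modn_small //.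
have -> : (n - c - b = a)%N by lia.
by rewrite -XE hom_partE cba eqxx.
Qed.

End CuspGraded.

(** * The Gorenstein condition *)

Section TrivialModule.
Variables (k : fieldType) (A : algType k) (eps : A -> k).
Hypotheses (epsL : linear (eps : A -> k^o)) (eps1 : eps 1 = 1)
  (epsM : forall a b, eps (a * b) = eps a * eps b).

Lemma regular_projective (R : nzRingType) : projective R^o.
Proof.
move=> M N f g fsurj; have [m mE] := fsurj (g 1).
have [h hE] : {h : {linear R^o -> M} | forall a, h a = (a : R) *: m}.
  by apply: linear_of => [u v|a u]; rewrite ?scalerBl ?scalerA.
by exists h => a; rewrite hE linearZ_LR mE -linearZ_LR [_ *: _]mulr1.
Qed.

(** For the trivial module K, A (x) K is A itself; with this model of the tensor product the general
    exactness statement becomes one about elements of A. *)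
Lemma trivial_tensor : exists (K : lmodType A) (k0 : K) (T : tensor K),
  [/\ k0 != 0, forall v, exists c : k, v = (c%:A : A) *: k0,
    forall a, a *: k0 = ((eps a)%:A : A) *: k0
  & exists q : {linear A^o -> tn_sort T},
    [/\ bijective q, q 1 = tn T k0 & forall f a, tn_map T f (q a) = q (f a)]].
Proof.
pose act (a : A) (c : k) : k := eps a * c.
have epsB := linear_sub epsL; have epsZ c : eps c%:A = c.
  by rewrite (linear_Z epsL) eps1 [_ *: _]mulr1.
have actA a b v : act a (act b v) = act (a * b) v by rewrite /act epsM mulrA.
have act1 : left_id 1 act by move=> v; rewrite /act eps1 mul1r.
have actDr : right_distributive act +%R by move=> a u v; rewrite /act mulrDr.
have actDl v : {morph act^~ v : a b / a + b}.
  by move=> a b; rewrite /act (additiveD epsB) mulrDl.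
pose K : lmodType A := HB.pack k
  (GRing.Zmodule_isLmodule.Build A k actA act1 actDr actDl).
have KZ (a : A) (v : K) : a *: v = eps a * v :> k by [].
pose one (m : K) : A^o := ((m : k)%:A : A).
have tnB' (u v : K) : one (u - v) = one u - one v by exact: (scalerBl (u : k) (v : k) (1 : A)).
have tnZ' (c : k) (m : K) : one ((c%:A : A) *: m) = (c%:A : A) *: one m.
  by rewrite /one KZ epsZ [RHS]mulr_algl scalerA.
have mapP (f : {linear A -> A}) : {g : {additive A^o -> A^o} | g =1 f}.
  pose g : {additive A^o -> A^o} := HB.pack (f : A^o -> A^o)
    (GRing.isZmodMorphism.Build A^o A^o (f : A^o -> A^o) (linearB f)).
  by exists g.
have idP (P : A^o -> Prop) : (forall u v, P u -> P v -> P (u - v)) ->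
    (forall (a : A) (m : K), P (a *: one m)) -> forall v, P v.
  by move=> _ PA v; have := PA v (1 : k); rewrite /one scale1r [_ *: _]mulr1.
have mapE (f : {linear A -> A}) a (m : K) :
    projT1 (mapP f) (a *: one m) = f a *: one m.
  case: (mapP f) => g /= gE; rewrite gE [_ *: _ in LHS]mulr_algr linearZ_LR.
  by rewrite [RHS]mulr_algr.
have lift (V : lmodType A) (phi : K -> V) :
    (forall u v, phi (u - v) = phi u - phi v) ->
    (forall (c : k) m, phi ((c%:A : A) *: m) = (c%:A : A) *: phi m) ->
    exists f : {linear A^o -> V}, forall m, f (one m) = phi m.
  move=> phiB phiZ.
  have [f fE] : {f : {linear A^o -> V} | forall a, f a = (a : A) *: phi (1 : k)}.
    by apply: linear_of => [u v|a u]; rewrite ?scalerBl ?scalerA.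
  exists f => m; rewrite fE -phiZ; congr (phi _).
  by rewrite KZ epsZ mulr1.
pose T := @Tensor k A K A^o one tnB' tnZ' idP
  (fun f => projT1 (mapP f)) mapE lift (@regular_projective A).
exists K, (1 : k), T; split.
- exact: oner_neq0.
- move=> v; exists (v : k).
  by rewrite KZ epsZ mulr1.
- by move=> a; rewrite !KZ epsZ.
exists idfun; split=> [||f a]; first by exists idfun.
  by rewrite /= /one scale1r.
by rewrite /=; case: (mapP f) => g /= ->.
Qed.

End TrivialModule.

Section RegularKoszul.
Variables (k : fieldType) (A : algType k) (gr : nat -> A -> Prop) (x : 'I_3 -> A).
Hypothesis AxW : quadratic_algebra gr x (cusp_relations k).
Notation x1 := (x o0). Notation x2 := (x o1). Notation x3 := (x o2).

(* The Hessian of the superpotential: \sum_j (kM r j) x_j is the relation w_r. *)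
Definition kM : 'I_3 -> 'I_3 -> A :=
  pt3 (pt3 (- (x2 + x3)) (- (x1 + x3)) (x2 - x1))
      (pt3 (x3 - x1) (- (x2 *+ 3)) (- x1))
      (pt3 (- (x1 + x2)) x1 0).

Lemma augmentation : exists eps : A -> k, [/\ linear (eps : A -> k^o), eps 1 = 1,
  forall a b, eps (a * b) = eps a * eps b & forall i, eps (x i) = 0].
Proof.
have [|p [pL p1 pM px]] := @quad_hom _ _ _ _ _ _ AxW k^o (fun=> 0).
  by move=> w _; rewrite big1 // => i _; rewrite big1 // => j _; rewrite mulr0 scaler0.
by exists p.
Qed.

Variable eps : A -> k.
Hypotheses (epsL : linear (eps : A -> k^o)) (eps1 : eps 1 = 1)
  (epsM : forall a b, eps (a * b) = eps a * eps b) (epsx : forall i, eps (x i) = 0).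

(** On A (x) K = A the operators L_i vanish, because x_i acts by zero on K. The complex of
    [tensor_koszul] then reduces to right multiplication by the x_r and by the entries of [kM]. *)
Lemma right_koszul :
  [/\ forall h, h * x1 = 0 -> h = 0,
      forall g, (forall j, \sum_r g r * kM r j = 0) -> exists h, forall r, g r = h * x r,
      forall f, \sum_r f r * x r = 0 ->
        exists g, forall j, f j = \sum_r g r * kM r j
    & forall v, eps v = 0 -> exists f, v = \sum_r f r * x r].
Proof.
have [X XE] := pbw AxW.
have [K [k0 [T [k0n k0g k0e [q [[q' qK q'K] q1 _]]]]]] := trivial_tensor epsL eps1 epsM.
have [R [L [e ops]]] := tensor_ops_exist x T.
have [ex3 ex2 ex1 ex0] := tensor_koszul AxW XE ops.
have [RE LE eE] := ops.
have qE a : q a = a *: tn T k0 by rewrite -q1 -linearZ_LR [_ *: _]mulr1.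
have Rq i a : R i (q a) = q (a * x i) by rewrite !qE RE.
have Lq i a : L i (q a) = 0.
  rewrite qE LE k0e epsx !scale0r (additive0 (tnB T)) scaler0 //.
have qD a b : q (a + b) = q a + q b by exact: linearD.
have qN a : q (- a) = - q a by exact: linearN.
have qMn a n : q (a *+ n) = q a *+ n by exact: raddfMn.
have inj : injective q := can_inj qK.
have q0 : q 0 = 0 by exact: linear0.
have kzE a : [/\ kz_d1 (R o0) (L o0) (q a) = q (a * x1), kz_d2 (R o1) (L o1) (q a) = q (a * x2)
    & kz_d3 (R o2) (L o2) (q a) = q (a * x3)].
  by rewrite /= !Rq !Lq !subr0.
have kzM a : [/\ kz_11 (R o1) (R o2) (L o1) (L o2) (q a) = q (a * kM o0 o0),
    kz_12 (R o0) (R o2) (L o0) (L o2) (q a) = q (a * kM o1 o0)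
    & kz_13 (R o0) (R o1) (L o0) (L o1) (q a) = q (a * kM o2 o0)] /\
    [/\ kz_21 (R o0) (R o2) (L o0) (L o2) (q a) = q (a * kM o0 o1),
    kz_22 (R o1) (L o1) (q a) = q (a * kM o1 o1)
    & kz_23 (R o0) (L o0) (q a) = q (a * kM o2 o1)] /\
    [/\ kz_31 (R o0) (R o1) (L o0) (L o1) (q a) = q (a * kM o0 o2),
    kz_32 (R o0) (L o0) (q a) = q (a * kM o1 o2) & a * kM o2 o2 = 0].
  rewrite /kM !pt3E mulr0 /= !Rq !Lq.
  by do !split; rewrite ?(mulrDr, mulrN, mulrnAr) ?(qD, qN, qMn); abelian.
split=> [h hx|g gM|f fx|v ev].
- by apply: inj; rewrite q0; apply: ex3; case: (kzE h) => -> _ _; rewrite hx.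
- have [[a1 _ _] [[b1 _ _] [c1 _ _]]] := kzM (g o0).
  have [[_ a2 _] [[_ b2 _] [_ c2 _]]] := kzM (g o1).
  have [[_ _ a3] [[_ _ b3] [_ _ c3]]] := kzM (g o2).
  have {}gM j : g o0 * kM o0 j + g o1 * kM o1 j + g o2 * kM o2 j = 0 by rewrite -(gM j) sum3.
  have [|||h [h1 h2 h3]] := ex2 (q (g o0)) (q (g o1)) (q (g o2)).
  - by rewrite a1 a2 a3 -!qD gM q0.
  - by rewrite b1 b2 b3 -!qD gM q0.
  - by rewrite c1 c2 -!qD -[X in q X]addr0 -c3 gM q0.
  rewrite -(q'K h) in h1 h2 h3; have [d1 d2 d3] := kzE (q' h).
  exists (q' h) => r; apply: inj.
  by elim/ord3_ind: r; [rewrite -d1 | rewrite -d2 | rewrite -d3].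
- have [[d1 _ _] [_ d2 _] [_ _ d3]] := And3 (kzE (f o0)) (kzE (f o1)) (kzE (f o2)).
  have [|g1 [g2 [g3 [h1 h2 h3]]]] := ex1 (q (f o0)) (q (f o1)) (q (f o2)).
    by rewrite d1 d2 d3 -!qD -q0 -fx sum3.
  rewrite -(q'K g1) -(q'K g2) -(q'K g3) in h1 h2 h3.
  have [[a1 _ _] [[b1 _ _] [c1 _ _]]] := kzM (q' g1).
  have [[_ a2 _] [[_ b2 _] [_ c2 _]]] := kzM (q' g2).
  have [[_ _ a3] [[_ _ b3] [_ _ c3]]] := kzM (q' g3).
  exists (pt3 (q' g1) (q' g2) (q' g3)) => j; apply: inj; rewrite sum3 !pt3E.
  elim/ord3_ind: j; rewrite ?c3 ?addr0 !qD.
  - by rewrite -a1 -a2 -a3.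
  - by rewrite -b1 -b2 -b3.
  by rewrite -c1 -c2.
have [|f1 [f2 [f3 E]]] := ex0 (q v).
  by rewrite qE eE k0e ev !scale0r.
rewrite -(q'K f1) -(q'K f2) -(q'K f3) in E.
have [[d1 _ _] [_ d2 _] [_ _ d3]] := And3 (kzE (q' f1)) (kzE (q' f2)) (kzE (q' f3)).
exists (pt3 (q' f1) (q' f2) (q' f3)); apply: inj; rewrite sum3 !pt3E.
by rewrite E d1 d2 d3 -!qD.
Qed.

End RegularKoszul.

Section LeftKoszul.
Variables (k : fieldType) (A : algType k) (gr : nat -> A -> Prop) (x : 'I_3 -> A).
Hypothesis AxW : quadratic_algebra gr x (cusp_relations k).
Notation x1 := (x o0). Notation x2 := (x o1). Notation x3 := (x o2).

Lemma kM_complex : (forall r, \sum_j kM x r j * x j = 0) /\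
  (forall j, \sum_r x r * kM x r j = 0).
Proof.
have [x12] := cusp_alg_rel AxW; rewrite !scaler_nat => x13 x23.
split=> i; rewrite sum3 /kM; elim/ord3_ind: i; rewrite !pt3E
  !(mulrDl, mulrDr, mulrN, mulNr, mulrnAl, mulrnAr, mulr0, mul0r) ?x12 ?x13 ?x23; abelian.
Qed.

(** Reversing words and changing the sign of x1 preserves the relations. The square is a
    homomorphism fixing the generators, hence the identity. *)
Lemma antiautomorphism : exists t : A -> A,
  [/\ linear t, t 1 = 1, forall a b, t (a * b) = t b * t a,
    involutive t & [/\ t x1 = - x1, t x2 = x2 & t x3 = x3]].
Proof.
have [x12] := cusp_alg_rel AxW; rewrite !scaler_nat => x13 x23.
have [|t [tL t1 tM tx]] := @quad_antihom _ _ _ _ _ _ AxW (pt3 (- x1) x2 x3).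
  apply/cusp_relations_sum; rewrite !pt3E !(mulrN, mulNr, opprK) ?x12 ?x13 ?x23.
  split; abelian.
have t' : [/\ t x1 = - x1, t x2 = x2 & t x3 = x3] by rewrite !tx !pt3E.
exists t; split=> // a; have [f ->] := qa_onto AxW a.
have ttL : linear (t \o t) by move=> c u v; rewrite /= !tL.
have tt1 : (t \o t) 1 = 1 by rewrite /= !t1.
have ttM u v : (t \o t) (u * v) = (t \o t) u * (t \o t) v by rewrite /= !tM.
rewrite -[LHS]/((t \o t) _) (eval_free_comp x f ttL tt1 ttM).
congr (eval_free _ f); apply: boolp.funext => i.
have tN := additiveN (linear_sub tL).
by elim/ord3_ind: i; case: t' => /= e1 e2 e3; rewrite ?e1 ?e2 ?e3 ?tN ?e1 ?opprK.
Qed.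

Variable eps : A -> k.
Hypotheses (epsL : linear (eps : A -> k^o)) (eps1 : eps 1 = 1)
  (epsM : forall a b, eps (a * b) = eps a * eps b) (epsx : forall i, eps (x i) = 0).

(* The transpose of kM is again kM up to the antiautomorphism and signs. *)
Lemma left_koszul :
  [/\ forall a, x1 * a = 0 -> a = 0,
      forall u, (forall r, \sum_j kM x r j * u j = 0) -> exists a, forall r, u r = x r * a,
      forall v, \sum_r x r * v r = 0 -> exists u, forall r, v r = \sum_j kM x r j * u j
    & forall a, eps a = 0 -> exists w, a = \sum_j x j * w j].
Proof.
have [r3 r2 r1 r0] := right_koszul AxW epsL eps1 epsM epsx.
have [t [tL t1 tM tK [e1 e2 e3]]] := antiautomorphism.
have tB := linear_sub tL; have tD := additiveD tB; have tN := additiveN tB.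
have t0 := additive0 tB.
have tMn a n : t (a *+ n) = t a *+ n by elim: n => [|n IHn]; rewrite ?mulr0n // !mulrS tD IHn.
(* The signs are chosen so that t(x_r) = - s_r x_r; then t(M_rj) = s_r s_j M_jr for the entries M of
   [kM]. *)
pose s : 'I_3 -> A -> A := pt3 id -%R -%R.
have sN r : s r 0 = 0 by rewrite /s; elim/ord3_ind: r; rewrite pt3E ?oppr0.
have sK r : involutive (s r) by move=> a; rewrite /s; elim/ord3_ind: r; rewrite pt3E ?opprK.
have ts r a : t (s r a) = s r (t a) by rewrite /s; elim/ord3_ind: r; rewrite pt3E ?tN.
have tx r : t (x r) = - s r (x r).
  by rewrite /s; elim/ord3_ind: r; rewrite !pt3E ?e1 ?e2 ?e3 ?opprK.
have sMl r a b : s r (a * b) = s r a * b.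
  by rewrite /s; elim/ord3_ind: r; rewrite pt3E ?mulNr.
have sMr r a b : s r (a * b) = a * s r b.
  by rewrite /s; elim/ord3_ind: r; rewrite pt3E ?mulrN.
have sD r a b : s r (a + b) = s r a + s r b.
  by rewrite /s; elim/ord3_ind: r; rewrite pt3E ?opprD.
have tkM r j : t (kM x r j) = s r (s j (kM x j r)).
  rewrite /kM /s; elim/ord3_ind: r; elim/ord3_ind: j; rewrite !pt3E;
    by rewrite ?(tD, tN, tMn, t0, e1, e2, e3); abelian.
split=> [a xa|u uM|v xv|a ea].
- apply: (can_inj tK); rewrite t0; apply: r3; apply: (can_inj tK).
  rewrite tM tK e1 t0 mulNr xa oppr0 //.
- have [j|h hE] := r2 (fun j => s j (t (u j))).
    rewrite sum3 -[LHS](sK j) !sD.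
    have := congr1 t (uM j); rewrite t0 sum3 !tD !tM !tkM => E.
    by rewrite -[RHS](sN j) -E !sD -!sMl -!sMr !sK !sMl.
  exists (- t h) => r; apply: (can_inj tK).
  by rewrite tM tN tK tx mulrNN -sMr -hE sK.
- have [|g gE] := r1 (fun r => - s r (t (v r))).
    have := congr1 t xv; rewrite t0 !sum3 /= !tD !tM !tx => <-.
    by rewrite !(mulNr, mulrN) -!sMl -!sMr.
  exists (fun j => t (- s j (g j))) => r; apply: (can_inj tK).
  rewrite sum3 !tD !tM !tK !tkM -[t (v r)]opprK -[t (v r)](sK r).
  have := gE r; rewrite sum3 => E.
  rewrite (_ : - s r (s r (t (v r))) = s r (- s r (t (v r)))); last first.
    by rewrite /s; elim/ord3_ind: r {E}; rewrite pt3E ?opprK.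
  rewrite E !sD !opprD !(mulNr) -!sMr -!sMl !sMr !sK -!sMr //.
have [|f fE] := r0 (t a).
  move: ea; have [c [g ->]] := aug_decomp AxW a.
  have eB := linear_sub epsL; have eD := additiveD eB; have tZ := linear_Z tL.
  rewrite tD tZ t1 !eD (additive_sum eB) [X in _ + X]big1 ?addr0 => [->|i _]; last first.
    by rewrite epsM epsx mulr0.
  rewrite (additive_sum tB) (additive_sum eB) big1 ?addr0 // => i _.
  by rewrite tM epsM tx /s; elim/ord3_ind: i;
    rewrite pt3E ?opprK ?(additiveN eB) epsx ?oppr0 mul0r.
exists (fun j => - s j (t (f j))); apply: (can_inj tK).
rewrite fE !sum3 !tD !tM !tx !tN !ts !tK.
by rewrite !mulrNN -!sMl -!sMr !sK.
Qed.

End LeftKoszul.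

Section Gorenstein.
Variables (k : fieldType) (A : algType k) (gr : nat -> A -> Prop) (x : 'I_3 -> A).
Hypothesis AxW : quadratic_algebra gr x (cusp_relations k).
Variable eps : A -> k.
Hypotheses (epsL : linear (eps : A -> k^o)) (eps1 : eps 1 = 1)
  (epsM : forall a b, eps (a * b) = eps a * eps b) (epsx : forall i, eps (x i) = 0).

Let gr_graded : graded_algebra gr.
Proof. by have [X XE] := pbw AxW; exact: (cusp_graded AxW XE). Qed.
Let gr_sum := ga_sum gr_graded.
Let gr_mul := ga_mul gr_graded.
Let grx i : gr 1 (x i). Proof. exact: gen_deg1 AxW i. Qed.
Let gr0 n : gr n 0. Proof. exact: ids_gr0 gr_sum n. Qed.
Let grB n u v : gr n u -> gr n v -> gr n (u - v). Proof. exact: ids_grB gr_sum n u v. Qed.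
Let epsB := linear_sub epsL.

Lemma eps_gr n a : (0 < n)%N -> gr n a -> eps a = 0.
Proof.
case: n => // n _ /(qa_grading AxW) [c ->].
rewrite (additive_sum epsB) big1 // => t _; rewrite (linear_Z epsL).
case/tupleP: t => i t; rewrite big_cons epsM epsx mul0r; exact: scaler0.
Qed.

Definition ksize (i : nat) : nat :=
  match i with 0 => 1 | 1 => 3 | 2 => 3 | 3 => 1 | _ => 0 end.

Definition kmx (i : nat) : 'M[A]_(ksize i.+1, ksize i) :=
  match i return 'M[A]_(ksize i.+1, ksize i) with
  | 0 => \col_r x r | 1 => \matrix_(r, j) kM x r j | 2 => \row_j x j | _ => 0 end.

Lemma kmx_deg i r j : gr 1 (kmx i r j).
Proof.
case: i r j => [|[|[|i]]] r j; rewrite mxE //.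
have closed := closedD gr0 grB; have closedo := closedN gr0 grB.
rewrite /kM; elim/ord3_ind: r; elim/ord3_ind: j; rewrite !pt3E //;
  by [apply: closedo | apply: grB | apply/closedo/closed | apply/closedo/(closedMn gr0 grB)].
Qed.

Variables (K : lmodType A) (k0 : K).
Hypotheses (k0n : k0 != 0) (k0g : forall v, exists c : k, v = (c%:A : A) *: k0)
  (k0e : forall a, a *: k0 = ((eps a)%:A : A) *: k0).

Lemma k0_eq0 a : a *: k0 = 0 <-> eps a = 0.
Proof. by rewrite k0e; split=> [/(scalar_k0 k0n) //|->]; rewrite !scale0r. Qed.

Let P i : lmodType A := 'rV[A]_(ksize i).
Let dP i : {linear P i.+1 -> P i} := mulmxr (kmx i).
Let grP i : int -> P i -> Prop := row_deg gr i%:Z.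

Let koszulE (y : 'rV[A]_3) : (y *m kmx 0) 0 0 = \sum_r y 0 r * x r.
Proof. by rewrite mxE; apply: eq_bigr => r _; rewrite mxE. Qed.

Lemma koszul_resolution : exists e : {linear P 0 -> K},
  graded_resolution_of_trivial gr dP grP e.
Proof.
have [r3 r2 r1 r0] := right_koszul AxW epsL eps1 epsM epsx.
have [kMx xkM] := kM_complex AxW.
have [e eE] : {e : {linear 'rV[A]_1 -> K} | forall v, e v = v 0 0 *: k0}.
  by apply: linear_of => [u v|a u]; rewrite !mxE ?scalerBl ?scalerA.
exists e; split.
- exists k0; split=> // n a v n0 ga; have [c ->] := k0g v.
  rewrite scalerA mulr_algr -mulr_algl -scalerA; apply/eqP.
  by rewrite (k0_eq0 a).2 ?scaler0 // (eps_gr n0 ga).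
- split=> [i||y|[|[|[|i]]] y].
  + exact: projective_row.
  + move=> v; have [c ->] := k0g v; exists (const_mx c%:A).
    by rewrite eE mxE.
  + rewrite eE k0_eq0; split=> [/r0 [f fE]|[z ->]].
      exists (\row_r f r); apply/rowP => i; rewrite ord1 koszulE fE.
      by apply: eq_bigr => r _; rewrite mxE.
    rewrite koszulE (additive_sum epsB) big1 // => r _.
    by rewrite epsM epsx mulr0.
  + split=> [y0|[z ->]].
      have [|g gE] := r1 (fun r => y 0 r); first by rewrite -koszulE [y *m _]y0 mxE.
      exists (\row_r g r); apply/rowP => j; rewrite gE mxE.
      by apply: eq_bigr => r _; rewrite !mxE.
    rewrite /dP /= -mulmxA (_ : kmx 1 *m kmx 0 = 0) ?mulmx0 //.
    apply/matrixP => r j; rewrite !mxE -[RHS](kMx r).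
    by apply: eq_bigr => l _; rewrite !mxE.
  + split=> [y0|[z ->]].
      have [j|h hE] := r2 (fun r => y 0 r).
        transitivity ((y *m kmx 1) 0 j); last by rewrite [y *m _]y0 mxE.
        by rewrite [RHS]mxE; apply: eq_bigr => r _; rewrite [kmx 1 r j]mxE.
      exists (const_mx h); apply/rowP => j.
      by rewrite hE mxE big_ord1 !mxE.
    rewrite /dP /= -mulmxA (_ : kmx 2 *m kmx 1 = 0) ?mulmx0 //.
    apply/matrixP => r j; rewrite !mxE -[RHS](xkM j).
    by apply: eq_bigr => l _; rewrite !mxE.
  + split=> [y0|[z ->]]; last by rewrite /dP /= [z]thinmx0 !mul0mx.
    exists 0; rewrite linear0; apply/rowP => j; rewrite !ord1 [RHS]mxE; apply: r3.
    transitivity ((y *m kmx 2) 0 o0); last by rewrite [y *m _]y0 mxE.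
    by rewrite [RHS]mxE big_ord1 [kmx 2 _ _]mxE.
  by split=> _; [exists 0; rewrite linear0; apply: (thinmx0 y) | rewrite /dP /= [y]thinmx0 mul0mx].
- by move=> i; apply: row_ok.
- move=> i n y gy j; rewrite mxE; apply: (closed_sum (ids_gr0 (int_grading_sum gr_sum))
    (ids_grB (int_grading_sum gr_sum))) => r _.
  rewrite (_ : n - i%:Z = (n - i.+1%:Z) + 1%:Z); last by rewrite -addn1 PoszD; ring.
  by apply: (int_grading_mul gr_sum gr_mul (n := 1)) (gy r) _; apply: kmx_deg.
move=> n y n0 gy; rewrite eE; apply/k0_eq0; have := gy 0; rewrite subr0.
case: n n0 gy => [[|n]|n] //= _ _; last by move=> ->; apply: additive0 epsB.
exact: eps_gr.
Qed.

Let int0 n : int_grading gr n 0. Proof. exact: ids_gr0 (int_grading_sum gr_sum) n. Qed.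

Let homE i (f : {linear P i -> A^o}) y : f y = \sum_l y 0 l * f (delta_mx 0 l) :> A.
Proof.
rewrite [y in LHS]row_sum_delta linear_sum; apply: eq_bigr => l _.
by rewrite linearZ_LR.
Qed.

Let hom_deg_delta i n (f : {linear P i -> A^o}) l :
  hom_degree gr grP n f -> int_grading gr (i%:Z + n) (f (delta_mx 0 l)).
Proof.
apply=> j; rewrite subrr mxE eqxx /=; case: eqP => _; last exact: gr0.
by apply/(ga_connected gr_graded); exists 1; rewrite scale1r.
Qed.

Let hom_of i n (w : 'I_(ksize i) -> A) : (forall l, int_grading gr (i%:Z + n) (w l)) ->
  exists g : {linear P i -> A^o},
    hom_degree gr grP n g /\ forall y, g y = \sum_l y 0 l * w l :> A.
Proof.
move=> gw; have [g gE] : {g : {linear P i -> A^o} | forall y, g y = \sum_l y 0 l * w l :> A}.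
  apply: linear_of => [u v|a u].
    by rewrite -sumrB; apply: eq_bigr => l _; rewrite !mxE mulrBl.
  by rewrite scaler_sumr; apply: eq_bigr => l _; rewrite !mxE -mulrA.
exists g; split=> // j y gy; rewrite gE.
apply: (closed_sum int0 (ids_grB (int_grading_sum gr_sum))) => l _.
have -> : j + n = (j - i%:Z) + (i%:Z + n) by ring.
exact: (int_grading_mul gr_sum gr_mul) (gy l) (gw l).
Qed.

(** The solution [w] need not be homogeneous. Since the entries of [kmx] have degree one and the
    values of [f] are homogeneous, the component of [w] of the right degree is again a solution. *)
Let coboundaryP i n (f : {linear P i.+1 -> A^o}) (w : 'I_(ksize i) -> A) :
  hom_degree gr grP n f ->
  (forall r, f (delta_mx 0 r) = \sum_j kmx i r j * w j :> A) ->
  @coboundary k A gr P dP grP i.+1 n f.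
Proof.
move=> gf fw; have [p pP] := int_projector gr_sum.
have scale (b a : A) m : gr 1 b -> p (1 + m) (b * a) = b * p m a.
  move=> gb; exact: (@projector_scale _ _ _ (reg_gmod gr_sum gr_mul) _ 1%N b m a pP gb).
have [|g [gg gE]] := @hom_of i n (fun j => p (i%:Z + n) (w j)); first by move=> l; apply: (pj_in pP).
exists g; split=> // y; rewrite gE homE.
transitivity (\sum_r y 0 r * \sum_j kmx i r j * p (i%:Z + n) (w j)).
  apply: eq_bigr => r _; congr (_ * _).
  rewrite -(pj_id pP (hom_deg_delta r gf)) fw (additive_sum (pj_sub pP _)).
  apply: eq_bigr => j _; rewrite -scale ?addrA ?[1 + _]addrC -?PoszD ?addn1 //.
  exact: kmx_deg.
under eq_bigr do rewrite mulr_sumr; rewrite exchange_big; apply: eq_bigr => j _ /=.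
by rewrite /dP /= mxE mulr_suml; apply: eq_bigr => r _; rewrite mulrA.
Qed.

Let cocycleP i n (f : {linear P i -> A^o}) : @cocycle k A gr P dP grP i n f ->
  forall r, \sum_j kmx i r j * (f (delta_mx 0 j) : A) = 0.
Proof.
case=> _ fd r; rewrite -[RHS](fd (delta_mx 0 r)) [RHS]homE; apply: eq_bigr => j _.
by rewrite /dP /= -rowE mxE.
Qed.

(** Hom(-, A) turns rows multiplied on the right by the matrices into columns multiplied on the
    left, so the required exactness is that of [left_koszul]. *)
Lemma cusp_ext_zero i n : i != 3%N -> @Ext_zero k A gr P dP grP i n.
Proof.
have [l0 l1 l2 l3] := left_koszul AxW epsL eps1 epsM epsx.
case: i => [|[|[|[|i]]]] // _ f fc; have fd := cocycleP fc; have [gf _] := fc.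
- move=> y; rewrite homE big_ord1 (l0 (f (delta_mx 0 0))) ?mulr0 // -[RHS](fd o0).
  by rewrite big_ord1 mxE.
- have [r|a aE] := l1 (fun j => f (delta_mx 0 j)).
    by rewrite -[RHS](fd r); apply: eq_bigr => j _; rewrite [kmx 1 r j]mxE.
  apply: (@coboundaryP 0 n f (fun=> a) gf) => r.
  by rewrite big_ord1 [kmx 0 r 0]mxE aE.
- have [|u uE] := l2 (fun j => f (delta_mx 0 j)).
    by rewrite -[RHS](fd 0); apply: eq_bigr => j _; rewrite [kmx 2 0 j]mxE.
  apply: (@coboundaryP 1 n f u gf) => r.
  by rewrite uE; apply: eq_bigr => j _; rewrite [kmx 1 r j]mxE.
by apply: (@coboundaryP i.+3 n f (fun=> 0) gf) => -[].
Qed.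

Lemma cusp_ext_line : @Ext_line k A gr P dP grP 3 (- 3%:Z) /\
  forall n, n != - 3%:Z -> @Ext_zero k A gr P dP grP 3 n.
Proof.
have [l0 l1 l2 l3] := left_koszul AxW epsL eps1 epsM epsx.
have row0 (y : P 4) : y = 0 by apply: (thinmx0 y).
split=> [|n n3 f [gf _]].
  (* P_3 is generated in degree 3, so the functional with value 1 on the generator has degree -3. It
     is not a coboundary, because those take values in the augmentation ideal on the generator. *)
  have [|f0 [gf0 f0E]] := @hom_of 3 (- 3%:Z) (fun=> 1).
    by move=> l; rewrite subrr /=; apply/(ga_connected gr_graded); exists 1; rewrite scale1r.
  exists f0; split; first by split=> // y; rewrite (row0 y) !linear0.
    move=> [g [_ gE]]; have := gE (delta_mx 0 0).
    rewrite f0E homE big_ord1 mxE eqxx mulr1 => /(congr1 eps)/eqP.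
    rewrite eps1 (additive_sum epsB) big1 ?oner_eq0 // => l _.
    rewrite epsM (eps_gr (n := 1)) ?mul0r //.
    by rewrite /dP /= -rowE !mxE; apply: grx.
  move=> f [gf _]; have := @hom_deg_delta 3 _ f ord0 gf; rewrite subrr => /(ga_connected gr_graded) [c fc].
  exists c; have [|g [gg gE]] := @hom_of 2 (- 3%:Z) (fun=> 0); first by move=> l; apply: int0.
  exists g; split=> // y; rewrite gE homE f0E !big_ord1 big1 ?fc => [|l _]; last exact: mulr0.
  by rewrite mulr1 mulr_algr subrr.
(* In any other degree the value on the generator is annihilated by [eps], hence lies in the right
   ideal generated by the x_j. *)
have [|w wE] := l3 (f (delta_mx 0 0)).
  have := @hom_deg_delta 3 _ f ord0 gf; case E : (3%:Z + n) => [[|m]|m] /=.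
  - by case/eqP: n3; apply/eqP; rewrite -addr_eq0 addrC E.
  - by move=> fm; apply: (@eps_gr m.+1).
  by move=> ->; apply: additive0 epsB.
apply: (@coboundaryP 2 n f w gf) => r.
by rewrite ord1 wE; apply: eq_bigr => j _; rewrite [kmx 2 _ _]mxE.
Qed.

(** Otherwise A^3 has a projection onto its submodule A (x1, x2, x3), sending e_r to h_r (x1, x2,
    x3). As it fixes (x1, x2, x3), one gets (1 - sum_r x_r h_r) x1 = 0; right multiplication by x1
    is injective, and applying [eps] gives 1 = 0. *)
Lemma cusp_proj_dim_gt n : proj_dim_le K n -> (3 <= n)%N.
Proof.
case=> Q [dQ [eQ [Qr Q0]]]; rewrite leqNgt; apply/negP => n3.
have Kdim : proj_dim_le K 2.
  by exists Q, dQ, eQ; split=> // i i2; apply: Q0; apply: leq_trans i2.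
have [e [_ res _ _ _]] := koszul_resolution.
have [eta [eta0 etaE]] := syzygy_split (resolution_start res) Kdim.
have [r3 r2 _ _] := right_koszul AxW epsL eps1 epsM epsx.
have ker (y : P 2) : dP 1 y = 0 -> exists h, forall r, (y : 'rV[A]_3) 0 r = h * x r.
  move=> y0; apply: r2 => j; transitivity ((y *m kmx 1) 0 j); last by rewrite [y *m _]y0 mxE.
  by rewrite [RHS]mxE; apply: eq_bigr => r _; rewrite [kmx 1 r j]mxE.
have [h hE] := boolp.choice (fun r : 'I_3 => ker _ (eta0 (delta_mx 0 r : P 2))).
pose v : P 2 := \row_r x r.
have v0 : dP 1 v = 0.
  apply/rowP => j; rewrite !mxE -[RHS]((kM_complex AxW).2 j).
  by apply: eq_bigr => r _; rewrite !mxE.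
have := etaE _ v0; rewrite [v in eta v]row_sum_delta linear_sum => /rowP/(_ o0).
rewrite summxE mxE => E.
have : (1 - \sum_r x r * h r) * x o0 = 0.
  rewrite mulrBl mul1r mulr_suml -{1}E; apply/eqP; rewrite subr_eq0; apply/eqP.
  by apply: eq_bigr => r _; rewrite linearZ_LR !mxE hE mulrA.
move/r3/(congr1 eps); rewrite epsB (additive0 epsB) eps1 (additive_sum epsB) big1.
  by move/eqP; rewrite subr0 oner_eq0.
by move=> r _; rewrite epsM epsx mul0r.
Qed.

End Gorenstein.

Lemma cusp_regular (k : fieldType) (A : algType k) (gr : nat -> A -> Prop) (x : 'I_3 -> A) :
  quadratic_algebra gr x (cusp_relations k) -> regular_algebra gr 3.
Proof.
move=> AxW; have [eps [epsL eps1 epsM epsx]] := augmentation AxW.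
have [X XE] := pbw AxW.
have [K [k0 [_ [k0n k0g k0e _]]]] := trivial_tensor epsL eps1 epsM.
have [e res] := koszul_resolution AxW epsL eps1 epsM epsx k0n k0g k0e.
split.
- exact: (cusp_graded AxW XE).
- by have [c [d g]] := (cusp_growth AxW XE); exists (c * 2 ^ d)%N; apply: (g 1%N).
- split=> [M|n /(_ K)]; first exact: (cusp_proj_dim AxW M).
  exact: (cusp_proj_dim_gt AxW epsL eps1 epsM epsx k0n k0g k0e).
- exact: (cusp_growth AxW XE).
have [line zero] := cusp_ext_line AxW epsL eps1 epsM epsx.
do 5!eexists; split; first exact: res; last by exists (- 3%:Z).
by move=> i n; apply: cusp_ext_zero.
Qed.

(** * The point scheme *)

Section CuspLocus.
Variables (k : fieldType) (R : comUnitAlgType k).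
Implicit Types p q : 'I_3 -> R.

Definition cusp_eqs p q : Prop :=
  [/\ p o0 * q o1 = p o1 * q o0 + p o0 * q o0,
      p o2 * q o0 = p o0 * q o2 + p o0 * q o0 + p o1 * q o1 *+ 3
    & p o2 * q o1 = p o1 * q o2 - p o1 * q o1 *+ 3 - p o0 * q o2 *+ 2 - p o0 * q o1 *+ 2].

Lemma cusp_locusP p q : on_zero_locus (cusp_relations k) p q <-> cusp_eqs p q.
Proof. by have := cusp_relations_sum (fun i j => p i * q j); rewrite !scaler_nat. Qed.

Definition flip p : 'I_3 -> R := pt3 (- p o0) (p o1) (p o2).

Lemma flipK p : flip (flip p) =1 p.
Proof. by move=> i; rewrite /flip; elim/ord3_ind: i; rewrite !pt3E ?opprK. Qed.

Let comb (u v w a b c a' b' c' y z : R) : a = a' -> b = b' -> c = c' ->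
  y - z = u * (a - a') + v * (b - b') + w * (c - c') -> y = z.
Proof.
by move=> -> -> ->; rewrite !subrr !mulr0 !addr0 => /eqP; rewrite subr_eq0 => /eqP.
Qed.

(** The trace of the antiautomorphism on points. It reduces statements about the first factor to
    statements about the second. *)
Lemma flip_eqs p q : cusp_eqs p q -> cusp_eqs (flip q) (flip p).
Proof.
case=> E1 E2 E3; rewrite /cusp_eqs /flip !pt3E; split.
- by apply: (comb (u := 1) (v := 0) (w := 0) E1 E2 E3); ring.
- by apply: (comb (u := 0) (v := 1) (w := 0) E1 E2 E3); ring.
by apply: (comb (u := 2%:R) (v := - 2%:R) (w := -1) E1 E2 E3); ring.
Qed.

Lemma cubic_flip p : cubic 0 (flip p) = cubic 0 p.
Proof. by rewrite /cubic /flip !pt3E; ring. Qed.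

(** Cramer's rule for [cusp_eqs] as a linear system in q: the multipliers u, v and w are the rows of
    minus the adjugate matrix. *)
Lemma cusp_eqs_det p q i : cusp_eqs p q -> 3%:R * cubic 0 p * q i = 0.
Proof.
case=> E1 E2 E3; rewrite /cubic; elim/ord3_ind: i.
- apply: (comb (u := p o1 * (p o0 *+ 2 - p o1) *+ 3 - p o0 * (p o2 + p o1 *+ 3 + p o0 *+ 2))
    (v := p o0 * (p o0 *+ 2 - p o1)) (w := p o0 ^+ 2) E1 E2 E3); ring.
- apply: (comb (u := (p o2 - p o0) * (p o0 *+ 2 - p o1))
    (v := (p o1 + p o0) * (p o0 *+ 2 - p o1)) (w := (p o1 + p o0) * p o0) E1 E2 E3); ring.
apply: (comb (u := - ((p o2 - p o0) * (p o2 + p o1 *+ 3 + p o0 *+ 2)))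
  (v := - ((p o1 + p o0) * (p o2 + p o1 *+ 3 + p o0 *+ 2)))
  (w := p o0 * (p o2 - p o0) - p o1 * (p o1 + p o0) *+ 3) E1 E2 E3); ring.
Qed.

(** A row of cofactors solves the system when its determinant vanishes, and it is the only solution
    up to a unit once one cofactor is a unit. In the local ring R either p_0 is a unit or p_2 is: a
    unit p_1 makes p_0 a unit, since p_1^3 = - p_0^2 p_2. *)
Lemma cusp_eqs_exists p : local_ring R -> proj_point p -> cubic 0 p = 0 ->
  exists q, [/\ proj_point q, cusp_eqs p q &
    forall q', proj_point q' -> cusp_eqs p q' -> same_point q q'].
Proof.
move=> locR [i pi] p0.
have uniq q j : q j \is a GRing.unit -> 
    (forall q', cusp_eqs p q' -> forall l, q' l * q j = q l * q' j) ->
    forall q', proj_point q' -> cusp_eqs p q' -> same_point q q'.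
  move=> qj cross q' [l q'l] /cross E; exists (q' j / q j) => [|m]; last first.
    by rewrite mulrAC [q' j * _]mulrC -E mulrK.
  rewrite unitrM unitrV qj andbT.
  have : q' l * q j \is a GRing.unit by rewrite unitrM q'l.
  by rewrite E unitrM => /andP[].
have u3 : p o1 \is a GRing.unit -> p o0 \is a GRing.unit.
  move=> p1; have : - (p o1 ^+ 3) \is a GRing.unit by rewrite unitrN unitrX.
  rewrite (_ : - _ = p o0 * (p o0 * p o2)); first by rewrite unitrM => /andP[].
  by apply/eqP; rewrite -subr_eq0 -oppr_eq0 -p0 /cubic; apply/eqP; ring.
have [p0u|[p20 s]] : p o0 \is a GRing.unit \/ p o2 - p o0 \is a GRing.unit /\
    p o2 + p o1 *+ 3 + p o0 *+ 2 \is a GRing.unit.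
  have [p2|p2] := boolp.pselect (p o2 \is a GRing.unit); last first.
    by left; move: pi; elim/ord3_ind: i => [//|/u3 //|/p2].
  have [|//] := boolp.pselect (p o0 \is a GRing.unit); first by left.
  move=> p0n; right; split.
    by have [||//] := locR (p o2 - p o0) (p o0); rewrite ?subrK.
  have [||] := locR (p o2 + p o1 *+ 3 + p o0 *+ 2) (- (p o1 *+ 3 + p o0 *+ 2)).
  - by rewrite (_ : _ + _ = p o2) //; ring.
  - by [].
  rewrite unitrN => /locR [|]; rewrite -mulr_natl unitrM => /andP[_] // /u3 //.
(* The cross product of the first two equations; its first coordinate is - p_0^2. *)
- pose q : 'I_3 -> R := pt3 (- (p o0 ^+ 2)) (- (p o0 * (p o1 + p o0)))
    ((p o1 * (p o1 + p o0)) *+ 3 - p o0 * (p o2 - p o0)).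
  exists q; split.
  + by exists o0; rewrite /q pt3E unitrN unitrX.
  + rewrite /cusp_eqs /q !pt3E; split; [ring | ring |].
    apply/eqP; rewrite -subr_eq0; apply/eqP.
    transitivity (- (3%:R * cubic 0 p)); last by rewrite p0 mulr0 oppr0.
    by rewrite /cubic; ring.
  apply: (uniq q o0); first by rewrite /q pt3E unitrN unitrX.
  move=> q' [E1 E2 E3] l; rewrite /q; elim/ord3_ind: l; rewrite !pt3E; first by rewrite mulrC.
    by apply: (comb (u := - p o0) (v := 0) (w := 0) E1 E2 E3); ring.
  by apply: (comb (u := 3%:R * p o1) (v := p o0) (w := 0) E1 E2 E3); ring.
(* Near the cusp, the cross product of the last two equations; its last coordinate is a product of
   two units. *)
pose q : 'I_3 -> R := pt3
  (p o0 * (p o2 + p o1 *+ 3 + p o0 *+ 2) - p o1 * (p o0 *+ 2 - p o1) *+ 3)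
  (- ((p o2 - p o0) * (p o0 *+ 2 - p o1)))
  ((p o2 - p o0) * (p o2 + p o1 *+ 3 + p o0 *+ 2)).
exists q; split.
- by exists o2; rewrite /q pt3E unitrM p20.
- rewrite /cusp_eqs /q !pt3E; split; [| ring | ring].
  apply/eqP; rewrite -subr_eq0; apply/eqP.
  transitivity (- (3%:R * cubic 0 p)); last by rewrite p0 mulr0 oppr0.
  by rewrite /cubic; ring.
apply: (uniq q o2); first by rewrite /q pt3E unitrM p20.
move=> q' [E1 E2 E3] l; rewrite /q; elim/ord3_ind: l; rewrite !pt3E; last by rewrite mulrC.
  apply: (comb (u := 0) (v := p o2 + p o1 *+ 3 + p o0 *+ 2) (w := p o1 *+ 3) E1 E2 E3).
  ring.
by apply: (comb (u := 0) (v := 0) (w := p o2 - p o0) E1 E2 E3); ring.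
Qed.

End CuspLocus.

Lemma cusp_has_cuspidal (k : closedFieldType) (A : algType k) (gr : nat -> A -> Prop)
    (x : 'I_3 -> A) :
  quadratic_algebra gr x (cusp_relations k) -> 3%:R != 0 :> k ->
  has_cuspidal_point_scheme gr.
Proof.
move=> AxW n3.
pose X : mpoly.mpoly 3 k := mpoly.mpolyX k (mpoly.mnm1 o0).
pose Y : mpoly.mpoly 3 k := mpoly.mpolyX k (mpoly.mnm1 o1).
pose Z : mpoly.mpoly 3 k := mpoly.mpolyX k (mpoly.mnm1 o2).
pose F := linear_change 1%:M (Y ^+ 3 + X ^+ 2 * Z).
exists x, (cusp_relations k); split=> //; exists F; split.
  by exists 1%:M; [apply: unitmx1 | left].
have onF (R : comUnitAlgType k) (p : 'I_3 -> R) :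
    on_subscheme (fun G => G = F) p <-> cubic 0 p = 0.
  have E : mpoly.mmap (in_alg R) p F = cubic 0 p.
    rewrite (@on_cubic k R 1%:M 0 F p) ?scale0r ?addr0 //.
    by rewrite /cubic !linA1.
  by rewrite -E; split=> [|E0 G ->]; [apply | ].
split=> [_ ->|R locR].
  exists 3%N; have -> : F = Y ^+ 3 + X ^+ 2 * Z.
    rewrite /F /linear_change -[RHS]mpoly.comp_mpoly_id; congr (mpoly.comp_mpoly _ _).
    apply: eq_from_tnth => i; rewrite !tnth_mktuple (bigD1 i) //= mxE eqxx scale1r.
    by rewrite big1 ?addr0 // => j ji; rewrite mxE eq_sym (negbTE ji) scale0r.
  apply: mpoly.dhomogD.
    by apply: (mpoly.dhomogMn (d := 1)); rewrite mpoly.dhomogX /= mpoly.mdeg1.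
  apply: (mpoly.dhomogM (d := 2) (e := 1)); last by rewrite mpoly.dhomogX /= mpoly.mdeg1.
  by apply: (mpoly.dhomogMn (d := 1)); rewrite mpoly.dhomogX /= mpoly.mdeg1.
have cancel3 (c : R) : 3%:R * c = 0 -> c = 0.
  move=> c3; rewrite -[c]scale1r -(mulVf n3) -scalerA.
  by rewrite (_ : 3%:R *: c = 0) ?scaler0 // scaler_nat -mulr_natl.
have left (p q : 'I_3 -> R) : proj_point q -> on_zero_locus (cusp_relations k) p q -> cubic 0 p = 0.
  case=> i qi /cusp_locusP pq; apply: cancel3; apply: (mulIr qi).
  by rewrite (cusp_eqs_det i pq) mul0r.
have flip_proj (p : 'I_3 -> R) : proj_point p -> proj_point (flip p).
  by case=> i pi; exists i; move: pi; rewrite /flip; elim/ord3_ind: i; rewrite !pt3E ?unitrN.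
have flip_same (p q : 'I_3 -> R) : same_point p (flip q) -> same_point (flip p) q.
  case=> u uu E; exists u => // i; have := E i; rewrite /flip.
  elim/ord3_ind: i; rewrite !pt3E // => E0.
  by rewrite mulrN -E0 opprK.
have flip_locus (p q : 'I_3 -> R) : on_zero_locus (cusp_relations k) p q ->
    on_zero_locus (cusp_relations k) (flip q) (flip p).
  by rewrite !cusp_locusP; apply: flip_eqs.
have flipW (p q : 'I_3 -> R) : on_zero_locus (cusp_relations k) (flip p) q ->
    on_zero_locus (cusp_relations k) (flip q) p.
  by move/flip_locus; rewrite (boolp.funext (flipK p)).
split=> [p q pp qp pq|p pp|q qp].
- by split; apply/onF; [apply: left pq | rewrite -cubic_flip; apply: left (flip_locus _ _ pq); apply: flip_proj].
- move/onF => /(cusp_eqs_exists locR pp) [q [qp /cusp_locusP pq quniq]].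
  exists q; split=> // q' q'p /cusp_locusP; exact: quniq.
move/onF; rewrite -cubic_flip => /(cusp_eqs_exists locR (flip_proj _ qp)).
case=> p [pp /cusp_locusP pq puniq]; exists (flip p); split.
- exact: flip_proj.
- exact: flipW.
move=> p' p'p pq'; apply: flip_same; apply: puniq; first exact: flip_proj.
exact/cusp_locusP/flip_locus.
Qed.

Theorem theorem3p1 (k : closedFieldType) :
  (forall (A : algType k) (gr : nat -> A -> Prop),
     quadratic_quantum_P2 gr ->
     (3%N \in [pchar k]%R -> ~ has_cuspidal_point_scheme gr) /\
     (3%N \notin [pchar k]%R -> has_cuspidal_point_scheme gr ->
        exists (B : algType k) (grB : nat -> B -> Prop) (x : 'I_3 -> B),
          quadratic_algebra grB x (cusp_relations k) /\
          graded_isomorphic gr grB)) /\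
  (forall (A : algType k) (gr : nat -> A -> Prop) (x : 'I_3 -> A),
     quadratic_algebra gr x (cusp_relations k) ->
     quadratic_quantum_P2 gr /\
     (has_cuspidal_point_scheme gr <-> 3%N \notin [pchar k]%R)).
Proof.
have charE : (3%N \in [pchar k]) = (3%:R == 0 :> k) by [].
split=> [A gr [reg _]|A gr x AxW].
  split=> [|_ /(cuspidal_relations reg) [_ [x AxW]]].
    by rewrite charE => /eqP k3 /(cuspidal_relations reg) [/eqP].
  (* The change of generators takes place inside A, so B is A itself and the isomorphism is the
     identity. *)
  exists A, gr, x; split=> //; exists idfun; split=> //.
  by exists idfun.
have reg := cusp_regular AxW.
split; first by split=> //; exists x, (cusp_relations k).
rewrite charE; split=> [/(cuspidal_relations reg) [] //|].
exact: cusp_has_cuspidal AxW.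
Qed.
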